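(* Let $V(x)=ix^2$, $\beta\in(-1,1)$, $\delta>0$, and let $P^h_\delta$ be the perturbed operator defined in the context. Set $$\Gamma_{-1,\beta}=\Big\{E\in\mathbb{C}:\mathrm{Re}\int_{-1}^\beta(it^2-i\delta-E)^{1/2}dt=0\Big\},\qquad \Gamma_{\beta,1}=\Big\{E\in\mathbb{C}:\mathrm{Re}\int_\beta^1(it^2+i\delta-E)^{1/2}dt=0\Big\}.$$ Then: 1. Large $E\in\lim_h\mathrm{Sp}(P^h_\delta)$ are near the union $\Gamma_{-1,\beta}\cup\Gamma_{\beta,1}$: for every $\eta>0$ there is $R>0$ such that every $E\in\lim_h\mathrm{Sp}(P^h_\delta)$ with $|E|\ge R$ is at distance less than $\eta$ from $\Gamma_{-1,\beta}\cup\Gamma_{\beta,1}$. 2. The curve $\Gamma_{-1,\beta}$ tends to infinity and is asymptotic to the line $\mathbb{R}+\frac i3(\beta^2-\beta+1)-i\delta$. 3. The curve $\Gamma_{\beta,1}$ tends to infinity and is asymptotic to the line $\mathbb{R}+\frac i3(\beta^2+\beta+1)+i\delta$.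
   Context: $P^h_\delta=-h^2\frac{d^2}{dx^2}+V_{\delta,\beta}(x)$ on $L^2([-1,1])$ with $V_{\delta,\beta}(x)=ix^2+i\delta$ for $x>\beta$, $V_{\delta,\beta}(x)=ix^2-i\delta$ for $x<\beta$, and Dirichlet conditions $u(-1)=u(1)=0$ (domain $\{u\in L^2: u''\in L^2,\ u(\pm1)=0\}$). $\lim_h\mathrm{Sp}(P^h_\delta)$ is the set of all $E_0\in\mathbb{C}$ for which there exist $h_j\to0$ and $E_{h_j}\in\mathrm{Sp}(P^{h_j}_\delta)$ with $E_{h_j}\to E_0$. Square roots are chosen continuously along the interval of integration. ''Asymptotic to a line'' means that as $|E|\to\infty$ along the curve, the distance from $E$ to the line tends to $0$. *)

(* Defs.v *)
From HB Require Import structures.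
From mathcomp Require Import all_boot all_order all_algebra.
From mathcomp Require Export complex.
From mathcomp Require Export all_classical all_reals all_analysis.

Set Implicit Arguments.
Unset Strict Implicit.
Unset Printing Implicit Defensive.

Import Order.TTheory GRing.Theory Num.Theory.
Import numFieldNormedType.Exports.


Local Open Scope classical_set_scope.
Local Open Scope ring_scope.
Local Open Scope complex_scope.

(* The topology of R[i] as a numFieldType is only inferred through the alias
   R[i]^o; its balls are the usual discs.
   [ComplexField.Normc.normc z : R] is the modulus. *)

Definition cintegral (R : realType) (a b : R) (f : R -> R[i]) : R[i] :=
  (\int[lebesgue_measure]_(t in `[a, b]) complex.Re (f t))
  +i* (\int[lebesgue_measure]_(t in `[a, b]) complex.Im (f t)).

(* Elements of L^2([-1,1]) are represented by functions R -> R[i], of which only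
   the values on [-1,1], up to a null set, are relevant. *)
Definition ae_eq_I (R : realType) (f g : R -> R[i]) : Prop :=
  {ae @lebesgue_measure R, forall x : R, -1 <= x <= 1 -> f x = g x}.

Definition sqnormL2 (R : realType) (f : R -> R[i]) : \bar R :=
  (\int[lebesgue_measure]_(x in `[(-1)%R : R, 1%R])
     (ComplexField.Normc.normc (f x) ^+ 2)%:E)%E.

Definition normL2 (R : realType) (f : R -> R[i]) : R :=
  Num.sqrt (fine (sqnormL2 f)).

Definition inL2 (R : realType) (f : R -> R[i]) : Prop :=
  [/\ measurable_fun `[(-1)%R : R, 1%R] (fun x : R => complex.Re (f x)),
      measurable_fun `[(-1)%R : R, 1%R] (fun x : R => complex.Im (f x))
    & (sqnormL2 f < +oo)%E].

(* "u'' = w in L^2": u is the continuously differentiable representative of its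
   class, its derivative v is absolutely continuous, and w is a density of v. *)
Definition has_second_derivative (R : realType) (u w : R -> R[i]) : Prop :=
  inL2 w /\
  exists v : R -> R[i], forall x : R, -1 <= x <= 1 ->
    u x = u (-1) + cintegral (-1) x v /\ v x = v (-1) + cintegral (-1) x w.

(* An unbounded operator T in L^2([-1,1]) is given by its graph: [T u f] means
   that u belongs to the domain of T and that T u = f. *)
Definition resolvent_set (R : realType)
    (T : (R -> R[i]) -> (R -> R[i]) -> Prop) : set R[i] :=
  [set E | exists K : R, forall f, inL2 f ->
    exists u, [/\ T u (fun x => f x + E * u x),
                  normL2 u <= K * normL2 f
                & forall u', T u' (fun x => f x + E * u' x) -> ae_eq_I u' u]].

Definition spectrum (R : realType)
    (T : (R -> R[i]) -> (R -> R[i]) -> Prop) : set R[i] := ~` resolvent_set T.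

(* The value at x = beta is immaterial. *)
Definition Vpert (R : realType) (delta beta x : R) : R[i] :=
  if beta < x then 0 +i* (x ^+ 2 + delta)
  else 0 +i* (x ^+ 2 - delta).

Definition Pop (R : realType) (h delta beta : R) (u f : R -> R[i]) : Prop :=
  [/\ inL2 u, u (-1) = 0, u 1 = 0 &
      exists2 w, has_second_derivative u w
        & ae_eq_I f (fun x => - (h ^+ 2)%:C * w x + Vpert delta beta x * u x)].

Definition lim_spectrum (R : realType) (delta beta : R) : set R[i] :=
  [set E0 | exists (h : nat -> R) (E : nat -> R[i]),
    [/\ forall j, 0 < h j,
        h j @[j --> \oo] --> (0 : R),
        forall j, spectrum (Pop (h j) delta beta) (E j)
      & (E j : R[i]^o) @[j --> \oo] --> (E0 : R[i]^o)]].

(* { E | Re \int_a^b (W(t) - E)^(1/2) dt = 0 }, where s is a branch of the square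
   root continuous along [a, b]. *)
Definition Gamma (R : realType) (a b : R) (W : R -> R[i]) : set R[i] :=
  [set E | exists s : R -> R[i],
    [/\ {within `[a, b], continuous (s : R -> R[i]^o)},
        forall t, a <= t <= b -> s t ^+ 2 = W t - E
      & complex.Re (cintegral a b s) = 0]].

Definition Gamma_left (R : realType) (delta beta : R) : set R[i] :=
  Gamma (-1) beta (fun t => 0 +i* (t ^+ 2 - delta)).

Definition Gamma_right (R : realType) (delta beta : R) : set R[i] :=
  Gamma beta 1 (fun t => 0 +i* (t ^+ 2 + delta)).

(* dist(E, A) < eta, with the convention dist(E, set0) = +oo. *)
Definition dist_lt (R : realType) (E : R[i]) (A : set R[i]) (eta : R) : Prop :=
  exists2 z, A z & ComplexField.Normc.normc (E - z) < eta.

Definition near_at_infinity (R : realType) (A B : set R[i]) : Prop :=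
  forall eta : R, 0 < eta ->
    exists2 r : R, 0 < r & forall E, A E -> r <= ComplexField.Normc.normc E -> dist_lt E B eta.

Definition tends_to_infinity (R : realType) (A : set R[i]) : Prop :=
  exists gamma : R -> R[i],
    [/\ continuous (gamma : R -> R[i]^o), forall t, A (gamma t)
      & ComplexField.Normc.normc (gamma t) @[t --> +oo] --> +oo].

(* The line R + i c. *)
Definition hline (R : realType) (c : R) : set R[i] :=
  [set x +i* c | x in [set: R]].

(* Main.v *)
(* Only Re E -> +oo with Im E bounded matters, and there sqrt (V - E) is close to
   i sqrt (Re E), so that Re int_a^b sqrt (V - E) vanishes for exactly one value of
   Im E, which tends to the mean of Im V over [a, b]; this describes both curves.

   A point of the spectrum is an eigenvalue, since otherwise the boundary value
   problem is solved by variation of an IVP solution.  An energy identity confines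
   it to Re E >= 0 and - delta <= Im E <= 1 + delta.  On either side of the jump the
   potential is a polynomial, so the eigenfunction can be continued to a complex path
   from the end point to beta.  When Im E stays away from the mean of Im V on that
   side, a path close to the real axis can be chosen on which the phase
   int sqrt (V - E) / h has a real part of constant rate; there the WKB components a, b
   satisfy |b| <= eps |a| at beta for h small, so that h u'/u is close to + or -
   sqrt (V - E) there.  The two values obtained at beta are different because V jumps
   by 2 i delta, hence Im E must be near one of the two means. *)

(* Write nu = 1 / Re E. On the real axis the local rate of the phase is proportional to nu (Im V -
   Im E), which may change sign before the jump, so that neither WKB component dominates throughout.
   Displacing the path by O(nu) replaces this rate by its mean, up to O(nu^2). After scaling, the
   square roots on the two sides of the jump differ only by a quantity of order nu delta, so the
   cones must have aperture o(nu). The aperture is the residual of the approximate root divided by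
   the rate, which is of order nu: a first order root, with residual O(nu^2), would give only O(nu),
   whereas the second order root gives O(nu^2). A polynomial root also removes every choice of a
   branch. Hence R is fixed first, by nu being small against delta and eta, and h afterwards,
   depending on E. The change of path rests on Picard iteration: with a polynomial potential the
   iterates are polynomials in the complex variable, whose values at [beta] do not see the path. *)
Require Import Defs.
From mathcomp Require Import all_boot all_order all_algebra.
From mathcomp Require Import ring lra measurable_realfun.
Import Order.TTheory GRing.Theory Num.Theory.
Import numFieldNormedType.Exports.
Local Open Scope classical_set_scope.
Local Open Scope ring_scope.
Local Open Scope complex_scope.
Set Implicit Arguments.
Unset Strict Implicit.
Unset Printing Implicit Defensive.

(** * Picard iteration for linear systems *)

Section picard.
Context {R : realType} {I : finType}.
Local Notation mu := (@lebesgue_measure R).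
Implicit Types (a b x t : R) (f : R -> R).

Lemma integrable_itv_le a b x f : x <= b ->
  mu.-integrable `[a, b] (EFin \o f) -> mu.-integrable `[a, x] (EFin \o f).
Proof.
move=> xb; apply: integrableS => //.
by apply: subset_itvl; rewrite bnd_simp.
Qed.

Lemma within_integrable a b f : {within `[a, b], continuous f} ->
  mu.-integrable `[a, b] (EFin \o f).
Proof. by move=> cf; apply: continuous_compact_integrable => //; exact: segment_compact. Qed.

Lemma Rintegral_derive a b (f g : R -> R) : a <= b -> {within `[a, b], continuous f} ->
  {within `[a, b], continuous g} ->
  (forall t, a < t < b -> is_derive t 1 f (g t)) ->
  \int[mu]_(t in `[a, b]) g t = f b - f a.
Proof.
rewrite le_eqVlt => /predU1P[<- _ _ _|ab cf cg df].
  by rewrite set_itv1 Rintegral_set1 subrr.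
rewrite /Rintegral (@continuous_FTC2 _ _ f)//.
- split.
  + by move=> t; rewrite in_itv/= => /df[].
  + by move/continuous_within_itvP : cf => /(_ ab)[].
  + by move/continuous_within_itvP : cf => /(_ ab)[].
- by move=> t; rewrite in_itv/= => /df [h1 h2]; rewrite derive1E h2.
Qed.

Lemma is_derive_continuous f x l : is_derive x 1 f l -> {for x, continuous f}.
Proof. by move=> [df _]; apply: differentiable_continuous; apply/derivable1_diffP. Qed.

Lemma integral_expR_le a x (K : R) : a <= x -> 0 < K ->
  \int[mu]_(t in `[a, x]) expR (K * (t - a)) <= expR (K * (x - a)) / K.
Proof.
move=> ax K0.
have D (t : R) : is_derive t 1 (fun t => expR (K * (t - a)) / K) (expR (K * (t - a))).
  apply: is_derive_eq; rewrite /GRing.scale /= !(subr0, mulr1, mul1r, addr0, mulr0, scaler0, mul0r, add0r).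
  by rewrite mulrCA mulVf ?mulr1// gt_eqF.
have cE (t : R) : {for t, continuous (fun t : R => expR (K * (t - a)))}.
  by apply: continuous_comp; [apply: cvgM; [exact: cvg_cst|apply: cvgB; [exact: cvg_id|exact: cvg_cst]]|exact: continuous_expR].
rewrite (@Rintegral_derive _ _ (fun t => expR (K * (t - a)) / K))//.
- by rewrite gerBl// divr_ge0// ?expR_ge0// ltW.
- by apply: continuous_subspaceT => t; exact: is_derive_continuous (D t).
- by apply: continuous_subspaceT => t; exact: cE.
Qed.

Definition linrhs (A : I -> I -> R -> R) (F : I -> R -> R) (X : I -> R -> R)
    (i : I) (t : R) : R := \sum_j A i j t * X j t + F i t.

(** The iteration starts from 0 rather than from [x0], so that the first increment, [x0] plus the
    integral of [F], is the quantity controlled by the constant [C] below. *)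
Fixpoint picard a (A : I -> I -> R -> R) (F : I -> R -> R) (x0 : I -> R) (n : nat) (i : I) (x : R) : R :=
  if n is m.+1 then
    x0 i + \int[mu]_(t in `[a, x]) linrhs A F (picard a A F x0 m) i t
  else 0.

Lemma integrable_mul_bounded a b (M : R) f g :
  measurable_fun `[a, b] f -> (forall t, a <= t <= b -> `|f t| <= M) ->
  {within `[a, b], continuous g} ->
  mu.-integrable `[a, b] (EFin \o (fun t => f t * g t)).
Proof.
move=> mf bf cg; apply: (@integrableMr _ _ _ mu _ _ f (EFin \o g)) => //.
- exists M; split; first exact: num_real.
  by move=> y My t /=; rewrite in_itv/= => /bf /le_trans; apply; exact: ltW.
- exact: within_integrable.
Qed.

Lemma integrable_linrhs a b (M : R) (A : I -> I -> R -> R) (F X : I -> R -> R) i :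
  (forall i j, measurable_fun `[a, b] (A i j)) ->
  (forall i j t, a <= t <= b -> `|A i j t| <= M) ->
  (forall i, mu.-integrable `[a, b] (EFin \o F i)) ->
  (forall i, {within `[a, b], continuous X i}) ->
  mu.-integrable `[a, b] (EFin \o linrhs A F X i).
Proof.
move=> mA bA iF cX.
rewrite [X in integrable _ _ X](_ : _ =
  (fun t => \sum_(j <- index_enum I) (A i j t * X j t)%:E) \+ (EFin \o F i))%E; last first.
  by apply/funext => t /=; rewrite /linrhs EFinD sumEFin.
apply: integrableD => //.
by apply: integrable_sum => // j _; exact: integrable_mul_bounded (bA i j) _.
Qed.

Section existence.
Context (a b M C : R) (A : I -> I -> R -> R) (F : I -> R -> R) (x0 : I -> R).
Context (ab : a < b).
Context (M0 : 0 < M).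
Context (mA : forall i j, measurable_fun `[a, b] (A i j)).
Context (bA : forall i j t, a <= t <= b -> `|A i j t| <= M).
Context (iF : forall i, mu.-integrable `[a, b] (EFin \o F i)).
Context (hC : forall i, `|x0 i| + \int[mu]_(t in `[a, b]) `|F i t| <= C).

Let K : R := 2 * (#|I|%:R + 1) * M.
Let K0 : 0 < K. Proof. by rewrite !mulr_gt0// ltr_wpDl. Qed.
Local Notation P := (picard a A F x0).

Lemma picard_continuous n i : {within `[a, b], continuous P n i}.
Proof.
elim: n i => [|n IH] i /=; first by apply: continuous_subspaceT => t; exact: cvg_cst.
move=> x; apply: cvgD; first exact: cvg_cst.
apply: (@parameterized_integral_continuous R a b); first exact: ltW.
exact: (@integrable_linrhs _ _ M).
Qed.

(** In the norm weighted by exp (K (x - a)) one iteration contracts by 1/2: integrating the weight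
    gains 1 / K, and [K] exceeds twice the bound #|I| M of the coefficient matrix. The forcing
    cancels in all differences but the first, so it need only be integrable and enters through [C]
    alone. *)
Lemma picard_diff n i x : a <= x <= b ->
  `|P n.+1 i x - P n i x| <= C * 2^-1 ^+ n * expR (K * (x - a)).
Proof.
elim: n i x => [|n IH] i x /andP[ax xb].
  rewrite /= subr0 expr0 mulr1.
  have -> : \int[mu]_(t in `[a, x]) linrhs A F (fun=> fun=> 0) i t = \int[mu]_(t in `[a, x]) F i t.
    apply: eq_Rintegral => t _; rewrite /linrhs big1 ?add0r// => j _.
    by rewrite mulr0.
  have iFx := integrable_itv_le xb (iF i).
  apply: (@le_trans _ _ C).
    apply: (le_trans _ (hC i)); apply: (le_trans (ler_normD _ _)).
    rewrite lerD2l; apply: (le_trans (le_normr_Rintegral _ _)) => //.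
    have iFa : mu.-integrable `[a, b] (EFin \o (fun t => `|F i t|)).
      exact: (@integrable_norm _ _ _ mu _ _ (iF i)).
    have := @Rintegral_itvB R _ (BLeft a) (BRight b) x iFa.
    move=> /(_ _ _)/eqP; rewrite !bnd_simp subr_eq => /(_ ax xb)/eqP ->.
    by rewrite lerDr Rintegral_ge0.
  apply: ler_peMr; last by rewrite -expR0 ler_expR mulr_ge0 ?subr_ge0// ltW.
  by apply: le_trans (hC i); rewrite addr_ge0// Rintegral_ge0.
rewrite [P n.+2]/= [in P n.+1 i x]/=.
rewrite opprD addrACA subrr add0r.
have iP k : mu.-integrable `[a, x] (EFin \o linrhs A F (P k) i).
  by apply: (integrable_itv_le xb); apply: (@integrable_linrhs _ _ M) => // j; exact: picard_continuous.
rewrite -RintegralB//; last exact: (iP n.+1).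
have iE : mu.-integrable `[a, x] (EFin \o (fun t => expR (K * (t - a)))).
  apply: within_integrable; apply: continuous_subspaceT => t.
  by apply: continuous_comp; [apply: cvgM; [exact: cvg_cst|apply: cvgB; [exact: cvg_id|exact: cvg_cst]]|exact: continuous_expR].
apply: (le_trans (le_normr_Rintegral _ _)) => //.
  exact: (@integrableB _ _ _ mu _ _ _ _ (iP n.+1) (iP n)).
pose c := #|I|%:R * M * (C * 2^-1 ^+ n).
apply: (@le_trans _ _ (\int[mu]_(t in `[a, x]) (c * expR (K * (t - a))))).
  apply: le_Rintegral => //.
  - by apply: integrable_norm => //; exact: (@integrableB _ _ _ mu _ _ _ _ (iP n.+1) (iP n)).
  - by apply: (integrableZl _ c iE).
  - move=> t /=; rewrite in_itv/= => /andP[at_ tx].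
    have tab : a <= t <= b by rewrite at_ (le_trans tx xb).
    rewrite /linrhs opprD addrACA subrr addr0 -sumrB.
    apply: (le_trans (ler_norm_sum _ _ _)).
    apply: (@le_trans _ _ (\sum_(j : I) M * (C * 2^-1 ^+ n * expR (K * (t - a))))).
      apply: ler_sum => j _; rewrite -mulrBr normrM.
      by apply: ler_pM => //; [exact: bA|exact: IH].
    rewrite sumr_const -[_ *+ _]mulr_natl /c.
    by rewrite le_eqVlt; apply/orP; left; apply/eqP; rewrite /=; ring.
rewrite RintegralZl//.
have C0 : 0 <= C by apply: le_trans (hC i); rewrite addr_ge0// Rintegral_ge0.
have c0 : 0 <= c.
  by rewrite !mulr_ge0// ?exprn_ge0// ltW.
apply: (le_trans (ler_wpM2l c0 (integral_expR_le ax K0))).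
set e := expR _; set D := C * _ in c c0 *.
have -> : C * 2^-1 ^+ n.+1 * e = (D / 2) * e by rewrite /D exprS; ring.
have D0 : 0 <= D by rewrite mulr_ge0// exprn_ge0// invr_ge0.
rewrite mulrCA [_ * e]mulrC ler_wpM2l ?expR_ge0//.
rewrite /c /K ler_pdivrMr//.
have -> : D / 2 * (2 * (#|I|%:R + 1) * M) = (#|I|%:R * M * D) + M * D by field.
by rewrite lerDl mulr_ge0// ltW.
Qed.

Lemma picard_bound n i x : a <= x <= b ->
  `|P n i x| <= 2 * C * expR (K * (b - a)).
Proof.
move=> axb; have /andP[ax xb] := axb.
have C0 : 0 <= C by apply: le_trans (hC i); rewrite addr_ge0// Rintegral_ge0.
apply: (@le_trans _ _ (2 * C * expR (K * (x - a)))); last first.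
  by rewrite ler_wpM2l ?mulr_ge0// ler_expR ler_wpM2l ?lerD2r// ltW.
set e := expR _.
suff : `|P n i x| <= (1 - 2^-1 ^+ n) * (2 * C * e).
  move=> /le_trans; apply; rewrite -[leRHS]mul1r ler_wpM2r//.
  by rewrite !mulr_ge0// expR_ge0.
elim: n => [|n IH]; first by rewrite expr0 subrr mul0r /= normr0.
rewrite -[P n.+1 i x](subrK (P n i x)).
apply: (le_trans (ler_normD _ _)); apply: (le_trans (lerD (picard_diff n i axb) IH)).
by rewrite le_eqVlt; apply/orP; left; apply/eqP; rewrite -/e exprS; field.
Qed.

Lemma picard_cvg i x : a <= x <= b -> cvgn (fun n => P n i x).
Proof.
move=> axb; have /andP[ax xb] := axb.
have -> : (fun n => P n i x) = series (telescope (fun n => P n i x)).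
  by rewrite telescopeK; apply/funext => n /=; rewrite subr0.
apply: normed_cvg.
apply: (@series_le_cvg _ _ (geometric (C * expR (K * (x - a))) 2^-1)) => //.
- by move=> n; exact: normr_ge0.
- have C0 : 0 <= C by apply: le_trans (hC i); rewrite addr_ge0// Rintegral_ge0.
  by move=> n /=; apply: mulr_ge0; [apply: mulr_ge0 => //; exact: expR_ge0|rewrite exprn_ge0// invr_ge0].
- by move=> n; apply: (le_trans (picard_diff n i axb)); rewrite /= mulrAC.
- by apply: is_cvg_geometric_series; rewrite ger0_norm// invf_lt1// ltr1n.
Qed.

(** The coefficients are only measurable, so the limit passes under the integral by dominated
    convergence, with the uniform bound of [picard_bound]. The convergence of the iterates stays in
    the conclusion because path independence is later read off from it. *)
Lemma picard_exists : exists X : I -> R -> R,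
  [/\ forall i, {within `[a, b], continuous X i},
      forall i x, a <= x <= b ->
        X i x = x0 i + \int[mu]_(t in `[a, x]) linrhs A F X i t,
      forall i x, a <= x <= b -> P n i x @[n --> \oo] --> X i x &
      forall i x, a <= x <= b -> `|X i x| <= 2 * C * expR (K * (b - a))].
Proof.
pose X i x := limn (fun n => P n i x).
have PX i x : a <= x <= b -> P n i x @[n --> \oo] --> X i x.
  exact: picard_cvg.
have bX i x : a <= x <= b -> `|X i x| <= 2 * C * expR (K * (b - a)).
  move=> axb; have /cvg_norm/cvgr_to_le := PX i x axb; apply.
  by apply: nearW => n; exact: picard_bound.
set B := 2 * C * _ in bX.
have mP n i : measurable_fun `[a, b] (P n i).
  by apply: subspace_continuous_measurable_fun => //; exact: picard_continuous.
have rhs_cvg i x : a <= x <= b -> linrhs A F (P n) i x @[n --> \oo] --> linrhs A F X i x.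
  move=> axb; apply: cvgD; last exact: cvg_cst.
  apply: cvg_big => [|j _]; first exact: add_continuous.
  by apply: cvgM; [exact: cvg_cst|exact: PX].
have int_cvg i x : a <= x <= b -> mu.-integrable `[a, x] (EFin \o linrhs A F X i) /\
    \int[mu]_(t in `[a, x]) linrhs A F (P n) i t @[n --> \oo] -->
    \int[mu]_(t in `[a, x]) linrhs A F X i t.
  move=> axb; have /andP[ax xb] := axb.
  have iP n : mu.-integrable `[a, x] (EFin \o linrhs A F (P n) i).
    apply: (integrable_itv_le xb); apply: (@integrable_linrhs _ _ M) => // j.
    exact: picard_continuous.
  pose g (t : R) : \bar R := (#|I|%:R * (M * B) + `|F i t|)%:E.
  have ig : mu.-integrable `[a, x] g.
    apply: (@integrableD _ _ _ mu `[a, x] _ (cst (#|I|%:R * (M * B))%:E) (fun t => `|F i t|%:E)) => //.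
      by apply: within_integrable; apply: continuous_subspaceT => ?; exact: cvg_cst.
    apply: (integrable_itv_le xb); exact: (@integrable_norm _ _ _ mu _ _ (iF i)).
  have sub t : `[a, x]%classic t -> a <= t <= b.
    by rewrite /= in_itv/= => /andP[-> /le_trans]; apply.
  have mPx n : measurable_fun `[a, x] (fun t => (linrhs A F (P n) i t)%:E).
    exact: (measurable_int mu (iP n)).
  have cPx t : `[a, x]%classic t -> (linrhs A F (P n) i t)%:E @[n --> \oo] --> (linrhs A F X i t)%:E.
    move=> /sub /rhs_cvg h; apply: cvg_EFin; last exact: h.
    by apply: nearW => n.
  have bg n t : `[a, x]%classic t -> (`|(linrhs A F (P n) i t)%:E| <= g t)%E.
    move=> /sub tab; rewrite /= lee_fin; apply: (le_trans (ler_normD _ _)).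
    rewrite lerD2r; apply: (le_trans (ler_norm_sum _ _ _)).
    apply: (@le_trans _ _ (\sum_(j : I) M * B)).
      apply: ler_sum => j _; rewrite normrM; apply: ler_pM => //; first exact: bA.
      exact: picard_bound.
    by rewrite sumr_const mulr_natl.
  have mf : measurable_fun `[a, x] (fun t => (linrhs A F X i t)%:E).
    exact: (emeasurable_fun_cvg _ _ mPx cPx).
  have [||[iX _ h]] := @dominated_convergence _ _ _ mu _ (measurable_itv _) _ _ _ mPx mf _ ig _.
  - by apply: aeW => t; exact: cPx.
  - by apply: aeW => t n; exact: bg.
  split => //.
  apply: fine_cvg; rewrite fineK; first exact: h.
  exact: integrable_fin_num.
have eqX i x : a <= x <= b -> X i x = x0 i + \int[mu]_(t in `[a, x]) linrhs A F X i t.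
  move=> axb; apply: (@cvg_unique _ (@Rhausdorff R) (P n.+1 i x @[n --> \oo])).
    have := PX i x axb; rewrite -(cvg_shiftS (fun n => P n i x)); exact.
  by apply: cvgD; [exact: cvg_cst|exact: (int_cvg i x axb).2].
exists X; split => // i.
have ibX : mu.-integrable `[a, b] (EFin \o linrhs A F X i).
  by apply: (int_cvg i b _).1; rewrite lexx ltW.
apply: (@subspace_eq_continuous _ _ _ (fun x => x0 i + \int[mu]_(t in `[a, x]) linrhs A F X i t)).
  by move=> x /set_mem/=; rewrite in_itv/= => /(eqX i) e; exact/esym.
move=> x; apply: cvgD; first exact: cvg_cst.
by apply: (@parameterized_integral_continuous R a b) => //; exact: ltW.
Qed.

End existence.
End picard.

(** * Complex-valued functions of a real variable *)

Section complex_calculus.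
Context {R : realType}.
Local Notation mu := (@lebesgue_measure R).
Local Notation Re := complex.Re.
Local Notation Im := complex.Im.
Local Notation normc := ComplexField.Normc.normc.
Implicit Types (a b x t : R) (f g u v : R -> R[i]) (z : R[i]).

Definition is_cderive f x z : Prop :=
  is_derive x (1 : R) (fun t => Re (f t)) (Re z) /\
  is_derive x (1 : R) (fun t => Im (f t)) (Im z).

Definition ccontinuous a b f : Prop :=
  {within `[a, b], continuous (fun t => Re (f t))} /\
  {within `[a, b], continuous (fun t => Im (f t))}.

Definition cmeasurable a b f : Prop :=
  measurable_fun `[a, b] (fun t => Re (f t)) /\
  measurable_fun `[a, b] (fun t => Im (f t)).

Definition cintegrable a b f : Prop :=
  mu.-integrable `[a, b] (EFin \o (fun t => Re (f t))) /\
  mu.-integrable `[a, b] (EFin \o (fun t => Im (f t))).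

Lemma cReD (z w : R[i]) : Re (z + w) = Re z + Re w. Proof. by case: z w => [? ?] []. Qed.
Lemma cImD (z w : R[i]) : Im (z + w) = Im z + Im w. Proof. by case: z w => [? ?] []. Qed.
Lemma cReN (z : R[i]) : Re (- z) = - Re z. Proof. by case: z. Qed.
Lemma cImN (z : R[i]) : Im (- z) = - Im z. Proof. by case: z. Qed.
Lemma cReM (z w : R[i]) : Re (z * w) = Re z * Re w - Im z * Im w.
Proof. by case: z w => [? ?] []. Qed.
Lemma cImM (z w : R[i]) : Im (z * w) = Re z * Im w + Im z * Re w.
Proof. by case: z w => [? ?] []. Qed.

Lemma complex_ext (z w : R[i]) : Re z = Re w -> Im z = Im w -> z = w.
Proof. by case: z w => [? ?] [? ?] /= -> ->. Qed.

Lemma normc_ge0 z : 0 <= normc z.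
Proof. by case: z => x y /=; exact: sqrtr_ge0. Qed.

Lemma sqr_normcE z : normc z ^+ 2 = Re z ^+ 2 + Im z ^+ 2.
Proof. by case: z => x y /=; rewrite sqr_sqrtr// addr_ge0// sqr_ge0. Qed.

Lemma normr_Re_le z : `|Re z| <= normc z.
Proof.
rewrite -(ler_pXn2r (ltn0Sn 1)) ?nnegrE ?normc_ge0// sqr_normcE real_normK ?num_real//.
by rewrite lerDl sqr_ge0.
Qed.

Lemma normr_Im_le z : `|Im z| <= normc z.
Proof.
rewrite -(ler_pXn2r (ltn0Sn 1)) ?nnegrE ?normc_ge0// sqr_normcE real_normK ?num_real//.
by rewrite lerDr sqr_ge0.
Qed.

Lemma normc_leD z w : normc (z + w) <= normc z + normc w.
Proof. exact: (@le_normcD R z w). Qed.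

Lemma normcM z w : normc (z * w) = normc z * normc w.
Proof. exact: ComplexField.Normc.normcM. Qed.

Lemma normc_opp z : normc (- z) = normc z.
Proof. exact: (@normcN R z). Qed.

Lemma normc_real x : normc (x%:C) = `|x|.
Proof. by rewrite /= expr0n/= addr0 sqrtr_sqr. Qed.

Lemma normc_le_ReIm z : normc z <= `|Re z| + `|Im z|.
Proof.
rewrite -(ler_pXn2r (ltn0Sn 1)) ?nnegrE ?normc_ge0 ?addr_ge0// sqr_normcE.
rewrite sqrrD !real_normK ?num_real// -addrA lerD2l lerDr mulrn_wge0// mulr_ge0//.
Qed.

Lemma normc_eq0 z : (normc z == 0) = (z == 0).
Proof.
apply/eqP/eqP => [|->]; first exact: ComplexField.Normc.eq0_normc.
exact: ComplexField.Normc.normc0.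
Qed.

Lemma is_cderive_cst z x : is_cderive (fun=> z) x 0.
Proof. by split; exact: is_derive_cst. Qed.

Lemma is_cderive_real (p : R -> R) x l : is_derive x 1 p l -> is_cderive (fun t => (p t)%:C) x l%:C.
Proof. by move=> h; split => //=; exact: is_derive_cst. Qed.

Lemma is_cderiveD f g x z w : is_cderive f x z -> is_cderive g x w ->
  is_cderive (fun t => f t + g t) x (z + w).
Proof.
move=> [f1 f2] [g1 g2]; split.
  rewrite cReD (_ : (fun t => _) = (fun t => Re (f t)) + (fun t => Re (g t))).
    exact: is_deriveD.
  by apply/funext => t; rewrite cReD.
rewrite cImD (_ : (fun t => _) = (fun t => Im (f t)) + (fun t => Im (g t))).
  exact: is_deriveD.
by apply/funext => t; rewrite cImD.
Qed.

Lemma is_cderiveM f g x z w : is_cderive f x z -> is_cderive g x w ->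
  is_cderive (fun t => f t * g t) x (z * g x + f x * w).
Proof.
move=> [f1 f2] [g1 g2]; split.
  rewrite (_ : (fun t => _) = (fun t => Re (f t)) * (fun t => Re (g t)) - (fun t => Im (f t)) * (fun t => Im (g t))).
    apply: (is_derive_eq (is_deriveB (is_deriveM f1 g1) (is_deriveM f2 g2))).
    rewrite cReD !cReM /GRing.scale /=.
    by move: (Re _) (Re _) (Re _) (Re _) (Im _) (Im _) (Im _) (Im _) => *; ring.
  by apply/funext => t; rewrite cReM.
rewrite (_ : (fun t => _) = (fun t => Re (f t)) * (fun t => Im (g t)) + (fun t => Im (f t)) * (fun t => Re (g t))).
  apply: (is_derive_eq (is_deriveD (is_deriveM f1 g2) (is_deriveM f2 g1))).
  rewrite cImD !cImM /GRing.scale /=.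
  by move: (Re _) (Re _) (Re _) (Re _) (Im _) (Im _) (Im _) (Im _) => *; ring.
by apply/funext => t; rewrite cImM.
Qed.

Lemma is_cderive_eq f x z w : is_cderive f x z -> z = w -> is_cderive f x w.
Proof. by move=> h <-. Qed.

Lemma is_cderiveZ f x c z : is_cderive f x z -> is_cderive (fun t => c * f t) x (c * z).
Proof.
move=> h; apply: is_cderive_eq; first exact: is_cderiveM (is_cderive_cst c x) h.
by rewrite mul0r add0r.
Qed.

Lemma is_cderiveB f g x z w : is_cderive f x z -> is_cderive g x w ->
  is_cderive (fun t => f t - g t) x (z - w).
Proof.
move=> hf hg; rewrite (_ : (fun t => _) = (fun t => f t + (-1) * g t)).
  by rewrite -(mulN1r w); apply: is_cderiveD => //; exact: is_cderiveZ.
by apply/funext => t; rewrite mulN1r.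
Qed.

Lemma is_derive_sqr_normc f x z : is_cderive f x z ->
  is_derive x 1 (fun t => normc (f t) ^+ 2) (2 * Re (z * (f x)^*)).
Proof.
move=> [f1 f2].
rewrite (_ : (fun t => _) = (fun t => Re (f t)) * (fun t => Re (f t)) + (fun t => Im (f t)) * (fun t => Im (f t))).
  apply: (is_derive_eq (is_deriveD (is_deriveM f1 f1) (is_deriveM f2 f2))).
  rewrite cReM /GRing.scale /=.
  by case: (f x) => p q /=; case: z {f1 f2} => r s /=; ring.
by apply/funext => t; rewrite sqr_normcE.
Qed.

Lemma is_cderive_horner (p : {poly R[i]}) (f : R -> R[i]) x z : is_cderive f x z ->
  is_cderive (fun t => p.[f t]) x (p^`().[f x] * z).
Proof.
move=> df; elim/poly_ind: p => [|p c IH].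
  rewrite (_ : (fun t => _) = fun=> 0); last by apply/funext => t; rewrite horner0.
  by rewrite deriv0 horner0 mul0r; exact: is_cderive_cst.
rewrite (_ : (fun t => _) = fun t => p.[f t] * f t + c); last first.
  by apply/funext => t; rewrite hornerMXaddC.
rewrite derivD derivC addr0 derivM derivX mulr1 hornerD hornerM hornerX.
apply: is_cderive_eq; first exact: is_cderiveD (is_cderiveM IH df) (is_cderive_cst c x).
by rewrite addr0 mulrDl mulrAC.
Qed.

Lemma is_cderive_continuous f x z : is_cderive f x z ->
  {for x, continuous (fun t => Re (f t))} /\ {for x, continuous (fun t => Im (f t))}.
Proof. by move=> [h1 h2]; split; apply: is_derive_continuous; eassumption. Qed.

Lemma ccontinuous_derive a b f (df : R -> R[i]) : (forall x, is_cderive f x (df x)) -> ccontinuous a b f.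
Proof.
move=> h; split; apply: continuous_subspaceT => t.
  exact: (is_cderive_continuous (h t)).1.
exact: (is_cderive_continuous (h t)).2.
Qed.

Lemma ccontinuousD a b f g : ccontinuous a b f -> ccontinuous a b g ->
  ccontinuous a b (fun t => f t + g t).
Proof.
move=> [f1 f2] [g1 g2]; split => x.
- under [X in continuous_at _ X]eq_fun do rewrite cReD; apply: cvgD; [exact: f1|exact: g1].
- under [X in continuous_at _ X]eq_fun do rewrite cImD; apply: cvgD; [exact: f2|exact: g2].
Qed.

Lemma ccontinuousM a b f g : ccontinuous a b f -> ccontinuous a b g ->
  ccontinuous a b (fun t => f t * g t).
Proof.
move=> [f1 f2] [g1 g2]; split => x.
- under [X in continuous_at _ X]eq_fun do rewrite cReM.
  by apply: cvgB; apply: cvgM; [exact: f1|exact: g1|exact: f2|exact: g2].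
- under [X in continuous_at _ X]eq_fun do rewrite cImM.
  by apply: cvgD; apply: cvgM; [exact: f1|exact: g2|exact: f2|exact: g1].
Qed.

Lemma ccontinuous_cst a b z : ccontinuous a b (fun=> z).
Proof. by split => x; exact: cvg_cst. Qed.

Lemma ccontinuous_integrable a b f : ccontinuous a b f -> cintegrable a b f.
Proof. by move=> [f1 f2]; split; apply: within_integrable. Qed.

Lemma ccontinuous_measurable a b f : ccontinuous a b f -> cmeasurable a b f.
Proof. by move=> [f1 f2]; split; apply: subspace_continuous_measurable_fun. Qed.

Lemma within_bounded a b (p : R -> R) : {within `[a, b], continuous p} ->
  exists2 M, 0 < M & forall t, a <= t <= b -> `|p t| <= M.
Proof.
move=> cp; have /compact_bounded[M [_ hM]] := continuous_compact cp (segment_compact (a := a) (b := b)).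
exists (`|M| + 1); first by rewrite ltr_wpDl.
move=> t tab; apply: (hM (`|M| + 1)); first by rewrite ltr_pwDr// ler_norm.
by exists t => //; rewrite /= in_itv.
Qed.

Lemma ccontinuous_bounded a b f : ccontinuous a b f ->
  exists2 M, 0 < M & forall t, a <= t <= b -> normc (f t) <= M.
Proof.
move=> [/within_bounded[M1 M10 h1] /within_bounded[M2 M20 h2]].
exists (M1 + M2); first exact: addr_gt0.
by move=> t tab; apply: (le_trans (normc_le_ReIm _)); apply: lerD; [exact: h1|exact: h2].
Qed.

Lemma cintegral_derive a b f g : a <= b -> ccontinuous a b f -> ccontinuous a b g ->
  (forall t, a < t < b -> is_cderive f t (g t)) -> cintegral a b g = f b - f a.
Proof.
move=> ab [f1 f2] [g1 g2] fg; rewrite /cintegral.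
have -> : \int[mu]_(t in `[a, b]) Re (g t) = Re (f b) - Re (f a).
  by apply: (Rintegral_derive ab f1 g1) => t /fg[].
have -> : \int[mu]_(t in `[a, b]) Im (g t) = Im (f b) - Im (f a).
  by apply: (Rintegral_derive ab f2 g2) => t /fg[].
by case: (f b) => ? ?; case: (f a).
Qed.

End complex_calculus.

(** * Picard iteration for a pair of complex equations *)

Section complex_picard.
Context {R : realType}.
Local Notation mu := (@lebesgue_measure R).
Local Notation Re := complex.Re.
Local Notation Im := complex.Im.
Local Notation normc := ComplexField.Normc.normc.

(* The complex system u' = al v, v' = ga u + F is encoded as a real one over
   bool * bool: the first index selects u (false) or v (true), the second one
   the real (false) or the imaginary (true) part. *)
Definition ReIm (p : bool) (z : R[i]) : R := if p then Im z else Re z.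

Definition realified (al ga : R -> R[i]) (k l : bool * bool) (t : R) : R :=
  if k.1 == l.1 then 0 else
  let z := (if k.1 then ga else al) t in
  if k.2 == l.2 then Re z else if k.2 then Im z else - Im z.

Definition realified_forcing (F : R -> R[i]) (k : bool * bool) (t : R) : R :=
  if k.1 then ReIm k.2 (F t) else 0.

Lemma sum_bool2 (V : nmodType) (G : bool * bool -> V) :
  \sum_k G k = G (true, true) + G (true, false) + (G (false, true) + G (false, false)).
Proof.
have -> : \sum_k G k = \sum_i \sum_j G (i, j).
  by rewrite pair_bigA; apply: eq_bigr => -[].
by rewrite !big_bool.
Qed.

Lemma linrhs_realified (al ga F : R -> R[i]) (X : bool * bool -> R -> R) (u v : R -> R[i]) t :
  (forall p, X (false, p) t = ReIm p (u t)) ->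
  (forall p, X (true, p) t = ReIm p (v t)) ->
  forall k, linrhs (realified al ga) (realified_forcing F) X k t =
    ReIm k.2 (if k.1 then ga t * u t + F t else al t * v t).
Proof.
move=> hu hv [[] p]; rewrite /linrhs sum_bool2.
- rewrite /realified /realified_forcing !hu /= !mul0r addr0 add0r; case: p => /=.
    by rewrite cImD cImM addrC; congr (_ + _); rewrite addrC.
  by rewrite cReD cReM mulNr; congr (_ + _); rewrite addrC.
- rewrite /realified /realified_forcing !hv /= !mul0r !addr0; case: p => /=.
    by rewrite cImM addrC.
  by rewrite cReM mulNr addrC.
Qed.

(** [B] depends on the coefficients alone and is chosen before the forcing and the initial values:
    this uniformity later bounds the resolvent. The last clause identifies the limit of any sequence
    obeying the complex recursion, so that iterates given in closed form, such as polynomials, can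
    be used. *)
Lemma cpicard_exists (a b M : R) (al ga : R -> R[i]) : a < b -> 0 < M ->
  cmeasurable a b al -> cmeasurable a b ga ->
  (forall t, a <= t <= b -> normc (al t) <= M) ->
  (forall t, a <= t <= b -> normc (ga t) <= M) ->
  exists2 B : R, 0 <= B & forall (F : R -> R[i]) (u0 v0 : R[i]) (C : R),
    cintegrable a b F -> normc u0 <= C ->
    normc v0 + \int[mu]_(t in `[a, b]) `|Re (F t)| + \int[mu]_(t in `[a, b]) `|Im (F t)| <= C ->
  exists u v : R -> R[i],
    [/\ ccontinuous a b u /\ ccontinuous a b v,
        forall x, a <= x <= b -> u x = u0 + cintegral a x (fun t => al t * v t),
        forall x, a <= x <= b -> v x = v0 + cintegral a x (fun t => ga t * u t + F t),
        forall x, a <= x <= b -> normc (u x) <= B * C /\ normc (v x) <= B * C &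
        forall pu pv : nat -> R -> R[i],
          (forall x, pu 0%N x = 0) -> (forall x, pv 0%N x = 0) ->
          (forall n x, a <= x <= b -> pu n.+1 x = u0 + cintegral a x (fun t => al t * pv n t)) ->
          (forall n x, a <= x <= b -> pv n.+1 x = v0 + cintegral a x (fun t => ga t * pu n t + F t)) ->
          forall p x, a <= x <= b ->
            ReIm p (pu n x) @[n --> \oo] --> ReIm p (u x) /\
            ReIm p (pv n x) @[n --> \oo] --> ReIm p (v x)].
Proof.
move=> ab M0 [mal1 mal2] [mga1 mga2] bal bga.
pose A := realified al ga.
have mA k l : measurable_fun `[a, b] (A k l).
  rewrite /A /realified; case: (k.1 == l.1); first exact: measurable_cst.
  case: (k.1); case: (k.2 == l.2) => //; case: (k.2) => //; exact: measurable_funN.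
have bA k l t : a <= t <= b -> `|A k l t| <= M.
  move=> tab; rewrite /A /realified; case: (k.1 == l.1); first by rewrite normr0 ltW.
  have : normc ((if k.1 then ga else al) t) <= M by case: (k.1); [exact: bga|exact: bal].
  move: ((if k.1 then ga else al) t) => z zM.
  case: (k.2 == l.2); first exact: le_trans (normr_Re_le z) zM.
  by case: (k.2); rewrite ?normrN; exact: le_trans (normr_Im_le z) zM.
pose K : R := 2 * (#|(bool * bool)%type : finType|%:R + 1) * M.
(* The bound 2 C exp (K (b - a)) of [picard_exists], counted once for the real and once for the
   imaginary part. *)
exists (4 * expR (K * (b - a))); first by rewrite mulr_ge0// expR_ge0.
move=> F u0 v0 C [iF1 iF2] u0C v0C.
pose x0 (k : bool * bool) := ReIm k.2 (if k.1 then v0 else u0).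
have iF k : mu.-integrable `[a, b] (EFin \o realified_forcing F k).
  case: k => [[] []]; rewrite /realified_forcing //=; exact: integrable0.
have n0 p z : `|ReIm p z| <= normc z.
  by case: p => /=; [exact: normr_Im_le|exact: normr_Re_le].
have hC k : `|x0 k| + \int[mu]_(t in `[a, b]) `|realified_forcing F k t| <= C.
  case: k => [[] p]; rewrite /x0 /realified_forcing /=.
    apply: le_trans v0C; rewrite -addrA; apply: lerD; first exact: n0.
    case: p => /=.
      by rewrite lerDr Rintegral_ge0.
    by rewrite lerDl Rintegral_ge0.
  rewrite (@eq_Rintegral _ _ _ mu _ (cst 0)); last by move=> *; rewrite normr0.
  by rewrite Rintegral_cst// mul0r addr0 (le_trans (n0 _ _)).
have [X [cX eX pX bX]] := @picard_exists R _ a b M C A _ x0 ab M0 mA bA iF hC.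
pose u t := (X (false, false) t) +i* (X (false, true) t).
pose v t := (X (true, false) t) +i* (X (true, true) t).
have rhsE t k : linrhs A (realified_forcing F) X k t = ReIm k.2 (if k.1 then ga t * u t + F t else al t * v t).
  by apply: linrhs_realified => -[].
exists u, v; split.
- by split; split => /=; exact: cX.
- move=> x xab; rewrite {1}/u !eX// /cintegral /x0 /=; apply: complex_ext; rewrite ?cReD ?cImD /=.
    by congr (_ + _); apply: eq_Rintegral => t _; rewrite rhsE.
  by congr (_ + _); apply: eq_Rintegral => t _; rewrite rhsE.
- move=> x xab; rewrite {1}/v !eX// /cintegral /x0 /=; apply: complex_ext; rewrite ?cReD ?cImD /=.
    by congr (_ + _); apply: eq_Rintegral => t _; rewrite rhsE.
  by congr (_ + _); apply: eq_Rintegral => t _; rewrite rhsE.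
- move=> x xab; split; apply: (le_trans (normc_le_ReIm _)).
    apply: (le_trans (lerD (bX (false, false) x xab) (bX (false, true) x xab))).
    by rewrite le_eqVlt; apply/orP; left; apply/eqP; rewrite -/K; ring.
  apply: (le_trans (lerD (bX (true, false) x xab) (bX (true, true) x xab))).
  by rewrite le_eqVlt; apply/orP; left; apply/eqP; rewrite -/K; ring.
- move=> pu pv pu0 pv0 puS pvS.
  have pE n k x : a <= x <= b -> picard a A (realified_forcing F) x0 n k x = ReIm k.2 (if k.1 then pv n x else pu n x).
    elim: n k x => [|n IH] k x xab /=.
      by rewrite pu0 pv0; case: k => [[] []].
    have h : \int[mu]_(t in `[a, x]) linrhs A (realified_forcing F) (picard a A (realified_forcing F) x0 n) k t =
      \int[mu]_(t in `[a, x]) ReIm k.2 (if k.1 then ga t * pu n t + F t else al t * pv n t).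
      apply: eq_Rintegral => t /set_mem/=; rewrite in_itv/= => /andP[a_t tx].
      have tab : a <= t <= b by rewrite a_t (le_trans tx)//; case/andP: xab.
      by apply: linrhs_realified => p; exact: IH.
    rewrite h puS// pvS// /x0.
    by case: k {h} => [[] []] /=; rewrite ?cReD ?cImD.
  move=> p x xab; split.
    have := pX (false, p) x xab.
    rewrite (_ : (fun n => _) = fun n => ReIm p (pu n x)); last by apply/funext => n; rewrite pE.
    by case: p.
  have := pX (true, p) x xab.
  rewrite (_ : (fun n => _) = fun n => ReIm p (pv n x)); last by apply/funext => n; rewrite pE.
  by case: p.
Qed.

End complex_picard.

(** * Solutions along polynomial paths *)

Section ode_calculus.
Context {R : realType}.
Local Notation Re := complex.Re.
Local Notation Im := complex.Im.
Local Notation normc := ComplexField.Normc.normc.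
Implicit Types (a b x t : R) (f g u v : R -> R[i]) (z : R[i]).

Lemma within_itv_continuous a b x (p : R -> R) : {within `[a, b], continuous p} ->
  a < x < b -> {for x, continuous p}.
Proof.
move=> cp /andP[ax xb]; have ab := lt_trans ax xb.
move/(continuous_within_itvP _ ab) : cp => [h _ _].
by apply: h; rewrite in_itv/= ax.
Qed.

Lemma within_itvS a b c d (p : R -> R) : a <= c -> d <= b ->
  {within `[a, b], continuous p} -> {within `[c, d], continuous p}.
Proof.
move=> ac db; apply: continuous_subspaceW => x /=; rewrite !in_itv/= => /andP[cx xd].
by rewrite (le_trans ac cx) (le_trans xd db).
Qed.

Lemma ccontinuousS a b c d f : a <= c -> d <= b -> ccontinuous a b f -> ccontinuous c d f.
Proof. by move=> ac db [h1 h2]; split; exact: within_itvS ac db _. Qed.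

Lemma le_of_is_derive a b (p dp : R -> R) : a <= b -> {within `[a, b], continuous p} ->
  (forall t, a < t < b -> is_derive t 1 p (dp t)) ->
  (forall t, a < t < b -> 0 <= dp t) -> p a <= p b.
Proof.
rewrite le_eqVlt => /predU1P[-> //|ab] cp hp dp0.
have hp' x : x \in `]a, b[ -> is_derive x 1 p (dp x) by rewrite in_itv/=; exact: hp.
have [c + e] := MVT ab hp' cp.
rewrite in_itv/= => cab.
by rewrite -subr_ge0 e mulr_ge0 ?dp0// subr_ge0 ltW.
Qed.

(** The function exp (- K t) p is nonincreasing. *)
Lemma gronwall_le0 a b (K : R) (p dp : R -> R) : {within `[a, b], continuous p} ->
  (forall t, a < t < b -> is_derive t 1 p (dp t)) ->
  (forall t, a < t < b -> dp t <= K * p t) -> p a <= 0 ->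
  forall x, a <= x <= b -> p x <= 0.
Proof.
move=> cp hp dpK pa x /andP[ax xb].
pose q t := - (expR (- K * t) * p t).
pose dq t := expR (- K * t) * (K * p t - dp t).
have E t : is_derive t 1 (fun t => expR (- K * t)) (- K * expR (- K * t)).
  by apply: is_derive_eq; rewrite /GRing.scale /= !(mulr1, mulr0, addr0, add0r, mul0r) mulrC.
have : q a <= q x.
  apply: (@le_of_is_derive _ _ q dq); first exact: ax.
  - move=> t; apply: cvgN; apply: cvgM; last exact: (within_itvS (lexx a) xb cp).
    by apply: continuous_subspaceT => s; exact: is_derive_continuous (E s).
  - move=> t /andP[a_t tx]; have tab : a < t < b by rewrite a_t (lt_le_trans tx).
    apply: (is_derive_eq (is_deriveN (is_deriveM (E t) (hp t tab)))).
    by rewrite /dq /GRing.scale /=; ring.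
  - move=> t /andP[a_t tx]; have tab : a < t < b by rewrite a_t (lt_le_trans tx).
    by rewrite /dq mulr_ge0 ?expR_ge0// subr_ge0 dpK.
rewrite /q lerN2 => h.
have : expR (- K * x) * p x <= 0.
  by apply: (le_trans h); rewrite mulr_ge0_le0// expR_ge0.
by rewrite pmulr_rle0// expR_gt0.
Qed.

Lemma ccontinuous_sqr_normc a b f : ccontinuous a b f ->
  {within `[a, b], continuous (fun t => normc (f t) ^+ 2)}.
Proof.
move=> [f1 f2] x.
under [X in continuous_at _ X]eq_fun do rewrite sqr_normcE.
by apply: cvgD; rewrite expr2; apply: cvgM; [exact: f1|exact: f1|exact: f2|exact: f2].
Qed.

Lemma normc_conj z : normc z^* = normc z.
Proof. by case: z => x y /=; rewrite sqrrN. Qed.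

Lemma Re_mulconj_le (z w : R[i]) : `|Re (z * w^*)| <= normc z * normc w.
Proof.
by apply: (le_trans (normr_Re_le _)); rewrite normcM normc_conj.
Qed.

(** The energy |u|^2 + |v|^2 grows at rate at most 2 M, by 2 |u| |v| <= |u|^2 + |v|^2. Equations and
    bounds are asked on the open interval only, so that the lemma applies on either side of the jump
    of the potential. *)
Lemma linear_ode_unique a b M u v (al ga : R -> R[i]) :
  ccontinuous a b u -> ccontinuous a b v ->
  (forall t, a < t < b -> normc (al t) <= M) ->
  (forall t, a < t < b -> normc (ga t) <= M) ->
  (forall t, a < t < b -> is_cderive u t (al t * v t)) ->
  (forall t, a < t < b -> is_cderive v t (ga t * u t)) ->
  u a = 0 -> v a = 0 -> forall x, a <= x <= b -> u x = 0 /\ v x = 0.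
Proof.
move=> cu cv bal bga du dv ua va x xab.
pose p t := normc (u t) ^+ 2 + normc (v t) ^+ 2.
have : p x <= 0.
  apply: (@gronwall_le0 a b (2 * M) p (fun t => 2 * Re (al t * v t * (u t)^*) + 2 * Re (ga t * u t * (v t)^*))) xab => //.
  - by move=> t; apply: cvgD; exact: ccontinuous_sqr_normc.
  - move=> t tab; apply: is_deriveD; apply: is_derive_sqr_normc; [exact: du|exact: dv].
  - move=> t tab.
    have h1 : Re (al t * v t * (u t)^*) <= M * (normc (v t) * normc (u t)).
      apply: (le_trans (ler_norm _)); apply: (le_trans (Re_mulconj_le _ _)).
      by rewrite normcM -mulrA ler_wpM2r ?mulr_ge0 ?normc_ge0// bal.
    have h2 : Re (ga t * u t * (v t)^*) <= M * (normc (u t) * normc (v t)).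
      apply: (le_trans (ler_norm _)); apply: (le_trans (Re_mulconj_le _ _)).
      by rewrite normcM -mulrA ler_wpM2r ?mulr_ge0 ?normc_ge0// bga.
    have M0 : 0 <= M by apply: le_trans (normc_ge0 _) (bal t tab).
    rewrite /p; set U := normc (u t) in h1 h2 *; set V := normc (v t) in h1 h2 *.
    have h3 : 0 <= M * (U - V) ^+ 2 by rewrite mulr_ge0// sqr_ge0.
    nra.
  - by rewrite /p ua va ComplexField.Normc.normc0 expr0n addr0.
rewrite /p => h.
have := sqr_ge0 (normc (u x)); have := sqr_ge0 (normc (v x)) => h1 h2.
have e1 : normc (u x) ^+ 2 = 0 by apply/eqP; rewrite eq_le h2 andbT; lra.
have e2 : normc (v x) ^+ 2 = 0 by apply/eqP; rewrite eq_le h1 andbT; lra.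
split; apply/eqP; rewrite -normc_eq0.
  by move/eqP : e1; rewrite expf_eq0.
by move/eqP : e2; rewrite expf_eq0.
Qed.

Lemma is_cderive_cintegral a b f x : cintegrable a b f -> a < x < b ->
  {for x, continuous (fun t => Re (f t))} -> {for x, continuous (fun t => Im (f t))} ->
  is_cderive (fun y => cintegral a y f) x (f x).
Proof.
move=> [i1 i2] /andP[ax xb] c1 c2; split.
  have [d e] := @continuous_FTC1_closed R _ a x b xb i1 ax c1.
  exact: (DeriveDef d (etrans (esym (derive1E _ _)) e)).
have [d e] := @continuous_FTC1_closed R _ a x b xb i2 ax c2.
exact: (DeriveDef d (etrans (esym (derive1E _ _)) e)).
Qed.

Lemma is_cderive_near_eq a b f g x z : a < x < b ->
  (forall y, a <= y <= b -> f y = g y) -> is_cderive g x z -> is_cderive f x z.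
Proof.
move=> /andP[ax xb] fg [h1 h2].
have nE : \forall y \near x, f y = g y.
  near=> y; apply: fg; apply/andP; split; apply: ltW.
    by near: y; exact: lt_nbhsr.
  by near: y; exact: lt_nbhsl.
split.
  by apply: near_eq_is_derive h1; apply: filterS nE => y ->.
by apply: near_eq_is_derive h2; apply: filterS nE => y ->.
Unshelve. all: by end_near. Qed.

Lemma cintegral_itv1 a f : cintegral a a f = 0.
Proof. by rewrite /cintegral set_itv1 !Rintegral_set1. Qed.

End ode_calculus.

(** * Path independence by polynomial Picard iterates *)

Section polynomial_paths.
Context {R : realType}.
Local Notation Re := complex.Re.
Local Notation Im := complex.Im.
Local Notation normc := ComplexField.Normc.normc.
Implicit Types (Z G : {poly R[i]}) (U V : R -> R[i]) (t : R).

Definition on_path Z t : R[i] := Z.[t%:C].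

(* U(t) = u(Z(t)) and V(t) = u'(Z(t)) for a solution u of u'' = G u. *)
Definition path_ode G Z U V : Prop :=
  [/\ ccontinuous 0 1 U, ccontinuous 0 1 V &
    forall t, 0 < t < 1 -> is_cderive U t (on_path Z^`() t * V t) /\
      is_cderive V t (on_path Z^`() t * G.[on_path Z t] * U t)].

Lemma is_cderive_on_path Z t : is_cderive (on_path Z) t (on_path Z^`() t).
Proof.
have h : is_cderive (fun s : R => s%:C) t 1 by apply: is_cderive_real; exact: is_derive_id.
apply: is_cderive_eq; first exact: (is_cderive_horner Z h).
by rewrite mulr1.
Qed.

Lemma is_cderive_poly_path (p : {poly R[i]}) Z t :
  is_cderive (fun t => p.[on_path Z t]) t (p^`().[on_path Z t] * on_path Z^`() t).
Proof. exact/is_cderive_horner/is_cderive_on_path. Qed.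

Lemma ccontinuous_on_path a b Z : ccontinuous a b (on_path Z).
Proof. exact: ccontinuous_derive (is_cderive_on_path Z). Qed.

Lemma ccontinuous_poly_path a b (p : {poly R[i]}) Z : ccontinuous a b (fun t => p.[on_path Z t]).
Proof. exact: ccontinuous_derive (is_cderive_poly_path p Z). Qed.

(** The primitive vanishing at 0: for i = 0 the quotient is a division by 0, hence 0. *)
Definition primitive (p : {poly R[i]}) : {poly R[i]} :=
  \poly_(i < (size p).+1) (p`_i.-1 / i%:R).

Lemma deriv_primitive p : (primitive p)^`() = p.
Proof.
apply/polyP => i; rewrite coef_deriv coef_poly ltnS /=.
case: ltnP => [ip|pi]; last by rewrite mul0rn nth_default.
by rewrite -[_ *+ _]mulr_natr mulfVK// pnatr_eq0.
Qed.

(** Iterates for u' = v, v' = G u in the complex variable, integrated from the base point [c]; no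
    path enters. *)
Fixpoint poly_picard G (c u0 v0 : R[i]) n : {poly R[i]} * {poly R[i]} :=
  if n is m.+1 then
    let: (p, q) := poly_picard G c u0 v0 m in
    (u0%:P + primitive q - (primitive q).[c]%:P,
     v0%:P + primitive (G * p) - (primitive (G * p)).[c]%:P)
  else (0, 0).

(** The integral of Z' q(Z) is the difference of a primitive of q at the end points, so the iterates
    of the system pulled back to the path are the polynomials [poly_picard] composed with [Z]. They
    see the path only through its starting point. *)
Lemma path_ode_exists G Z (u0 v0 : R[i]) : exists U V,
  [/\ path_ode G Z U V, U 0 = u0, V 0 = v0 &
    forall p t, 0 <= t <= 1 ->
      ReIm p (poly_picard G Z.[0] u0 v0 n).1.[on_path Z t] @[n --> \oo] --> ReIm p (U t) /\
      ReIm p (poly_picard G Z.[0] u0 v0 n).2.[on_path Z t] @[n --> \oo] --> ReIm p (V t)].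
Proof.
pose al := on_path Z^`().
pose ga t := on_path Z^`() t * G.[on_path Z t].
have cal : ccontinuous 0 1 al by exact: ccontinuous_on_path.
have cga : ccontinuous 0 1 ga.
  by apply: ccontinuousM; [exact: ccontinuous_on_path|exact: ccontinuous_poly_path].
have [M1 M10 bal] := ccontinuous_bounded cal.
have [M2 M20 bga] := ccontinuous_bounded cga.
have M0 : 0 < M1 + M2 by exact: addr_gt0.
have bal' t : 0 <= t <= 1 -> normc (al t) <= M1 + M2.
  by move=> /bal /le_trans; apply; rewrite lerDl ltW.
have bga' t : 0 <= t <= 1 -> normc (ga t) <= M1 + M2.
  by move=> /bga /le_trans; apply; rewrite lerDr ltW.
have [B _ ex] := cpicard_exists ltr01 M0 (ccontinuous_measurable cal) (ccontinuous_measurable cga) bal' bga'.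
have i0 : cintegrable (0 : R) 1 (fun _ => 0 : R[i]).
  exact: ccontinuous_integrable (ccontinuous_cst _ _ _).
have I0 : normc v0 + \int[lebesgue_measure]_(t in `[(0 : R), 1]) `|Re (0 : R[i])| +
    \int[lebesgue_measure]_(t in `[(0 : R), 1]) `|Im (0 : R[i])| <= normc u0 + normc v0.
  by rewrite !normr0 !Rintegral_cst//= !mul0r !addr0 lerDr normc_ge0.
have u0C : normc u0 <= normc u0 + normc v0 by rewrite lerDl normc_ge0.
have [U [V [[cU cV] eU eV _ lim]]] := ex (fun=> 0) u0 v0 _ i0 u0C I0.
have cont_al_V : ccontinuous 0 1 (fun t => al t * V t) by exact: ccontinuousM.
have cont_ga_U : ccontinuous 0 1 (fun t => ga t * U t + 0).
  by apply: ccontinuousD; [exact: ccontinuousM|exact: ccontinuous_cst].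
have deq (W w : R -> R[i]) (w0 : R[i]) : ccontinuous 0 1 w ->
    (forall x, 0 <= x <= 1 -> W x = w0 + cintegral 0 x w) ->
    forall t, 0 < t < 1 -> is_cderive W t (w t).
  move=> cw eW t t01.
  have h : is_cderive (fun x => w0 + cintegral 0 x w) t (w t).
    rewrite -[w t]add0r; apply: is_cderiveD; first exact: is_cderive_cst.
    apply: (is_cderive_cintegral (ccontinuous_integrable cw) t01).
      exact: (within_itv_continuous cw.1 t01).
    exact: (within_itv_continuous cw.2 t01).
  exact: (is_cderive_near_eq t01 eW h).
exists U, V; split.
- split => // t t01; split; first exact: (deq _ _ u0 cont_al_V eU).
  by have := deq _ _ v0 cont_ga_U eV t t01; rewrite addr0.
- by rewrite eU ?lexx ?ler01// cintegral_itv1 addr0.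
- by rewrite eV ?lexx ?ler01// cintegral_itv1 addr0.
- apply: lim => [x|x|n x /andP[x0 x1]|n x /andP[x0 x1]].
  + by rewrite horner0.
  + by rewrite horner0.
  + rewrite (@cintegral_derive _ _ _ (fun t => (primitive (poly_picard G Z.[0] u0 v0 n).2).[on_path Z t]))//.
    * by rewrite /=; case: poly_picard => p q /=; rewrite !(hornerD, hornerN, hornerC) addrA.
    * exact: ccontinuous_poly_path.
    * apply: ccontinuousM; [exact: ccontinuous_on_path|exact: ccontinuous_poly_path].
    * move=> t _; apply: is_cderive_eq; first exact: is_cderive_poly_path.
      by rewrite deriv_primitive mulrC.
  + rewrite (@cintegral_derive _ _ _ (fun t => (primitive (G * (poly_picard G Z.[0] u0 v0 n).1)).[on_path Z t]))//.
    * by rewrite /=; case: poly_picard => p q /=; rewrite !(hornerD, hornerN, hornerC) addrA.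
    * exact: ccontinuous_poly_path.
    * apply: ccontinuousD; last exact: ccontinuous_cst.
      apply: ccontinuousM; last exact: ccontinuous_poly_path.
      by apply: ccontinuousM; [exact: ccontinuous_on_path|exact: ccontinuous_poly_path].
    * move=> t _; apply: is_cderive_eq; first exact: is_cderive_poly_path.
      by rewrite deriv_primitive hornerM addr0 /ga mulrC mulrA.
Qed.

Lemma path_ode_unique G Z U1 V1 U2 V2 : path_ode G Z U1 V1 -> path_ode G Z U2 V2 ->
  U1 0 = U2 0 -> V1 0 = V2 0 -> forall t, 0 <= t <= 1 -> U1 t = U2 t /\ V1 t = V2 t.
Proof.
move=> [cU1 cV1 d1] [cU2 cV2 d2] U0 V0.
have cal : ccontinuous 0 1 (on_path Z^`()) by exact: ccontinuous_on_path.
have cga : ccontinuous 0 1 (fun t => on_path Z^`() t * G.[on_path Z t]).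
  by apply: ccontinuousM; [exact: ccontinuous_on_path|exact: ccontinuous_poly_path].
have [M1 M10 bal] := ccontinuous_bounded cal.
have [M2 M20 bga] := ccontinuous_bounded cga.
have cB f g : ccontinuous (0:R) 1 f -> ccontinuous 0 1 g -> ccontinuous 0 1 (fun t => f t - g t).
  move=> cf cg; rewrite (_ : (fun t => _) = (fun t => f t + (-1) * g t)); last first.
    by apply/funext => s; rewrite mulN1r.
  by apply: ccontinuousD => //; apply: ccontinuousM => //; exact: ccontinuous_cst.
have lt_le t : 0 < t < 1 -> (0 : R) <= t <= 1 by move=> /andP[/ltW -> /ltW ->].
move=> t t01.
have [] := @linear_ode_unique R 0 1 (M1 + M2) (fun t => U1 t - U2 t) (fun t => V1 t - V2 t)
  (on_path Z^`()) (fun t => on_path Z^`() t * G.[on_path Z t]) (cB _ _ cU1 cU2) (cB _ _ cV1 cV2) _ _ _ _ _ _ t t01.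
- by move=> s /lt_le /bal /le_trans; apply; rewrite lerDl ltW.
- by move=> s /lt_le /bga /le_trans; apply; rewrite lerDr ltW.
- by move=> s s01; rewrite mulrBr; apply: is_cderiveB; [exact: (d1 s s01).1|exact: (d2 s s01).1].
- by move=> s s01; rewrite mulrBr; apply: is_cderiveB; [exact: (d1 s s01).2|exact: (d2 s s01).2].
- by rewrite U0 subrr.
- by rewrite V0 subrr.
by move=> /eqP + /eqP; rewrite !subr_eq0 => /eqP -> /eqP ->.
Qed.

(* Both sides are limits of the same sequence of polynomials, evaluated at the
   common endpoints of the two paths. *)
Lemma path_ode_independent G Z1 Z2 U1 V1 U2 V2 :
  path_ode G Z1 U1 V1 -> path_ode G Z2 U2 V2 ->
  Z1.[0] = Z2.[0] -> Z1.[1] = Z2.[1] ->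
  U1 0 = U2 0 -> V1 0 = V2 0 -> U1 1 = U2 1 /\ V1 1 = V2 1.
Proof.
move=> o1 o2 Z0 Z1E U0 V0.
have [U1' [V1' [p1 U10 V10 lim1]]] := path_ode_exists G Z1 (U1 0) (V1 0).
have [U2' [V2' [p2 U20 V20 lim2]]] := path_ode_exists G Z2 (U1 0) (V1 0).
have I1 : (0 : R) <= 1 <= (1 : R).
  by apply/andP; split; [exact: ler01|exact: lexx].
have e1 : on_path Z1 1 = on_path Z2 1 by exact: Z1E.
have [-> ->] := path_ode_unique o1 p1 (esym U10) (esym V10) I1.
have [-> ->] := path_ode_unique o2 p2 (etrans (esym U0) (esym U20)) (etrans (esym V0) (esym V20)) I1.
have eP p : ReIm p (U1' 1) = ReIm p (U2' 1) /\ ReIm p (V1' 1) = ReIm p (V2' 1).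
  have [l1 l1'] := lim1 p 1 I1; have [l2 l2'] := lim2 p 1 I1.
  rewrite -Z0 -e1 in l2 l2'.
  by split; [exact: (@cvg_unique _ (@Rhausdorff R) _ _ _ _ l1 l2)|exact: (@cvg_unique _ (@Rhausdorff R) _ _ _ _ l1' l2')].
by split; apply: complex_ext; [exact: (eP false).1|exact: (eP true).1|exact: (eP false).2|exact: (eP true).2].
Qed.

End polynomial_paths.

(** * Entering the cone *)

Section cone.
Context {R : realType}.
Local Notation Re := complex.Re.
Local Notation normc := ComplexField.Normc.normc.
Implicit Types (a b th ea eb : R -> R[i]).

Lemma le_add_of_is_derive (c : R) (p dp : R -> R) : {within `[(0 : R), 1], continuous p} ->
  (forall t : R, 0 < t < 1 -> is_derive t 1 p (dp t)) ->
  (forall t : R, 0 < t < 1 -> c <= dp t) -> p 0 + c <= p 1.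
Proof.
move=> cp hp dpc.
have L (t : R) : is_derive t 1 (fun t : R => c * t) c.
  by apply: is_derive_eq; rewrite /GRing.scale /= !(mulr1, mulr0, addr0, add0r, mul0r).
have : p 0 - c * 0 <= p 1 - c * 1.
  apply: (@le_of_is_derive _ 0 1 (fun t => p t - c * t) (fun t => dp t - c)); first exact: ler01.
  - move=> t; apply: cvgB; first exact: cp.
    by apply: continuous_subspaceT => s; exact: is_derive_continuous (L s).
  - by move=> t t01; exact: is_deriveB (hp t t01) (L t).
  - by move=> t t01; rewrite subr_ge0 dpc.
by rewrite mulr0 subr0 mulr1 lerBrDr.
Qed.

Lemma le_prefix_of_is_derive (p dp : R -> R) (s : R) : {within `[(0 : R), 1], continuous p} ->
  (forall t : R, 0 < t < 1 -> is_derive t 1 p (dp t)) ->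
  (forall t : R, 0 < t < 1 -> 0 <= dp t) -> 0 <= s <= 1 -> p 0 <= p s.
Proof.
move=> cp hp dp0 /andP[s0 s1].
apply: (@le_of_is_derive _ 0 s p dp) => //.
- exact: (within_itvS (lexx 0) s1 cp).
- by move=> t /andP[t0 ts]; apply: hp; rewrite t0 (lt_le_trans ts).
- by move=> t /andP[t0 ts]; apply: dp0; rewrite t0 (lt_le_trans ts).
Qed.

Lemma Re_mul_conj_self (z : R[i]) (w : R[i]) : Re (w * z * z^*) = Re w * normc z ^+ 2.
Proof.
rewrite sqr_normcE; case: z w => [x y] [p q] /=; ring.
Qed.

(* If th drives a to grow and b to decay, the cone |b| <= eps |a| is entered after
   a time O(H / (g eps^2)) by a trajectory starting from |a| = |b|. *)
Lemma cone_entrance (H g tau eps : R) a b th ea eb :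
  0 < H -> 0 < g -> 0 < eps <= 1 -> 0 <= tau -> 8 * tau <= g * eps -> H <= g * eps ^+ 2 ->
  ccontinuous 0 1 a -> ccontinuous 0 1 b ->
  (forall t : R, 0 < t < 1 -> is_cderive a t (H^-1%:C * (th t * a t + ea t))) ->
  (forall t : R, 0 < t < 1 -> is_cderive b t (H^-1%:C * (- th t * b t + eb t))) ->
  (forall t : R, 0 < t < 1 -> g <= Re (th t)) ->
  (forall t : R, 0 < t < 1 -> normc (ea t) <= tau * (normc (a t) + normc (b t))) ->
  (forall t : R, 0 < t < 1 -> normc (eb t) <= tau * (normc (a t) + normc (b t))) ->
  normc (a 0) = normc (b 0) ->
  normc (b 1) <= eps * normc (a 1) /\ normc (a 0) <= normc (a 1).
Proof.
move=> H0 g0 /andP[eps0 eps1] tau0 htau hH ca cb da db hth hea heb ab0.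
pose A t := normc (a t); pose B t := normc (b t).
pose dA t := 2 * Re (H^-1%:C * (th t * a t + ea t) * (a t)^*).
pose dB t := 2 * Re (H^-1%:C * (- th t * b t + eb t) * (b t)^*).
have hA (t : R) : 0 < t < 1 -> is_derive t 1 (fun t => A t ^+ 2) (dA t) by move=> /da; exact: is_derive_sqr_normc.
have hB (t : R) : 0 < t < 1 -> is_derive t 1 (fun t => B t ^+ 2) (dB t) by move=> /db; exact: is_derive_sqr_normc.
have cA : {within `[(0 : R), 1], continuous (fun t => A t ^+ 2)} by exact: ccontinuous_sqr_normc.
have cB : {within `[(0 : R), 1], continuous (fun t => B t ^+ 2)} by exact: ccontinuous_sqr_normc.
have A0 t : 0 <= A t by exact: normc_ge0.
have B0 t : 0 <= B t by exact: normc_ge0.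
have real_mul (x : R) (z : R[i]) : Re (x%:C * z) = x * Re z by case: z => p q /=; ring.
have Hi : 0 < 2 * H^-1 by rewrite mulr_gt0// invr_gt0.
have bdA (t : R) : 0 < t < 1 -> 2 * H^-1 * (g * A t ^+ 2 - tau * (A t + B t) * A t) <= dA t.
  move=> t01; rewrite /dA -(mulrA (H^-1)%:C) real_mul [leRHS]mulrA ler_pM2l; last exact: Hi.
  rewrite mulrDl cReD Re_mul_conj_self; apply: lerD.
    by rewrite ler_wpM2r ?sqr_ge0// hth.
  have := Re_mulconj_le (ea t) (a t); rewrite ler_norml => /andP[h _].
  by apply: le_trans h; rewrite lerN2; apply: ler_wpM2r; [exact: A0|exact: hea].
have bdB (t : R) : 0 < t < 1 -> dB t <= 2 * H^-1 * (- (g * B t ^+ 2) + tau * (A t + B t) * B t).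
  move=> t01; rewrite /dB -(mulrA (H^-1)%:C) real_mul [leLHS]mulrA ler_pM2l; last exact: Hi.
  rewrite mulrDl cReD Re_mul_conj_self; apply: lerD.
    by rewrite cReN mulNr lerN2 ler_wpM2r ?sqr_ge0// hth.
  have := Re_mulconj_le (eb t) (b t); rewrite ler_norml => /andP[_ h].
  by apply: (le_trans h); apply: ler_wpM2r; [exact: B0|exact: heb].
have tau_g : 8 * tau <= g by apply: (le_trans htau); rewrite ler_piMr// ltW.
(* |a|^2 - |b|^2 starts at 0 and is nondecreasing, because 8 tau <= g. *)
have AB (t : R) : 0 <= t <= 1 -> B t <= A t.
  move=> t01.
  have : A 0 ^+ 2 - B 0 ^+ 2 <= A t ^+ 2 - B t ^+ 2.
    apply: (@le_prefix_of_is_derive (fun t => A t ^+ 2 - B t ^+ 2) (fun t => dA t - dB t)) => //.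
    - by move=> s; apply: cvgB; [exact: cA|exact: cB].
    - by move=> s s01; exact: is_deriveB (hA s s01) (hB s s01).
    - move=> s s01; rewrite subr_ge0; apply: (le_trans (bdB s s01)); apply: le_trans (bdA s s01).
      rewrite ler_pM2l// -subr_ge0.
      have -> : g * A s ^+ 2 - tau * (A s + B s) * A s - (- (g * B s ^+ 2) + tau * (A s + B s) * B s) =
        (g - 8 * tau) * (A s ^+ 2 + B s ^+ 2) + tau * (6 * (A s ^+ 2 + B s ^+ 2) + (A s - B s) ^+ 2) by ring.
      apply: addr_ge0; apply: mulr_ge0 => //; rewrite ?subr_ge0//.
        by do ?[exact: sqr_ge0|apply: addr_ge0].
      by do ?[exact: sqr_ge0|apply: addr_ge0|apply: mulr_ge0].
  have -> : A 0 = B 0 by exact: ab0.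
  by rewrite subrr subr_ge0 ler_pXn2r ?nnegrE.
have lt_le (t : R) : 0 < t < 1 -> (0 : R) <= t <= 1 by move=> /andP[/ltW -> /ltW ->].
have A0t (t : R) : 0 <= t <= 1 -> A 0 <= A t.
  move=> t01; rewrite -(ler_pXn2r (ltn0Sn 1)) ?nnegrE//.
  apply: (@le_prefix_of_is_derive (fun t => A t ^+ 2) dA) => // s s01.
  apply: le_trans (bdA s s01); rewrite pmulr_rge0//.
  have ABs := AB s (lt_le s s01).
  have -> : g * A s ^+ 2 - tau * (A s + B s) * A s =
     (g - 8 * tau) * A s ^+ 2 + tau * A s * (6 * A s + (A s - B s)) by ring.
  have s1 : 0 <= A s - B s by rewrite subr_ge0.
  have s2 : 0 <= g - 8 * tau by rewrite subr_ge0.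
  by do ?[exact: sqr_ge0|exact: s1|exact: s2|exact: A0|apply: addr_ge0|apply: mulr_ge0].
split; last by apply: A0t; apply/andP; split; [exact: ler01|exact: lexx].
(* The cone is the set where [p] is nonnegative. At the start p >= - |a 0|^2, and its derivative is
   at least g eps^2 |a|^2 / H >= |a 0|^2, so unit time suffices. *)
pose p t := eps ^+ 2 * A t ^+ 2 - B t ^+ 2.
have key : p 0 + A 0 ^+ 2 <= p 1.
  apply: (@le_add_of_is_derive _ p (fun t => eps ^+ 2 * dA t - dB t)).
  - by move=> t; apply: cvgB; [apply: cvgM; [exact: cvg_cst|exact: cA]|exact: cB].
  - move=> t t01; apply: is_deriveB; last exact: hB.
    apply: (is_derive_eq (is_deriveM (is_derive_cst (eps ^+ 2) t 1) (hA t t01))).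
    by rewrite /GRing.scale /= mulr0 addr0.
  - move=> t t01; have ABt := AB t (lt_le t t01); have A0A := A0t t (lt_le t t01).
    have e2 : 0 <= eps ^+ 2 by exact: sqr_ge0.
    have h1 := ler_wpM2l e2 (bdA t t01); have h2 := bdB t t01.
    apply: (@le_trans _ _ (2 * H^-1 * (eps ^+ 2 * (g * A t ^+ 2 - tau * (A t + B t) * A t)
       - (- (g * B t ^+ 2) + tau * (A t + B t) * B t)))); last first.
      rewrite mulrBr; apply: lerB => //; by rewrite mulrCA.
    set x := A t in ABt A0A *; set y := B t in ABt *.
    have x0 : 0 <= x by exact: A0. have y0 : 0 <= y by exact: B0.
    have m1 : 2^-1 * (g * eps ^+ 2) * x ^+ 2 <= eps ^+ 2 * (g * x ^+ 2 - tau * (x + y) * x) - (- (g * y ^+ 2) + tau * (x + y) * y).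
      have k1 : tau * (x + y) * (eps ^+ 2 * x + y) <= tau * (2 * x) * (eps ^+ 2 * x + y).
        apply: ler_wpM2r; first by rewrite addr_ge0// mulr_ge0.
        by apply: ler_wpM2l => //; lra.
      have k2 : 8 * tau * (x * y) <= g * eps * (x * y) by rewrite ler_wpM2r// mulr_ge0.
      have k3 : 8 * tau * (eps ^+ 2 * x ^+ 2) <= g * (eps ^+ 2 * x ^+ 2) by rewrite ler_wpM2r// mulr_ge0 ?sqr_ge0.
      have k4 : 0 <= g * (eps * x - y) ^+ 2 by rewrite mulr_ge0 ?sqr_ge0// ltW.
      have k5 : 0 <= g * y ^+ 2 by rewrite mulr_ge0 ?sqr_ge0// ltW.
      have k6 : 0 <= g * eps ^+ 2 * x ^+ 2 by rewrite !mulr_ge0 ?sqr_ge0// ltW.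
      by nra.
    apply: (@le_trans _ _ (2 * H^-1 * (2^-1 * (g * eps ^+ 2) * x ^+ 2))); last by rewrite ler_pM2l.
    have -> : 2 * H^-1 * (2^-1 * (g * eps ^+ 2) * x ^+ 2) = (g * eps ^+ 2 / H) * x ^+ 2 by field; rewrite gt_eqF.
    apply: (@le_trans _ _ (x ^+ 2)); first by rewrite ler_pXn2r ?nnegrE//.
    by rewrite ler_peMl ?sqr_ge0// ler_pdivlMr// mul1r.
have : 0 <= p 1.
  apply: le_trans key; rewrite /p (_ : B 0 = A 0); last by rewrite /A ab0.
  by rewrite subrK mulr_ge0 ?sqr_ge0.
by rewrite /p subr_ge0 -exprMn ler_pXn2r ?nnegrE// mulr_ge0// ltW.
Qed.

End cone.

(** * The WKB path *)

Section complex_wkb.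
Context {R : realType}.
Local Notation Re := complex.Re.
Local Notation normc := ComplexField.Normc.normc.
Implicit Types (z w : R[i]) (t x : R).

(* With E = lambda + i mu, nu = 1/lambda and H = h / sqrt lambda, the equation
   h^2 u'' = (i z^2 - i k - E) u reads u'' = weber H nu (mu + k) u. *)
Definition weber (H nu Y0 : R) : {poly R[i]} :=
  (- (H ^- 2)%:C)%:P * (1 + ('i * nu%:C)%:P * (Y0%:C%:P - 'X * 'X)).

Definition wdev (nu Y0 : R) z : R[i] := 'i * nu%:C * (Y0%:C - z * z).

(* Second order expansion of sqrt (1 + w). *)
Definition wkb_sqrt w : R[i] := 1 + (2^-1)%:C * w - (8^-1)%:C * (w * w).

(** Mean of t^2 between [e] and [beta] for an end point with e^2 = 1, which is the source of the
    summand 1. *)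
Definition mean_sq (e beta : R) : R := (beta ^+ 2 + e * beta + 1) / 3.

Definition seg (e beta t : R) : R := e + (beta - e) * t.

(** Along x + i y(x) the first order part of Re (i sqrt (1 + w) dz/dx) is - nu / 2 (Y0 - x^2) -
    y'(x). It is constant if y' = nu / 2 (x^2 - m) with m constant, and y can vanish at both [e] and
    [beta] only if m is the mean of x^2. This is that y. *)
Definition shift (e beta nu x : R) : R :=
  nu / 6 * (x ^+ 3 - 3 * mean_sq e beta * x + e * beta * (beta + e)).

Definition segp (e beta : R) : {poly R[i]} := e%:C%:P + (beta - e)%:C%:P * 'X.

(* The path x + i shift x from e to beta, on which the real part of the phase
   int sqrt (1 + w) grows at an almost constant rate. *)
Definition cpath (e beta nu : R) : {poly R[i]} :=
  segp e beta + ('i * (nu / 6)%:C)%:P *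
    (segp e beta * segp e beta * segp e beta
     - (3 * mean_sq e beta)%:C%:P * segp e beta + (e * beta * (beta + e))%:C%:P).

Lemma on_segp e beta t : on_path (segp e beta) t = (seg e beta t)%:C.
Proof.
by rewrite /on_path /segp /seg hornerD hornerM hornerX !hornerC -rmorphM -rmorphD.
Qed.

Lemma on_dsegp e beta t : on_path (segp e beta)^`() t = (beta - e)%:C.
Proof.
rewrite /on_path /segp derivD derivM !derivC derivX mul0r mulr1 !add0r.
by rewrite hornerC.
Qed.

Lemma on_cpath e beta nu t : on_path (cpath e beta nu) t =
  seg e beta t +i* shift e beta nu (seg e beta t).
Proof.
have h := on_segp e beta t.
rewrite /on_path in h *; rewrite /cpath; move: (segp e beta) h => p h.
rewrite !(hornerD, hornerN, hornerM, hornerC) h.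
rewrite -!rmorphM -rmorphB -rmorphD.
apply: complex_ext; rewrite ?cReD ?cImD ?cReM ?cImM /=.
  by ring.
by rewrite /shift; ring.
Qed.

Lemma on_dcpath e beta nu t : e ^+ 2 = 1 -> on_path (cpath e beta nu)^`() t =
  (beta - e)%:C * (1 +i* (nu / 2 * (seg e beta t ^+ 2 - mean_sq e beta))).
Proof.
move=> e1; have h := on_segp e beta t; have dh := on_dsegp e beta t.
rewrite /on_path in h dh *; rewrite /cpath; move: (segp e beta) h dh => p h dh.
rewrite !(derivD, derivN, derivM, derivC) !(hornerD, hornerN, hornerM, hornerC, horner0) h dh.
apply: complex_ext; rewrite ?cReD ?cImD ?cReN ?cImN ?cReM ?cImM /=.
  by ring.
by field.
Qed.

Lemma shift_end e beta nu : e ^+ 2 = 1 -> shift e beta nu e = 0 /\ shift e beta nu beta = 0.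
Proof.
move=> e1; rewrite /shift /mean_sq.
have e3 : e ^+ 3 = e by rewrite exprS e1 mulr1.
split; first by rewrite e3; field.
transitivity (nu / 6 * beta * (e ^+ 2 - 1)); first by field.
by rewrite e1 subrr mulr0.
Qed.

Lemma wkb_sqrt_sqr w : 1 + w - wkb_sqrt w * wkb_sqrt w =
  (8^-1)%:C * (w * w * w) - (64^-1)%:C * (w * w * w * w).
Proof.
rewrite /wkb_sqrt; case: w => x y; apply: complex_ext.
  by rewrite !(cReD, cReN, cReM, cImD, cImN, cImM) /=; field.
by rewrite !(cReD, cReN, cReM, cImD, cImN, cImM) /=; field.
Qed.

Lemma normc_leB z w : normc (z - w) <= normc z + normc w.
Proof. by apply: (le_trans (normc_leD _ _)); rewrite normc_opp. Qed.

Lemma normc_i : normc ('i : R[i]) = 1.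
Proof. by rewrite /= expr0n expr1n add0r sqrtr1. Qed.

Lemma wkb_sqrt_bounds w : normc w <= 2^-1 ->
  2^-1 <= normc (wkb_sqrt w) /\ normc (wkb_sqrt w) <= 2.
Proof.
move=> hw.
have n0 := normc_ge0 w.
have h : normc ((2^-1)%:C * w - (8^-1)%:C * (w * w)) <= 2^-1.
  apply: (le_trans (normc_leB _ _)); rewrite !normcM !normc_real !ger0_norm ?invr_ge0//.
  nra.
have one : normc (1 : R[i]) = 1 by exact: ComplexField.Normc.normc1.
split.
  have := normc_leB (wkb_sqrt w) ((2^-1)%:C * w - (8^-1)%:C * (w * w)).
  have -> : wkb_sqrt w - ((2^-1)%:C * w - (8^-1)%:C * (w * w)) = 1 by rewrite /wkb_sqrt; ring.
  by rewrite one; lra.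
have -> : wkb_sqrt w = 1 + ((2^-1)%:C * w - (8^-1)%:C * (w * w)) by rewrite /wkb_sqrt; ring.
by apply: (le_trans (normc_leD _ _)); rewrite one; lra.
Qed.

Lemma wkb_sqrt_residual w : normc w <= 2^-1 ->
  normc (1 + w - wkb_sqrt w * wkb_sqrt w) <= 4^-1 * normc w ^+ 3.
Proof.
move=> hw; rewrite wkb_sqrt_sqr; apply: (le_trans (normc_leB _ _)).
rewrite !normcM !normc_real !ger0_norm ?invr_ge0//.
have n0 := normc_ge0 w; set n := normc w in hw n0 *.
have n3 : 0 <= n ^+ 3 by rewrite exprn_ge0.
have : n ^+ 3 * n <= n ^+ 3 * 2^-1 by rewrite ler_wpM2l.
rewrite !exprS expr0 mulr1 in n3 * => h.
have -> : n * n * n * n = n * (n * n) * n by ring.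
have -> : n * n * n = n * (n * n) by ring.
lra.
Qed.

Lemma wdev_complexE (nu Y0 x y : R) :
  wdev nu Y0 (x +i* y) = (nu * (2 * x * y)) +i* (nu * (Y0 - x ^+ 2 + y ^+ 2)).
Proof.
rewrite /wdev; apply: complex_ext; rewrite !(cReM, cImM) ?cReD ?cImD ?cReN ?cImN !(cReM, cImM) /=; ring.
Qed.

Lemma wkb_sqrt_complexE (x y : R) :
  wkb_sqrt (x +i* y) = (1 + x / 2 - (x ^+ 2 - y ^+ 2) / 8) +i* (y / 2 - x * y / 4).
Proof.
by rewrite /wkb_sqrt; apply: complex_ext; rewrite ?cReD ?cImD ?cReN ?cImN !(cReM, cImM) /=; field.
Qed.

Lemma Re_i_mul (a b c L : R) : Re ('i * (a +i* b) * (L%:C * (1 +i* c))) = - L * (b + a * c).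
Proof. by rewrite !(cReM, cImM) /=; ring. Qed.

Section path_estimates.
Context (e beta nu Y0 D eta ell : R).
Context (e2 : e ^+ 2 = 1).
Context (beta1 : -1 <= beta <= 1).
Context (nu0 : 0 < nu).
Context (YD : 9 + `|Y0| <= D).
Context (nuD : nu * D <= 2^-1).

Let D9 : 9 <= D. Proof. by apply: le_trans YD; rewrite lerDl. Qed.
Let nu1 : nu <= 1.
Proof.
have h : nu * 9 <= nu * D by rewrite ler_pM2l.
have := nuD; lra.
Qed.
Let e1 : -1 <= e <= 1.
Proof. by have ee := e2; apply/andP; split; nra. Qed.

Lemma mean_sq_01 : 0 <= mean_sq e beta <= 1.
Proof. by move/andP: beta1 e1 => [? ?] /andP[? ?]; have ee := e2; rewrite /mean_sq; apply/andP; split; nra. Qed.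

Lemma seg_bounds t : 0 <= t <= 1 -> -1 <= seg e beta t <= 1.
Proof. by move/andP: beta1 e1 => [? ?] /andP[? ?] /andP[? ?]; rewrite /seg; apply/andP; split; nra. Qed.

Lemma shift_bound x : -1 <= x <= 1 -> `|shift e beta nu x| <= 2 * nu.
Proof.
move=> /andP[x1 x2]; rewrite /shift normrM ger0_norm; last by rewrite divr_ge0// ltW.
have /andP[m0 m1] := mean_sq_01.
(* The cubic has the roots [e], [beta] and - (beta + e); its three linear factors are at most 2, 2
   and 3 in modulus. *)
have h : `|x ^+ 3 - 3 * mean_sq e beta * x + e * beta * (beta + e)| <= 12.
  have -> : x ^+ 3 - 3 * mean_sq e beta * x + e * beta * (beta + e) =
    (x - e) * (x - beta) * (x + beta + e).
    have -> : (x - e) * (x - beta) * (x + beta + e) =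
      x ^+ 3 - (e ^+ 2 + e * beta + beta ^+ 2) * x + e * beta * (beta + e) by ring.
    by rewrite e2 /mean_sq; field.
  move/andP : beta1 e1 => [b1 b2] /andP[ee1 ee2]; rewrite !normrM.
  have h1 : `|x - e| <= 2 by rewrite ler_norml; apply/andP; split; lra.
  have h2 : `|x - beta| <= 2 by rewrite ler_norml; apply/andP; split; lra.
  have h3 : `|x + beta + e| <= 3 by rewrite ler_norml; apply/andP; split; lra.
  have -> : 12 = 2 * 2 * 3 :> R by ring.
  by apply: ler_pM => //; apply: ler_pM.
have : nu / 6 * `|x ^+ 3 - 3 * mean_sq e beta * x + e * beta * (beta + e)| <= nu / 6 * 12.
  by rewrite ler_wpM2l// divr_ge0// ltW.
lra.
Qed.

Lemma normc_cpath t : 0 <= t <= 1 -> normc (on_path (cpath e beta nu) t) <= 3.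
Proof.
move=> t01; have /andP[x1 x2] := seg_bounds t01; have hs := shift_bound (seg_bounds t01).
rewrite on_cpath; apply: (le_trans (normc_le_ReIm _)) => /=.
have : `|seg e beta t| <= 1 by rewrite ler_norml x1.
have := nu1; lra.
Qed.

(** The 9 in the lower bound for [D] is the square of 3, which bounds |z| on the path. *)
Lemma normc_wdev z : normc z <= 3 -> normc (wdev nu Y0 z) <= nu * D.
Proof.
move=> z3; rewrite /wdev !normcM normc_i mul1r normc_real gtr0_norm// ler_pM2l//.
apply: (le_trans (normc_leB _ _)); apply: le_trans YD; rewrite normcM normc_real addrC lerD2r.
by have := normc_ge0 z; nra.
Qed.

Lemma normc_dcpath t : 0 <= t <= 1 -> normc (on_path (cpath e beta nu)^`() t) <= 3.
Proof.
move=> t01; have n0 := nu0; have n1 := nu1; rewrite on_dcpath// normcM normc_real.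
have /andP[x1 x2] := seg_bounds t01; have /andP[m0 m1] := mean_sq_01.
have h1 : `|beta - e| <= 2.
  by move/andP : beta1 e1 => [b1 b2] /andP[ee1 ee2]; rewrite ler_norml; apply/andP; split; lra.
have h2 : normc (1 +i* (nu / 2 * (seg e beta t ^+ 2 - mean_sq e beta))) <= 3 / 2.
  apply: (le_trans (normc_le_ReIm _)); rewrite /= normr1.
  have : `|nu / 2 * (seg e beta t ^+ 2 - mean_sq e beta)| <= 1 / 2.
    have h : `|seg e beta t ^+ 2 - mean_sq e beta| <= 1 by rewrite ler_norml; apply/andP; split; nra.
    rewrite normrM ger0_norm; last by rewrite divr_ge0// ltW.
    have : nu / 2 * `|seg e beta t ^+ 2 - mean_sq e beta| <= nu / 2 * 1.
      by rewrite ler_wpM2l// divr_ge0// ltW.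
    lra.
  lra.
have -> : 3 = 2 * (3 / 2) :> R by field.
by apply: ler_pM => //; exact: normc_ge0.
Qed.

(* The choice of the shift makes the first order part of the rate constant. *)
Lemma phase_rate t : 0 <= t <= 1 -> nu * D ^+ 2 <= eta / 4 ->
  eta <= `|Y0 - mean_sq e beta| -> 0 < eta ->
  let rate := Re ('i * wkb_sqrt (wdev nu Y0 (on_path (cpath e beta nu) t)) *
      on_path (cpath e beta nu)^`() t) in
  `|rate + (beta - e) * (nu / 2 * (Y0 - mean_sq e beta))| <= `|beta - e| * (nu * eta / 4).
Proof.
move=> t01 nuDD hY eta0 /=; have n0 := nu0; have n1 := nu1; have d9 := D9.
rewrite on_dcpath// on_cpath.
have x11 := seg_bounds t01; have hs := shift_bound x11; have /andP[m0 m1] := mean_sq_01.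
move: (seg e beta t) x11 hs => x x11; move: (shift e beta nu x) => s hs.
move: (mean_sq e beta) m0 m1 hY => m m0 m1 hY.
(* In these terms w = nu (- r + i p), and the velocity of the path is (beta - e) (1 + i nu q /
   2). *)
pose p := Y0 - x ^+ 2 + s ^+ 2; pose r := - (2 * x * s); pose q := x ^+ 2 - m.
set L := beta - e.
rewrite wdev_complexE wkb_sqrt_complexE Re_i_mul.
set re := - L * _.
have {re}-> : re = - L * (nu * (p + q) / 2 + nu ^+ 2 * (p * r / 4 - q * r / 4) + nu ^+ 3 * q * (p ^+ 2 - r ^+ 2) / 16).
  by rewrite /re -/p -/q /r; congr (_ * _); generalize p q => p' q'; field.
(* First order cancellation: p + q = Y0 - m + s^2. Besides terms with a further factor nu only s^2 /
   2 is left, and s is O(nu). *)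
have -> : - L * (nu * (p + q) / 2 + nu ^+ 2 * (p * r / 4 - q * r / 4) + nu ^+ 3 * q * (p ^+ 2 - r ^+ 2) / 16)
   + L * (nu / 2 * (Y0 - m)) =
  - L * (nu * (s ^+ 2 / 2 + nu * (p * r / 4 - q * r / 4) + nu ^+ 2 * q * (p ^+ 2 - r ^+ 2) / 16)).
  by rewrite /p /q; field.
rewrite normrM normrN ler_wpM2l// normrM (gtr0_norm nu0) -[leRHS]mulrA ler_pM2l//.
apply: le_trans nuDD.
move/andP : x11 => [x1 x2].
have x1' : `|x| <= 1 by rewrite ler_norml x1.
have s2 : `|s| <= 2 by lra.
have x2b : 0 <= x ^+ 2 <= 1 by rewrite sqr_ge0/=; nra.
have hp : `|p| <= D.
  apply: le_trans YD; rewrite /p addrC; apply: (le_trans (ler_normD _ _)).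
  have h1 : `|s ^+ 2| <= 4 by rewrite normrX; have := normr_ge0 s; nra.
  have h2 : `|Y0 - x ^+ 2| <= `|Y0| + 1.
    by apply: (le_trans (ler_normB _ _)); rewrite lerD2l normrX; have := normr_ge0 x; nra.
  lra.
have hr : `|r| <= 4 * nu.
  have h : `|x| * `|s| <= 1 * (2 * nu) by exact: ler_pM.
  by rewrite /r normrN -mulrA !normrM normr_nat; lra.
have hq : `|q| <= 1 by rewrite /q ler_norml; apply/andP; split; lra.
have hr' : `|r| <= 4 by lra.
have t1 : `|s ^+ 2 / 2| <= 2 * nu.
  rewrite normrM normrX [X in _ * X]ger0_norm ?invr_ge0//; have := normr_ge0 s; nra.
have D0 : 0 <= D by lra.
have t2 : `|nu * (p * r / 4 - q * r / 4)| <= nu * (D + 1).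
  rewrite normrM (gtr0_norm nu0) ler_pM2l//.
  have i4 : `|4^-1| = 4^-1 :> R by rewrite ger0_norm ?invr_ge0.
  apply: (le_trans (ler_normB _ _)); rewrite !normrM i4.
  have h1 : `|p| * `|r| <= D * 4 by exact: ler_pM.
  have h2 : `|q| * `|r| <= 1 * 4 by exact: ler_pM.
  lra.
have t3 : `|nu ^+ 2 * q * (p ^+ 2 - r ^+ 2) / 16| <= nu * (D ^+ 2 + 16) / 16.
  rewrite normrM (ger0_norm (_ : 0 <= 16^-1)) ?invr_ge0// ler_wpM2r ?invr_ge0//.
  rewrite normrM (normrM (nu ^+ 2)) normrX (gtr0_norm nu0).
  have h1 : `|p ^+ 2 - r ^+ 2| <= D ^+ 2 + 16.
    apply: (le_trans (ler_normB _ _)); rewrite !normrX; apply: lerD.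
      by rewrite ler_pXn2r ?nnegrE.
    by have := normr_ge0 r; nra.
  apply: ler_pM => //; first by rewrite mulr_ge0// sqr_ge0.
  rewrite -[leRHS]mulr1; apply: ler_pM => //; first exact: sqr_ge0.
  by rewrite expr2 ler_piMl// ltW.
apply: (le_trans (ler_normD _ _)); apply: (le_trans (lerD (ler_normD _ _) (lexx _))).
have DD : 81 <= D ^+ 2 by nra.
have DD' : 9 * D <= D ^+ 2 by rewrite expr2 ler_wpM2r.
have : nu * (2 + (D + 1) + (D ^+ 2 + 16) / 16) <= nu * D ^+ 2 by rewrite ler_pM2l//; lra.
lra.
Qed.

End path_estimates.
End complex_wkb.

(** * The cone estimate along the WKB path *)

Section path_cone.
Context {R : realType}.
Local Notation Re := complex.Re.
Local Notation normc := ComplexField.Normc.normc.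
Implicit Types (z w : R[i]) (t x : R).

Lemma iMi : 'i * 'i = -1 :> R[i].
Proof. by rewrite -expr2 sqr_i. Qed.

Lemma horner_weber (H nu Y0 : R) z :
  (weber H nu Y0).[z] = - (H ^- 2)%:C * (1 + wdev nu Y0 z).
Proof. by rewrite /weber !(hornerD, hornerN, hornerM, hornerC, hornerX). Qed.

(** Derivative of the WKB component - i H V + S U, split into its phase part and an error. The
    imaginary unit is a variable so that [field] treats it as an atom, the relation i * i = -1 being
    used once. Replacing [S] and [dS] by their opposites gives the other component. *)
Lemma wkb_factor_derive (i H dz w S dS U V : R[i]) : H != 0 -> i * i = -1 ->
  - i * H * (dz * (- (H ^- 2) * (1 + w)) * U) + (dS * U + S * (dz * V)) =
  H^-1 * (i * S * dz * (- i * H * V + S * U) + (i * dz * (1 + w - S * S) + H * dS) * U).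
Proof.
move=> H0 ii.
have e : H^-1 * (i * S * dz * (- i * H * V + S * U) + (i * dz * (1 + w - S * S) + H * dS) * U) =
  - (i * i) * S * dz * V + H^-1 * (i * dz * (1 + w) * U) + dS * U by field.
by rewrite e ii; field.
Qed.

(** [U 0 = 0] gives both components the same modulus H |V 0| at the start, as [cone_entrance]
    requires. The aperture [eps] is 16 (nu D)^3 divided by the rate ell nu eta / 4, hence of order
    nu^2. The sign of [S] records which component grows. The lower bound by H |V 0| lets the initial
    slope be recovered from the values at [beta]. *)
Lemma path_cone (e beta nu Y0 H eta ell D eps : R) (U V : R -> R[i]) :
  e ^+ 2 = 1 -> -1 <= beta <= 1 -> 0 < ell <= `|beta - e| -> 0 < nu ->
  9 + `|Y0| <= D -> nu * D <= 2^-1 -> 0 < eta <= `|Y0 - mean_sq e beta| ->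
  nu * D ^+ 2 <= eta / 4 -> 0 < H -> H <= nu ^+ 2 ->
  eps = 64 * D ^+ 3 * nu ^+ 2 / (ell * eta) -> eps <= 1 ->
  H <= ell * (nu * eta / 4) * eps ^+ 2 ->
  path_ode (weber H nu Y0) (cpath e beta nu) U V -> U 0 = 0 ->
  exists2 S : R[i], S = wkb_sqrt (wdev nu Y0 beta%:C) \/ S = - wkb_sqrt (wdev nu Y0 beta%:C) &
    normc (- 'i * H%:C * V 1 - S * U 1) <= eps * normc (- 'i * H%:C * V 1 + S * U 1) /\
    H * normc (V 0) <= normc (- 'i * H%:C * V 1 + S * U 1).
Proof.
move=> e2 beta1 /andP[ell0 hell] nu0 YD nuD /andP[eta0 hY] nuDD H0 Hnu epsE eps1 Heps [cU cV dUV] U0.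
have D9 : 9 <= D by apply: le_trans YD; rewrite lerDl.
pose z := on_path (cpath e beta nu); pose dz := on_path (cpath e beta nu)^`().
pose w t := wdev nu Y0 (z t); pose S t := wkb_sqrt (w t).
pose dw t := 'i * nu%:C * (0 - (dz t * z t + z t * dz t)).
pose dS t := 0 + (2^-1)%:C * dw t - (8^-1)%:C * (dw t * w t + w t * dw t).
pose P t := - 'i * H%:C * V t.
pose a t := P t + S t * U t; pose b t := P t - S t * U t.
pose th t := 'i * S t * dz t.
pose ea t := ('i * dz t * (1 + w t - S t * S t) + H%:C * dS t) * U t.
pose eb t := ('i * dz t * (1 + w t - S t * S t) - H%:C * dS t) * U t.
have dzE t : is_cderive z t (dz t) by exact: is_cderive_on_path.
have dwE t : is_cderive w t (dw t).
  apply: is_cderiveZ; apply: is_cderiveB; first exact: is_cderive_cst.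
  exact: is_cderiveM.
have dSE t : is_cderive S t (dS t).
  apply: is_cderiveB.
    by apply: is_cderiveD; [exact: is_cderive_cst|exact: is_cderiveZ].
  by apply: is_cderiveZ; exact: is_cderiveM.
have cS : ccontinuous 0 1 S by exact: ccontinuous_derive dSE.
have cP : ccontinuous 0 1 P by apply: ccontinuousM => //; exact: ccontinuous_cst.
have cSU : ccontinuous 0 1 (fun t => S t * U t) by exact: ccontinuousM.
have ca : ccontinuous 0 1 a by exact: ccontinuousD.
have cb : ccontinuous 0 1 b.
  rewrite (_ : b = fun t => P t + (-1) * (S t * U t)); last first.
    by apply/funext => t; rewrite mulN1r.
  by apply: ccontinuousD => //; apply: ccontinuousM => //; exact: ccontinuous_cst.
have HC0 : H%:C != 0 :> R[i].
  by rewrite -normc_eq0 normc_real normr_eq0 gt_eqF.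
have HVE : (H ^- 2)%:C = (H%:C) ^- 2 :> R[i] by rewrite fmorphV rmorphXn.
have HiE : (H^-1)%:C = (H%:C)^-1 :> R[i] by rewrite fmorphV.
have dP (t : R) : 0 < t < 1 -> is_cderive P t (- 'i * H%:C * (dz t * (- ((H%:C) ^- 2) * (1 + w t)) * U t)).
  move=> /dUV[_ dV]; apply: is_cderiveZ; apply: (is_cderive_eq dV).
  by rewrite horner_weber HVE.
have dSU (t : R) : 0 < t < 1 -> is_cderive (fun t => S t * U t) t (dS t * U t + S t * (dz t * V t)).
  by move=> /dUV[dU _]; exact: is_cderiveM.
have da (t : R) : 0 < t < 1 -> is_cderive a t ((H^-1)%:C * (th t * a t + ea t)).
  move=> t01; apply: (is_cderive_eq (is_cderiveD (dP t t01) (dSU t t01))).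
  by rewrite HiE; apply: wkb_factor_derive => //; exact: iMi.
have db (t : R) : 0 < t < 1 -> is_cderive b t ((H^-1)%:C * (- th t * b t + eb t)).
  move=> t01; apply: (is_cderive_eq (is_cderiveB (dP t t01) (dSU t t01))).
  rewrite HiE.
  have := wkb_factor_derive (dz t) (w t) (- S t) (- dS t) (U t) (V t) HC0 iMi.
  rewrite mulrNN /th /b /P /eb => h.
  rewrite -[in RHS](opprK (S t)) in h *.
  by rewrite opprD -!mulNr h; congr (_ * _); ring.
have lt_le (t : R) : 0 < t < 1 -> 0 <= t <= 1 by move=> /andP[/ltW -> /ltW ->].
have wle (t : R) : 0 <= t <= 1 -> normc (w t) <= nu * D.
  by move=> t01; apply: (normc_wdev nu0 YD); exact: (normc_cpath e2 beta1 nu0 YD nuD t01).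
have wle2 (t : R) : 0 <= t <= 1 -> normc (w t) <= 2^-1 by move=> /wle /le_trans; apply.
(* The velocity bound 3 times the residual of [wkb_sqrt], plus H times the bound for the derivative
   of [S]. By H <= nu^2 both terms are O(nu^3). *)
pose tau := 3 / 4 * (nu * D) ^+ 3 + 18 * H * nu.
have nuD0 : 0 <= nu * D by rewrite mulr_ge0//; lra.
have tau0 : 0 <= tau.
  apply: addr_ge0; first by apply: mulr_ge0 => //; exact: exprn_ge0.
  by apply: mulr_ge0; [apply: mulr_ge0 => //|]; exact: ltW.
have dSle (t : R) : 0 <= t <= 1 -> normc (dS t) <= 18 * nu.
  move=> t01; have hw := wle2 t t01.
  have hz := normc_cpath e2 beta1 nu0 YD nuD t01.
  have hdz := normc_dcpath e2 beta1 nu0 YD nuD t01.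
  have hdw : normc (dw t) <= 18 * nu.
    have -> : dw t = (- (2 * nu))%:C * ('i * (z t * dz t)).
      by rewrite /dw rmorphN rmorphM /= rmorph_nat; ring.
    have nu2 : 0 < 2 * nu by rewrite mulr_gt0.
    rewrite !normcM normc_i mul1r normc_real normrN (gtr0_norm nu2).
    have -> : 18 * nu = 2 * nu * (3 * 3) by ring.
    by rewrite ler_pM2l//; apply: ler_pM => //; exact: normc_ge0.
  have -> : dS t = (2^-1)%:C * dw t - (4^-1)%:C * (dw t * w t).
    have -> : 4^-1 = 2 * 8^-1 :> R by field.
    by rewrite /dS rmorphM rmorph_nat; ring.
  have i2 : `|2^-1| = 2^-1 :> R by rewrite ger0_norm.
  have i4 : `|4^-1| = 4^-1 :> R by rewrite ger0_norm.
  move: (dw t) (w t) hdw hw => p q hp hq.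
  apply: (le_trans (normc_leB _ _)); rewrite !normcM !normc_real i2 i4.
  have n1 := normc_ge0 p.
  have : normc p * normc q <= normc p * 2^-1 by rewrite ler_wpM2l.
  lra.
have Ule (t : R) : 0 <= t <= 1 -> normc (U t) <= normc (a t) + normc (b t).
  move=> t01; have [S2 _] := wkb_sqrt_bounds (wle2 t t01).
  apply: le_trans (normc_leB (a t) (b t)).
  have -> : a t - b t = 2%:C * (S t * U t) by rewrite /a /b rmorph_nat; ring.
  rewrite -/(S t) in S2; move: (S t) (U t) S2 => p q p2.
  rewrite !normcM normc_real normr_nat mulrA ler_peMl ?normc_ge0//; lra.
have errle (t : R) (z1 : R[i]) : 0 <= t <= 1 -> z1 = H%:C * dS t \/ z1 = - (H%:C * dS t) ->
    normc (('i * dz t * (1 + w t - S t * S t) + z1) * U t) <= tau * (normc (a t) + normc (b t)).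
  move=> t01 hz1; rewrite normcM; apply: ler_pM; rewrite ?normc_ge0//; last exact: Ule.
  apply: (le_trans (normc_leD _ _)); apply: lerD.
    rewrite !normcM normc_i mul1r.
    have hdz := normc_dcpath e2 beta1 nu0 YD nuD t01.
    have hr := wkb_sqrt_residual (wle2 t t01).
    have hw3 : normc (w t) ^+ 3 <= (nu * D) ^+ 3.
      by rewrite ler_pXn2r ?nnegrE ?normc_ge0// wle.
    have -> : 3 / 4 * (nu * D) ^+ 3 = 3 * (4^-1 * (nu * D) ^+ 3) by rewrite mulrA.
    apply: ler_pM; rewrite ?normc_ge0//; apply: (le_trans hr).
    by rewrite ler_wpM2l// invr_ge0.
  have -> : normc z1 = H * normc (dS t).
    by case: hz1 => ->; rewrite ?normc_opp normcM normc_real gtr0_norm.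
  by have := dSle t t01; nra.
have heal (t : R) : 0 < t < 1 -> normc (ea t) <= tau * (normc (a t) + normc (b t)).
  by move=> /lt_le t01; apply: errle => //; left.
have hebl (t : R) : 0 < t < 1 -> normc (eb t) <= tau * (normc (a t) + normc (b t)).
  by move=> /lt_le t01; apply: errle => //; right.
pose g := ell * (nu * eta / 4).
have g0 : 0 < g by rewrite !mulr_gt0.
have ee0 : 0 < ell * eta by exact: mulr_gt0.
have eps0 : 0 < eps.
  by rewrite epsE divr_gt0// mulr_gt0 ?exprn_gt0// mulr_gt0// exprn_gt0//; lra.
have htau : 8 * tau <= g * eps.
  have -> : g * eps = 16 * (nu * D) ^+ 3.
    by rewrite /g epsE; field; rewrite !gt_eqF.
  rewrite /tau.
  have h1 : 8 * (18 * H * nu) <= 144 * nu ^+ 3.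
    have : H * nu <= nu ^+ 2 * nu by rewrite ler_wpM2r// ltW.
    by rewrite -exprSr; lra.
  have h2 : 729 * nu ^+ 3 <= (nu * D) ^+ 3.
    have -> : 729 * nu ^+ 3 = (nu * 9) ^+ 3 by ring.
    have n9 : 0 <= nu * 9 by rewrite mulr_ge0// ltW.
    by rewrite ler_pXn2r ?nnegrE// ler_wpM2l// ltW.
  have h3 : 0 <= nu ^+ 3 by rewrite exprn_ge0// ltW.
  lra.
have z1E : z 1 = beta%:C.
  rewrite /z on_cpath /seg mulr1 addrC subrK.
  by rewrite (shift_end beta nu e2).2.
have ab0 : normc (a 0) = normc (b 0) by rewrite /a /b U0 mulr0 addr0 subr0.
have a0 : normc (a 0) = H * normc (V 0).
  by rewrite /a U0 mulr0 addr0 /P !normcM normc_opp normc_i mul1r normc_real gtr0_norm.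
have S1 : S 1 = wkb_sqrt (wdev nu Y0 beta%:C) by rewrite /S /w z1E.
have rate t (t01 : 0 < t < 1) := phase_rate e2 beta1 nu0 YD nuD (lt_le t t01) nuDD hY eta0.
have T : ell * eta <= `|(beta - e) * (Y0 - mean_sq e beta)|.
  by rewrite normrM; apply: ler_pM => //; exact: ltW.
have epsI : 0 < eps <= 1 by rewrite eps0.
have hT (t : R) : 0 < t < 1 ->
  (0 <= (beta - e) * (Y0 - mean_sq e beta) -> Re (th t) <= - g) /\
  ((beta - e) * (Y0 - mean_sq e beta) <= 0 -> g <= Re (th t)).
  move=> t01; have := rate t t01; rewrite -/(z t) -/(w t) -/(S t) -/(dz t) -/(th t) /=.
  rewrite ler_norml => /andP[r1 r2].
  set X := (beta - e) * _ in T *.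
  have XE : (beta - e) * (nu / 2 * (Y0 - mean_sq e beta)) = nu / 2 * X by rewrite /X; ring.
  rewrite XE in r1 r2.
  have LX : `|beta - e| * eta <= `|X| by rewrite /X normrM ler_wpM2l.
  have Lg : g <= `|beta - e| * (nu * eta / 4) by rewrite ler_wpM2r// !mulr_ge0// ltW.
  have k : `|beta - e| * (nu * eta / 4) <= nu / 4 * `|X|.
    have -> : `|beta - e| * (nu * eta / 4) = nu / 4 * (`|beta - e| * eta) by ring.
    by rewrite ler_wpM2l// divr_ge0// ltW.
  split => hX; [rewrite (ger0_norm hX) in k LX|rewrite (ler0_norm hX) in k LX]; lra.
(* In the first case the real part of the phase grows from [e] to [beta]; in the second it decreases
   and the two components exchange roles. *)
have [X0|X0] := leP ((beta - e) * (Y0 - mean_sq e beta)) 0.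
- have hth (t : R) : 0 < t < 1 -> g <= Re (th t) by move=> /hT[_]; apply.
  have [h1 h2] := cone_entrance H0 g0 epsI tau0 htau Heps ca cb da db hth heal hebl ab0.
  exists (S 1); first by left.
  by split => //; rewrite -a0.
- have hth (t : R) : 0 < t < 1 -> g <= Re (- th t).
    by move=> /hT[h _]; rewrite cReN lerNr; apply: h; exact: ltW.
  have da' t : 0 < t < 1 -> is_cderive a t ((H^-1)%:C * (- - th t * a t + ea t)).
    by rewrite opprK; exact: da.
  have heal' t : 0 < t < 1 -> normc (ea t) <= tau * (normc (b t) + normc (a t)).
    by move=> t01; rewrite addrC; exact: heal.
  have hebl' t : 0 < t < 1 -> normc (eb t) <= tau * (normc (b t) + normc (a t)).
    by move=> t01; rewrite addrC; exact: hebl.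
  have [h1 h2] := cone_entrance H0 g0 epsI tau0 htau Heps cb ca db da' hth hebl' heal' (esym ab0).
  exists (- S 1); first by right; rewrite S1.
  rewrite (mulNr (S 1)) opprK; split => //.
  by rewrite -a0 ab0.
Qed.

End path_cone.

(** * Matching at the jump *)

Section matching.
Context {R : realType}.
Local Notation normc := ComplexField.Normc.normc.
Implicit Types (z w E : R[i]) (t x h : R).

(** At [beta], where the potential jumps, only continuity of [u] and [v] is asked; this is the
    matching condition. *)
Definition strong_solution h delta beta E (u v : R -> R[i]) : Prop :=
  [/\ ccontinuous (-1) 1 u, ccontinuous (-1) 1 v &
    forall x, -1 < x < 1 -> x != beta ->
      is_cderive u x (v x) /\
      is_cderive v x ((h ^- 2)%:C * (Vpert delta beta x - E) * u x)].

Lemma within_itv_comp (a b c d : R) (p : R -> R) (s : R -> R) :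
  {within `[c, d], continuous p} -> continuous s ->
  (forall t, a <= t <= b -> c <= s t <= d) ->
  {within `[a, b], continuous (fun t => p (s t))}.
Proof.
move=> /subspace_continuousP cp cs sab; apply/subspace_continuousP => x xab P hP.
have sx : `[c, d]%classic (s x) by rewrite /= in_itv/=; apply: sab; move: xab; rewrite /= in_itv.
have h : \forall t \near x, `[c, d]%classic (s t) -> P (p (s t)) := cs x _ (cp _ sx P hP).
change (\forall t \near x, `[a, b]%classic t -> P (p (s t))).
apply: filterS h => t ht; rewrite /= in_itv/= => tab; apply: ht.
by rewrite /= in_itv/=; exact: sab.
Qed.

Lemma seg_continuous (e beta : R) : continuous (seg e beta).
Proof.
move=> t; apply: cvgD; first exact: cvg_cst.
by apply: cvgM; [exact: cvg_cst|exact: cvg_id].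
Qed.

Lemma is_derive_comp_seg (p : R -> R) (e beta t l : R) :
  is_derive (seg e beta t) 1 p l -> is_derive t 1 (fun t => p (seg e beta t)) ((beta - e) * l).
Proof.
move=> dp.
have ds : is_derive t 1 (seg e beta) (beta - e).
  apply: (is_derive_eq (is_deriveD (is_derive_cst e t 1)
    (is_deriveM (is_derive_cst (beta - e) t 1) (is_derive_id t 1)))).
  by rewrite /GRing.scale /= mulr0 mulr1 addr0 add0r.
by apply: (is_derive_eq (is_derive1_comp dp ds)); rewrite mulrC.
Qed.

Lemma is_cderive_comp_seg (f : R -> R[i]) (e beta t : R) z :
  is_cderive f (seg e beta t) z -> is_cderive (fun t => f (seg e beta t)) t ((beta - e)%:C * z).
Proof.
move=> [f1 f2]; split.
  by apply: (is_derive_eq (is_derive_comp_seg f1)); rewrite cReM /= mul0r subr0.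
by apply: (is_derive_eq (is_derive_comp_seg f2)); rewrite cImM /= mul0r addr0.
Qed.

(** The segment runs from the end point [e] to [beta], backwards when e = 1, so that both sides
    reach the jump at time 1 and the open segment stays on one side of it. Factoring lam out of E -
    V turns h^2 into H^2 = h^2 nu. *)
Lemma seg_path_ode h delta beta e lam mu nu H (u v : R -> R[i]) :
  -1 < beta < 1 -> e = -1 \/ e = 1 -> 0 < lam -> nu = lam^-1 -> h != 0 -> H ^+ 2 = h ^+ 2 * nu ->
  strong_solution h delta beta (lam +i* mu) u v ->
  path_ode (weber H nu (mu - e * delta)) (segp e beta)
    (fun t => u (seg e beta t)) (fun t => v (seg e beta t)).
Proof.
move=> /andP[b1 b2] he lam0 nuE h0 HE [cu cv duv].
have he' : e ^+ 2 = 1 by case: he => ->; rewrite ?sqrrN expr1n.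
have b12 : -1 <= beta <= 1 by rewrite !ltW.
have mapsto t : 0 <= t <= 1 -> -1 <= seg e beta t <= 1 by exact: seg_bounds.
have sc : continuous (seg e beta) by exact: seg_continuous.
split.
- by split; [apply: (within_itv_comp cu.1 sc mapsto)|apply: (within_itv_comp cu.2 sc mapsto)].
- by split; [apply: (within_itv_comp cv.1 sc mapsto)|apply: (within_itv_comp cv.2 sc mapsto)].
move=> t t01; have /andP[t0 t1] := t01.
have s11 : -1 < seg e beta t < 1.
  by rewrite /seg; case: he => ->; apply/andP; split; nra.
have VE : Vpert delta beta (seg e beta t) = 0 +i* (seg e beta t ^+ 2 + e * delta).
  rewrite /Vpert; case: he => ->; case: ifPn => //; rewrite /seg.
  - by move=> ?; exfalso; nra.
  - by move=> _; congr (_ +i* _); rewrite mulN1r.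
  - by move=> _; congr (_ +i* _); rewrite mul1r.
  - by rewrite -leNgt => ?; exfalso; nra.
have sb : seg e beta t != beta.
  apply/eqP; rewrite /seg; case: he => -> ?; nra.
have [du dv] := duv _ s11 sb.
rewrite on_dsegp; split; first exact: is_cderive_comp_seg.
apply: (is_cderive_eq (is_cderive_comp_seg dv)).
rewrite mulrA; congr (_ * _); congr (_ * _).
rewrite horner_weber on_segp VE HE.
have H0 : h ^+ 2 != 0 by rewrite sqrf_eq0.
have lam00 : lam != 0 by rewrite gt_eqF.
rewrite (_ : (seg e beta t)%:C = seg e beta t +i* 0)// wdev_complexE; subst nu.
apply: complex_ext; rewrite !(cReM, cImM, cReD, cImD, cReN, cImN) /=.
  by field; rewrite lam00 h0.
by field; rewrite lam00 h0.
Qed.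

(** For equal signs the difference of the two roots is (w1 - w2) (1/2 - (w1 + w2) / 8), whose second
    factor is at least 1/4 in modulus. For opposite signs it is, up to sign, the sum of two numbers
    near 1, which is at least 1. *)
Lemma mismatch_ge (nu delta : R) (w1 w2 S1 S2 : R[i]) :
  0 < nu -> 0 < delta -> normc w1 <= 2^-1 -> normc w2 <= 2^-1 ->
  normc (w1 - w2) = 2 * (nu * delta) -> nu * delta <= 2 ->
  S1 = wkb_sqrt w1 \/ S1 = - wkb_sqrt w1 -> S2 = wkb_sqrt w2 \/ S2 = - wkb_sqrt w2 ->
  nu * delta / 2 <= normc (S1 - S2).
Proof.
move=> nu0 d0 h1 h2 hd hnd hS1 hS2.
have one : normc (1 : R[i]) = 1 by exact: ComplexField.Normc.normc1.
have hs : normc (w1 + w2) <= 1 by apply: (le_trans (normc_leD _ _)); lra.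
have i8 : `|8^-1| = 8^-1 :> R by rewrite ger0_norm.
have i2 : `|2^-1| = 2^-1 :> R by rewrite ger0_norm.
have nd0 : 0 < nu * delta by exact: mulr_gt0.
have hm : nu * delta / 2 <= normc (wkb_sqrt w1 - wkb_sqrt w2).
  have -> : wkb_sqrt w1 - wkb_sqrt w2 = (w1 - w2) * ((2^-1)%:C - (8^-1)%:C * (w1 + w2)).
    by rewrite /wkb_sqrt; ring.
  rewrite normcM hd.
  have : 4^-1 <= normc ((2^-1)%:C - (8^-1)%:C * (w1 + w2)).
    have := normc_leD ((2^-1)%:C - (8^-1)%:C * (w1 + w2)) ((8^-1)%:C * (w1 + w2)).
    by rewrite subrK normcM !normc_real i2 i8; lra.
  have -> : nu * delta / 2 = 2 * (nu * delta) * 4^-1 by field.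
  by move=> ?; rewrite ler_wpM2l// mulr_ge0// ltW.
have hp : nu * delta / 2 <= normc (wkb_sqrt w1 + wkb_sqrt w2).
  have e0 : (2%:C : R[i]) = (wkb_sqrt w1 + wkb_sqrt w2) + ((8^-1)%:C * (w1 * w1 + w2 * w2) - (2^-1)%:C * (w1 + w2)).
    by rewrite /wkb_sqrt rmorph_nat; ring.
  have : normc (2%:C : R[i]) <= normc (wkb_sqrt w1 + wkb_sqrt w2) + (8^-1 * (4^-1 + 4^-1) + 2^-1).
    rewrite {1}e0; apply: (le_trans (normc_leD _ _)); rewrite lerD2l.
    apply: (le_trans (normc_leB _ _)); rewrite !normcM !normc_real i2 i8; apply: lerD.
      rewrite ler_wpM2l ?invr_ge0//; apply: (le_trans (normc_leD _ _)); rewrite !normcM.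
      by have n1 := normc_ge0 w1; have n2 := normc_ge0 w2; apply: lerD; nra.
    lra.
  by rewrite normc_real normr_nat; lra.
case: hS1 => ->; case: hS2 => ->.
- exact: hm.
- by rewrite opprK.
- by rewrite -opprD normc_opp.
- by rewrite -opprD normc_opp.
Qed.

(** Since P + S u = (P - S u) + 2 S u, the cone condition bounds |P - S u| by eps (|P - S u| + 4
    |u|), and eps <= 1/2 absorbs the first term. *)
Lemma cone_ratio (eps : R) (P S u : R[i]) : 0 < eps <= 2^-1 ->
  normc (P - S * u) <= eps * normc (P + S * u) -> normc S <= 2 ->
  normc (P - S * u) <= 8 * eps * normc u.
Proof.
move=> /andP[e0 e1] h S2.
have n0 := normc_ge0 (P - S * u); have u0 := normc_ge0 u.
have : normc (P + S * u) <= normc (P - S * u) + 2 * (2 * normc u).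
  have -> : P + S * u = (P - S * u) + 2%:C * (S * u) by rewrite rmorph_nat; ring.
  apply: (le_trans (normc_leD _ _)); rewrite lerD2l normcM normcM normc_real normr_nat.
  by rewrite ler_pM2l// ler_wpM2r.
move=> hB; have h2 := le_trans h (ler_wpM2l (ltW e0) hB).
move: (normc _) (normc u) n0 u0 h2 => A B A0 B0 h2.
nra.
Qed.

(** Both S1 u and S2 u are within 8 eps |u| of P, so roots further apart than 16 eps force u = 0 at
    the jump. Then P vanishes by the first cone condition, and with it the bound H |v0| carried
    along from the end point. *)
Lemma matching_contradiction (H eps d : R) (P S1 S2 u v0 : R[i]) :
  0 < H -> 0 < eps <= 2^-1 -> 16 * eps < d -> d <= normc (S1 - S2) ->
  normc S1 <= 2 -> normc S2 <= 2 ->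
  normc (P - S1 * u) <= eps * normc (P + S1 * u) ->
  H * normc v0 <= normc (P + S1 * u) ->
  normc (P - S2 * u) <= eps * normc (P + S2 * u) -> v0 = 0.
Proof.
move=> H0 epsI epsd hd hS1 hS2 h1 hv h2.
have k1 := cone_ratio epsI h1 hS1; have k2 := cone_ratio epsI h2 hS2.
have u0 := normc_ge0 u.
have k3 : normc (S1 - S2) * normc u <= 16 * eps * normc u.
  rewrite -normcM.
  have -> : (S1 - S2) * u = (P - S2 * u) - (P - S1 * u) by ring.
  by apply: (le_trans (normc_leB _ _)); lra.
have un0 : normc u = 0.
  apply/eqP; rewrite eq_le u0 andbT leNgt; apply/negP => up.
  by have : normc (S1 - S2) <= 16 * eps by [rewrite -(ler_pM2r up)]; lra.
have uE : u = 0 by apply/eqP; rewrite -normc_eq0 un0.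
move: h1 hv; rewrite uE mulr0 subr0 addr0 => h1 hv.
have P0 := normc_ge0 P; have v00 := normc_ge0 v0.
have PE : normc P = 0 by apply/eqP; rewrite eq_le P0 andbT; move/andP : epsI => [? ?]; nra.
rewrite PE in hv.
by apply/eqP; rewrite -normc_eq0 eq_le v00 andbT -(pmulr_rle0 _ H0).
Qed.

End matching.

(** * Values of E without eigenfunctions *)

Section trivial_solutions.
Context {R : realType}.
Local Notation Re := complex.Re.
Local Notation Im := complex.Im.
Local Notation normc := ComplexField.Normc.normc.
Implicit Types (z w E : R[i]) (t x h : R).

(** The real segment and [cpath] share their end points, so the values of the solution at [beta] may
    be computed along [cpath], where the cone estimate applies. The length 1 - |beta| serves both
    end points, being at most |beta - e|. *)
Lemma strong_solution_at (h delta beta e lam mu nu H eta D eps : R) (u v : R -> R[i]) :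
  -1 < beta < 1 -> e = -1 \/ e = 1 -> 0 < lam -> nu = lam^-1 -> 0 < h ->
  H = h * Num.sqrt nu ->
  9 + `|mu - e * delta| <= D -> nu * D <= 2^-1 ->
  0 < eta <= `|mu - e * delta - mean_sq e beta| ->
  nu * D ^+ 2 <= eta / 4 -> H <= nu ^+ 2 ->
  eps = 64 * D ^+ 3 * nu ^+ 2 / ((1 - `|beta|) * eta) -> eps <= 1 ->
  H <= (1 - `|beta|) * (nu * eta / 4) * eps ^+ 2 ->
  strong_solution h delta beta (lam +i* mu) u v -> u e = 0 ->
  exists2 S : R[i], S = wkb_sqrt (wdev nu (mu - e * delta) beta%:C) \/
      S = - wkb_sqrt (wdev nu (mu - e * delta) beta%:C) &
    normc (- 'i * H%:C * v beta - S * u beta) <= eps * normc (- 'i * H%:C * v beta + S * u beta) /\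
    H * normc (v e) <= normc (- 'i * H%:C * v beta + S * u beta).
Proof.
move=> hb he lam0 nuE h0 HE YD nuD hY nuDD Hnu epsE eps1 Heps sol ue.
have nu0 : 0 < nu by rewrite nuE invr_gt0.
have H0 : 0 < H by rewrite HE mulr_gt0// sqrtr_gt0.
have H2 : H ^+ 2 = h ^+ 2 * nu by rewrite HE exprMn sqr_sqrtr// ltW.
have hn0 : h != 0 by rewrite gt_eqF.
have e2 : e ^+ 2 = 1 by case: he => ->; rewrite ?sqrrN expr1n.
have /andP[b1 b2] := hb.
have b12 : -1 <= beta <= 1 by rewrite !ltW.
have ell : 0 < 1 - `|beta| <= `|beta - e|.
  rewrite subr_gt0 ltr_norml hb /= lerBlDr.
  have : `|e| <= `|beta - e| + `|beta|.
    by rewrite addrC -(distrC e) -[X in `|X| <= _](subrK beta) addrC; exact: ler_normD.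
  by case: he => ->; rewrite ?normrN normr1.
have p1 := seg_path_ode hb he lam0 nuE hn0 H2 sol.
set Y0 := mu - e * delta in YD hY p1 *.
have [U [V [p2 U0 V0 _]]] := path_ode_exists (weber H nu Y0) (cpath e beta nu) (u e) (v e).
have s0 : seg e beta 0 = e by rewrite /seg mulr0 addr0.
have s1 : seg e beta 1 = beta by rewrite /seg mulr1 addrC subrK.
have E0 : (segp e beta).[0] = (cpath e beta nu).[0].
  have := on_cpath e beta nu 0; have := on_segp e beta 0.
  by rewrite /on_path s0 (shift_end beta nu e2).1 => -> ->.
have E1 : (segp e beta).[1] = (cpath e beta nu).[1].
  have := on_cpath e beta nu 1; have := on_segp e beta 1.
  by rewrite /on_path s1 (shift_end beta nu e2).2 => -> ->.
have [] := path_ode_independent p1 p2 E0 E1; rewrite ?s0 ?s1//.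
move=> -> ->; rewrite -V0.
by apply: (path_cone e2 b12 ell nu0 YD nuD hY nuDD H0 Hnu epsE eps1 Heps p2); rewrite U0.
Qed.

(** [R0] must not depend on h or on an upper bound for lam, whereas [h0] may: [nu0] is a lower bound
    for 1 / lam, and the cone estimate asks for H of order at most nu^5. *)
Lemma strong_solution_trivial (beta delta eta : R) :
  -1 < beta < 1 -> 0 < delta -> 0 < eta ->
  exists2 R0 : R, 0 < R0 & forall nu0 : R, 0 < nu0 ->
  exists2 h0 : R, 0 < h0 & forall (h lam mu : R) (u v : R -> R[i]),
    0 < h < h0 -> R0 <= lam -> nu0 <= lam^-1 -> - delta <= mu <= 1 + delta ->
    eta <= `|mu - ((beta ^+ 2 - beta + 1) / 3 - delta)| ->
    eta <= `|mu - ((beta ^+ 2 + beta + 1) / 3 + delta)| ->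
    strong_solution h delta beta (lam +i* mu) u v ->
    u (-1) = 0 -> u 1 = 0 -> v (-1) = 0.
Proof.
move=> hb d0 eta0.
(* Both |mu + delta| and |mu - delta| are at most 1 + 2 delta in the strip. *)
pose D : R := 10 + 2 * delta.
pose l := 1 - `|beta|.
have l0 : 0 < l by rewrite subr_gt0 ltr_norml.
have D0 : 0 < D by rewrite /D; lra.
have le0 : 0 < l * eta by exact: mulr_gt0.
pose k := 64 * D ^+ 3 / (l * eta).
have k0 : 0 < k by rewrite divr_gt0// mulr_gt0// exprn_gt0.
(* Each summand secures one condition on nu = 1 / lam: nu < 1, nu D <= 1/2, nu D^2 <= eta / 4, nu
   delta <= 1, then eps <= 1/2 and 16 eps < nu delta / 2 for eps = k nu^2. *)
exists (1 + 2 * D + 4 * D ^+ 2 / eta + delta + 2 * k + 32 * k / delta).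
  have h1 : 0 < 4 * D ^+ 2 / eta by rewrite divr_gt0// mulr_gt0// exprn_gt0.
  have h2 : 0 < 32 * k / delta by rewrite divr_gt0// mulr_gt0.
  lra.
move=> nu0 nu00.
(* H <= h because nu <= 1, so it is enough that h lies below the bounds asked of [H], evaluated at
   nu0 <= nu. *)
exists (Num.min (nu0 ^+ 2) (l * (nu0 * eta / 4) * (k * nu0 ^+ 2) ^+ 2)).
  rewrite lt_min exprn_gt0//=.
  by do ?[exact: l0|exact: k0|exact: eta0|exact: nu00|apply: mulr_gt0|apply: exprn_gt0].
move=> h lam mu u v /andP[hh0]; rewrite lt_min => /andP[hh1 hh2] lamR nul /andP[mu1 mu2] hL hR sol um1 u1.
have t1 : 0 < 4 * D ^+ 2 / eta by rewrite divr_gt0// mulr_gt0// exprn_gt0.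
have t2 : 0 < 32 * k / delta by rewrite divr_gt0// mulr_gt0.
have lam1 : 1 < lam by lra.
have lam0 : 0 < lam by lra.
pose nu := lam^-1.
have n0 : 0 < nu by rewrite invr_gt0.
have n1 : nu <= 1 by rewrite invf_le1// ltW.
have nuX X : X <= lam -> nu * X <= 1 by move=> ?; rewrite /nu mulrC ler_pdivrMr// mul1r.
have nuX' X : X < lam -> nu * X < 1 by move=> ?; rewrite /nu mulrC ltr_pdivrMr// mul1r.
have c1 : nu * D <= 2^-1 by have : nu * (2 * D) <= 1 by [apply: nuX; lra]; lra.
have c2 : nu * D ^+ 2 <= eta / 4.
  have : nu * (4 * D ^+ 2 / eta) <= 1 by apply: nuX; lra.
  by rewrite !mulrA ler_pdivrMr// mul1r; lra.
pose eps := 64 * D ^+ 3 * nu ^+ 2 / (l * eta).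
have epsE : eps = k * nu ^+ 2 by rewrite /eps /k; field; rewrite !gt_eqF.
have eps0 : 0 < eps by rewrite epsE mulr_gt0// exprn_gt0.
have eps2 : eps <= 2^-1.
  have h1 : nu * (2 * k) <= 1 by apply: nuX; lra.
  have : nu * (2 * k) * nu <= 1 * nu by rewrite ler_wpM2r// ltW.
  by rewrite epsE; lra.
have epsd : 16 * eps < nu * delta / 2.
  have h1 : nu * (32 * k / delta) < 1 by apply: nuX'; lra.
  have h2 : nu * (32 * k) < delta by move: h1; rewrite !mulrA ltr_pdivrMr// mul1r.
  have : nu * (nu * (32 * k)) < nu * delta by rewrite ltr_pM2l.
  by rewrite epsE; lra.
have nud : nu * delta <= 2 by have : nu * delta <= 1 by [apply: nuX; lra]; lra.
pose H := h * Num.sqrt nu.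
have H0 : 0 < H by rewrite /H mulr_gt0// sqrtr_gt0.
have Hh : H <= h.
  have s1 : Num.sqrt nu <= 1 by rewrite -[leRHS]sqrtr1 ler_sqrt.
  by rewrite /H ler_piMr// ltW.
have nu0nu : nu0 ^+ 2 <= nu ^+ 2 by rewrite ler_pXn2r ?nnegrE// ltW.
have H1 : H <= nu ^+ 2 by lra.
have H2 : H <= l * (nu * eta / 4) * eps ^+ 2.
  apply: (le_trans Hh); apply: (le_trans (ltW hh2)); rewrite epsE; apply: ler_pM.
  - by rewrite !mulr_ge0// ltW.
  - exact: sqr_ge0.
  - by rewrite ler_pM2l// !ler_pM2r ?invr_gt0.
  - have kn (n : R) : 0 <= k * n ^+ 2 by apply: mulr_ge0; [exact: ltW|exact: sqr_ge0].
    by rewrite ler_pXn2r ?nnegrE// ler_pM2l.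
have mL : mu - ((beta ^+ 2 - beta + 1) / 3 - delta) = mu - (-1) * delta - mean_sq (-1) beta.
  by rewrite /mean_sq; ring.
have mR : mu - ((beta ^+ 2 + beta + 1) / 3 + delta) = mu - 1 * delta - mean_sq 1 beta.
  by rewrite /mean_sq; ring.
rewrite mL in hL; rewrite mR in hR.
have YL : 9 + `|mu - (-1) * delta| <= D.
  by rewrite /D; have : `|mu - (-1) * delta| <= 1 + 2 * delta by [rewrite ler_norml; apply/andP; split; lra]; lra.
have YR : 9 + `|mu - 1 * delta| <= D.
  by rewrite /D; have : `|mu - 1 * delta| <= 1 + 2 * delta by [rewrite ler_norml; apply/andP; split; lra]; lra.
have eps1 : eps <= 1 by lra.
have etaL : 0 < eta <= `|mu - (-1) * delta - mean_sq (-1) beta| by rewrite eta0.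
have etaR : 0 < eta <= `|mu - 1 * delta - mean_sq 1 beta| by rewrite eta0.
have [S1 hS1 [a1 a2]] := strong_solution_at hb (or_introl erefl) lam0 erefl hh0 erefl YL c1 etaL c2 H1 erefl eps1 H2 sol um1.
have [S2 hS2 [a3 _]] := strong_solution_at hb (or_intror erefl) lam0 erefl hh0 erefl YR c1 etaR c2 H1 erefl eps1 H2 sol u1.
have b3 : normc (beta%:C) <= 3.
  by rewrite normc_real; have : `|beta| < 1 by [rewrite ltr_norml]; lra.
have w1 := le_trans (normc_wdev n0 YL b3) c1.
have w2 := le_trans (normc_wdev n0 YR b3) c1.
have d12 : normc (wdev nu (mu - (-1) * delta) beta%:C - wdev nu (mu - 1 * delta) beta%:C) = 2 * (nu * delta).
  have -> : wdev nu (mu - (-1) * delta) beta%:C - wdev nu (mu - 1 * delta) beta%:C =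
     'i * (2 * (nu * delta))%:C.
    by apply: complex_ext; rewrite /wdev !(cReM, cImM, cReD, cImD, cReN, cImN) /=; ring.
  by rewrite normcM normc_i mul1r normc_real gtr0_norm// !mulr_gt0.
have := mismatch_ge n0 d0 w1 w2 d12 nud hS1 hS2 => hd.
have epsI : 0 < eps <= 2^-1 by rewrite eps0.
have nS w S : normc w <= 2^-1 -> S = wkb_sqrt w \/ S = - wkb_sqrt w -> normc S <= 2.
  by move=> /wkb_sqrt_bounds[_ hw] [->|->] //; rewrite normc_opp.
exact: (matching_contradiction H0 epsI epsd hd (nS _ _ w1 hS1) (nS _ _ w2 hS2) a1 a2 a3).
Qed.

Lemma is_cderive_conj (f : R -> R[i]) x z : is_cderive f x z -> is_cderive (fun t => (f t)^*) x z^*.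
Proof.
have r w : Re (w^*) = Re w by case: w.
have i w : Im (w^*) = - Im w by case: w.
move=> [f1 f2]; split.
  by rewrite r; under eq_fun do rewrite r.
by rewrite i; under eq_fun do rewrite i; exact: is_deriveN.
Qed.

Lemma within_eq0_at_left_end (a b c : R) (p : R -> R) : a < c -> c <= b ->
  {within `[a, b], continuous p} -> (forall x, a < x < c -> p x = 0) -> p a = 0.
Proof.
move=> ac cb cp p0.
have [_ h _] := (continuous_within_itvP _ ac).1 (within_itvS (lexx a) cb cp).
apply: (@cvg_unique _ (@Rhausdorff R) _ _ _ _ h).
apply: (@cvg_trans _ (0 @[x --> a^'+])); last exact: cvg_cst.
apply: near_eq_cvg; near=> x; apply/esym/p0; apply/andP; split.
  by near: x; exact: nbhs_right_gt.
by near: x; exact: nbhs_right_lt.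
Unshelve. all: by end_near. Qed.

(* The real part of (p - i q) v ubar is nondecreasing with derivative at least p |v|^2. *)
Lemma energy_trivial h delta beta lam mu (p q : R) (u v : R -> R[i]) :
  -1 < beta < 1 -> 0 < h -> 0 < p ->
  (forall x, -1 < x < 1 -> 0 <= - p * lam + q * (Im (Vpert delta beta x) - mu)) ->
  strong_solution h delta beta (lam +i* mu) u v -> u (-1) = 0 -> u 1 = 0 -> v (-1) = 0.
Proof.
move=> /andP[b1 b2] h0 p0 hpq [cu cv duv] um1 u1.
pose f t := (p +i* (- q)) * (v t * (u t)^*).
pose df t := (p +i* (- q)) * ((h ^- 2)%:C * (Vpert delta beta t - (lam +i* mu)) * u t * (u t)^* + v t * (v t)^*).
pose g t := Re (f t).
have dg x : -1 < x < 1 -> x != beta -> is_derive x 1 g (Re (df x)).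
  move=> x1 xb; have [du dv] := duv x x1 xb.
  exact: (is_cderiveZ (p +i* (- q)) (is_cderiveM dv (is_cderive_conj du))).1.
have dfge x : -1 < x < 1 -> p * normc (v x) ^+ 2 <= Re (df x).
  move=> x1.
  have V0 : Re (Vpert delta beta x) = 0 by rewrite /Vpert; case: ifP.
  have -> : Re (df x) = p * normc (v x) ^+ 2 +
      h ^- 2 * (- p * lam + q * (Im (Vpert delta beta x) - mu)) * normc (u x) ^+ 2.
    rewrite /df !sqr_normcE; move: (Vpert delta beta x) V0 => [a b] /= ->.
    case: (u x) (v x) => [c d] [c' d'].
    by rewrite !(cReM, cImM, cReD, cImD, cReN, cImN) /=; ring.
  rewrite lerDl mulr_ge0 ?sqr_ge0// mulr_ge0 ?hpq// invr_ge0 sqr_ge0//.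
have dg0 x : -1 < x < 1 -> 0 <= Re (df x).
  move=> x1; apply: le_trans (dfge x x1); rewrite mulr_ge0 ?sqr_ge0// ltW//.
have ccu : ccontinuous (-1) 1 (fun t => (u t)^*).
  have r w : Re (w^*) = Re w by case: w.
  have i w : Im (w^*) = - Im w by case: w.
  case: cu => cu1 cu2; split.
    by under [X in continuous X]eq_fun do rewrite r.
  by under [X in continuous X]eq_fun do rewrite i; move=> x; apply: cvgN; exact: cu2.
have cg : {within `[-1, 1], continuous g}.
  by apply: (ccontinuousM (ccontinuous_cst (-1) 1 (p +i* (- q))) (ccontinuousM cv ccu)).1.
have mono a b : -1 <= a -> a <= b -> b <= 1 -> (b <= beta) || (beta <= a) -> g a <= g b.
  move=> a1 ab b11 side.
  have io t : a < t < b -> -1 < t < 1 by move=> /andP[? ?]; apply/andP; split; lra.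
  apply: (@le_of_is_derive _ a b g (fun t => Re (df t))) => //.
  - exact: (within_itvS a1 b11 cg).
  - move=> t tab; apply: dg; first exact: io.
    by case/andP: tab => ? ?; apply/eqP => tb; case/orP: side => ?; lra.
  - by move=> t /io; exact: dg0.
have gu0 t : u t = 0 -> g t = 0.
  by move=> ut; rewrite /g /f ut !(cReM, cImM) /= oppr0 !mulr0 subrr addr0 !mulr0 subrr.
have g1 := gu0 _ um1; have g2 := gu0 _ u1.
have gb : g beta <= 0.
  by rewrite -g2; apply: mono => //; rewrite ?(ltW b1) ?(ltW b2) ?lexx ?orbT.
(* [g] is nondecreasing on each side and continuous at the jump, and it vanishes at both ends; so it
   vanishes up to [beta], and there its derivative, which dominates p |v|^2, vanishes too. *)
have g0 x : -1 < x < beta -> g x = 0.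
  move=> /andP[x1 x2]; apply/eqP; rewrite eq_le; apply/andP; split.
    by apply: le_trans gb; apply: mono; [exact: ltW|exact: ltW|exact: ltW|rewrite lexx].
  by rewrite -g1; apply: mono; [exact: lexx|exact: ltW|apply/ltW/(lt_trans x2)|rewrite (ltW x2)].
have v0 x : -1 < x < beta -> v x = 0.
  move=> xb; have /andP[x1 x2] := xb.
  have x11 : -1 < x < 1 by rewrite x1 (lt_trans x2).
  have d1 := dg x x11 (negbT (lt_eqF x2)).
  have e0 : Re (df x) = 0.
    have [_ <-] := d1.
    have -> : 'D_1 g x = 'D_1 (cst (0 : R)) x.
      apply: near_eq_derive; near=> y; apply: g0; apply/andP; split.
        by near: y; exact: lt_nbhsr.
      by near: y; exact: lt_nbhsl.
    by rewrite derive_cst.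
  have := dfge x x11; rewrite e0 pmulr_rle0// => hv.
  have : normc (v x) ^+ 2 = 0 by apply/eqP; rewrite eq_le hv sqr_ge0.
  by move=> /eqP; rewrite expf_eq0 /= normc_eq0 => /eqP.
have [cv1 cv2] := cv.
apply: complex_ext.
  by apply: (within_eq0_at_left_end b1 (ltW b2) cv1) => x /v0 ->.
by apply: (within_eq0_at_left_end b1 (ltW b2) cv2) => x /v0 ->.
Unshelve. all: by end_near. Qed.

(** Each excluded half plane has its own multiplier: q = 0 for Re E < 0, and q = 1 or -1 below or
    above the strip. In the last two cases [p] must stay positive to control |v|^2, and is taken
    small enough that p lam does not exceed the distance from mu to the strip. *)
Lemma strong_solution_outside_trivial h delta beta lam mu (u v : R -> R[i]) :
  -1 < beta < 1 -> 0 < h -> 0 < delta -> lam < 0 \/ mu < - delta \/ 1 + delta < mu ->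
  strong_solution h delta beta (lam +i* mu) u v -> u (-1) = 0 -> u 1 = 0 -> v (-1) = 0.
Proof.
move=> hb h0 d0 out.
have bV x : -1 < x < 1 -> - delta <= Im (Vpert delta beta x) <= 1 + delta.
  move=> /andP[x1 x2]; have : 0 <= x ^+ 2 <= 1 by rewrite sqr_ge0/=; nra.
  by rewrite /Vpert => /andP[? ?]; case: ifP => _ /=; apply/andP; split; lra.
have l1 : 0 < 1 + `|lam| by rewrite ltr_pwDl.
have ll : lam <= 1 + `|lam| by apply: (le_trans (ler_norm lam)); lra.
case: out => [lam0|[mu0|mu0]].
- apply: (@energy_trivial _ _ _ _ _ 1 0) => // x _.
  by rewrite mul0r addr0 mulN1r oppr_ge0 ltW.
- have s0 : 0 < - delta - mu by lra.
  apply: (@energy_trivial _ _ _ _ _ ((- delta - mu) / (1 + `|lam|)) 1) => //; first exact: divr_gt0.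
  move=> x /bV/andP[v1 v2].
  have : (- delta - mu) / (1 + `|lam|) * lam <= - delta - mu.
    by rewrite mulrAC ler_pdivrMr// ler_pM2l.
  lra.
- have s0 : 0 < mu - (1 + delta) by lra.
  apply: (@energy_trivial _ _ _ _ _ ((mu - (1 + delta)) / (1 + `|lam|)) (-1)) => //; first exact: divr_gt0.
  move=> x /bV/andP[v1 v2].
  have : (mu - (1 + delta)) / (1 + `|lam|) * lam <= mu - (1 + delta).
    by rewrite mulrAC ler_pdivrMr// ler_pM2l.
  lra.
Qed.

End trivial_solutions.

(** * Square-integrable functions *)

Section square_integrable.
Context {R : realType}.
Local Notation mu := (@lebesgue_measure R).
Local Notation Re := complex.Re.
Local Notation Im := complex.Im.
Local Notation normc := ComplexField.Normc.normc.
Implicit Types (a b x t : R) (f g u v : R -> R[i]) (z : R[i]).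

Lemma cintegrableD a b f g : cintegrable a b f -> cintegrable a b g ->
  cintegrable a b (fun t => f t + g t).
Proof.
move=> [f1 f2] [g1 g2]; split.
  rewrite (_ : _ \o _ = (EFin \o (fun t => Re (f t))) \+ (EFin \o (fun t => Re (g t))))%E.
    exact: integrableD.
  by apply/funext => t /=; rewrite cReD.
rewrite (_ : _ \o _ = (EFin \o (fun t => Im (f t))) \+ (EFin \o (fun t => Im (g t))))%E.
  exact: integrableD.
by apply/funext => t /=; rewrite cImD.
Qed.

Lemma integrable_lin a b (r s : R) (p q : R -> R) :
  mu.-integrable `[a, b] (EFin \o p) -> mu.-integrable `[a, b] (EFin \o q) ->
  mu.-integrable `[a, b] (EFin \o (fun t => r * p t + s * q t)).
Proof.
move=> ip iq.
have h1 : mu.-integrable `[a, b] (fun t => r%:E * (p t)%:E)%E by exact: integrableZl.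
have h2 : mu.-integrable `[a, b] (fun t => s%:E * (q t)%:E)%E by exact: integrableZl.
exact: (integrableD _ h1 h2).
Qed.

Lemma Rintegral_lin a b (r s : R) (p q : R -> R) :
  mu.-integrable `[a, b] (EFin \o p) -> mu.-integrable `[a, b] (EFin \o q) ->
  \int[mu]_(t in `[a, b]) (r * p t + s * q t) =
  r * \int[mu]_(t in `[a, b]) p t + s * \int[mu]_(t in `[a, b]) q t.
Proof.
move=> ip iq.
have h1 : mu.-integrable `[a, b] (EFin \o (fun t => r * p t)) by exact: (integrableZl _ r ip).
have h2 : mu.-integrable `[a, b] (EFin \o (fun t => s * q t)) by exact: (integrableZl _ s iq).
by rewrite RintegralD// !RintegralZl.
Qed.

Lemma cintegrableZ a b f c : cintegrable a b f -> cintegrable a b (fun t => c * f t).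
Proof.
move=> [f1 f2]; split.
  rewrite (_ : (fun t => _) = (fun t => Re c * Re (f t) + (- Im c) * Im (f t))).
    exact: integrable_lin.
  by apply/funext => t; rewrite cReM mulNr.
rewrite (_ : (fun t => _) = (fun t => Re c * Im (f t) + Im c * Re (f t))).
  exact: integrable_lin.
by apply/funext => t; rewrite cImM.
Qed.

Lemma cintegralD a b f g : cintegrable a b f -> cintegrable a b g ->
  cintegral a b (fun t => f t + g t) = cintegral a b f + cintegral a b g.
Proof.
move=> [f1 f2] [g1 g2]; rewrite /cintegral; apply: complex_ext; rewrite ?cReD ?cImD /=.
  rewrite -RintegralD//; congr (Rintegral _ _ _); apply/funext => t; exact: cReD.
rewrite -RintegralD//; congr (Rintegral _ _ _); apply/funext => t; exact: cImD.
Qed.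

Lemma cintegralZ a b f c : cintegrable a b f ->
  cintegral a b (fun t => c * f t) = c * cintegral a b f.
Proof.
move=> [f1 f2]; rewrite /cintegral; apply: complex_ext; rewrite ?cReM ?cImM /=.
  rewrite -mulNr -Rintegral_lin//; congr (Rintegral _ _ _); apply/funext => t.
  by rewrite cReM mulNr.
rewrite -Rintegral_lin//; congr (Rintegral _ _ _); apply/funext => t.
by rewrite cImM.
Qed.

Lemma cintegrableS a b x f : x <= b -> cintegrable a b f -> cintegrable a x f.
Proof. by move=> xb [f1 f2]; split; exact: integrable_itv_le xb _. Qed.

Lemma cintegral_ae_eq a b f g : cmeasurable a b f -> cmeasurable a b g ->
  {ae mu, forall t, a <= t <= b -> f t = g t} -> cintegral a b f = cintegral a b g.
Proof.
move=> [f1 f2] [g1 g2] fg; rewrite /cintegral /Rintegral; congr (_ +i* _); congr fine.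
  apply: ae_eq_integral => //; [exact/measurable_EFinP|exact/measurable_EFinP|].
  by apply: (@filterS _ _ (ae_filter_ringOfSetsType mu) _ _ _ fg) => t h; rewrite /= in_itv/= => /h ->.
apply: ae_eq_integral => //; [exact/measurable_EFinP|exact/measurable_EFinP|].
by apply: (@filterS _ _ (ae_filter_ringOfSetsType mu) _ _ _ fg) => t h; rewrite /= in_itv/= => /h ->.
Qed.

Lemma cmeasurableD a b f g : cmeasurable a b f -> cmeasurable a b g ->
  cmeasurable a b (fun t => f t + g t).
Proof.
move=> [f1 f2] [g1 g2]; split.
  rewrite (_ : (fun t => _) = (fun t => Re (f t)) \+ (fun t => Re (g t))).
    exact: measurable_funD.
  by apply/funext => t; rewrite cReD.
rewrite (_ : (fun t => _) = (fun t => Im (f t)) \+ (fun t => Im (g t))).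
  exact: measurable_funD.
by apply/funext => t; rewrite cImD.
Qed.

Lemma cmeasurableM a b f g : cmeasurable a b f -> cmeasurable a b g ->
  cmeasurable a b (fun t => f t * g t).
Proof.
move=> [f1 f2] [g1 g2]; split.
  rewrite (_ : (fun t => _) = ((fun t => Re (f t)) \* (fun t => Re (g t))) \- ((fun t => Im (f t)) \* (fun t => Im (g t)))).
    by apply: measurable_funB; exact: measurable_funM.
  by apply/funext => t; rewrite cReM.
rewrite (_ : (fun t => _) = ((fun t => Re (f t)) \* (fun t => Im (g t))) \+ ((fun t => Im (f t)) \* (fun t => Re (g t)))).
  by apply: measurable_funD; exact: measurable_funM.
by apply/funext => t; rewrite cImM.
Qed.

Lemma measurable_sqr_normc a b f : cmeasurable a b f ->
  measurable_fun `[a, b] (fun t => normc (f t) ^+ 2).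
Proof.
move=> [f1 f2].
rewrite (_ : (fun t => _) = (fun t => Re (f t) ^+ 2) \+ (fun t => Im (f t) ^+ 2)).
  by apply: measurable_funD; exact: measurable_funX.
by apply/funext => t; rewrite sqr_normcE.
Qed.

Lemma inL2P f : inL2 f <-> cmeasurable (-1) 1 f /\
  mu.-integrable `[(-1 : R), 1] (EFin \o (fun t => normc (f t) ^+ 2)).
Proof.
have e : (\int[mu]_(x in `[(-1)%R : R, 1%R]) `|(EFin \o (fun t => (normc (f t) ^+ 2)%R)) x| = sqnormL2 f)%E.
  by apply: eq_integral => t _; rewrite /= ger0_norm// sqr_ge0.
split => [[m1 m2 lt]|[[m1 m2] /integrableP[_ lt]]].
  split; first by [].
  apply/integrableP; split; last by rewrite e.
  by apply/measurable_EFinP; apply: measurable_sqr_normc.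
by split => //; rewrite -e.
Qed.

Lemma inL2Z f c : inL2 f -> inL2 (fun t => c * f t).
Proof.
move=> /inL2P[mf lf]; apply/inL2P; split.
  by apply: cmeasurableM => //; split; exact: measurable_cst.
rewrite (_ : (fun t => _) = fun t => normc c ^+ 2 * normc (f t) ^+ 2).
  exact: (integrableZl _ (normc c ^+ 2) lf).
by apply/funext => t; rewrite normcM exprMn.
Qed.

Lemma inL2D f g : inL2 f -> inL2 g -> inL2 (fun t => f t + g t).
Proof.
move=> /inL2P[mf lf] /inL2P[mg lg]; apply/inL2P.
have mfg : cmeasurable (-1) 1 (fun t => f t + g t) by exact: cmeasurableD.
split; first exact: mfg.
apply: (le_integrable _ _ _ (integrable_lin 2 2 lf lg)) => //.
  by apply/measurable_EFinP; apply: measurable_sqr_normc.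
move=> t _ /=; rewrite lee_fin ger0_norm ?sqr_ge0// ger0_norm; last first.
  by rewrite addr_ge0// mulr_ge0// sqr_ge0.
have h := normc_leD (f t) (g t); have := normc_ge0 (f t + g t).
have := normc_ge0 (f t); have := normc_ge0 (g t).
move: (normc (f t)) (normc (g t)) (normc (f t + g t)) h => p q r h q0 p0 r0.
have h2 : r ^+ 2 <= (p + q) ^+ 2 by rewrite ler_pXn2r ?nnegrE// addr_ge0.
have := sqr_ge0 (p - q); nra.
Qed.

Lemma measure_symmetric_itv : mu `[(-1 : R), 1] = 2%:E.
Proof.
have := @lebesgue_measure_itv R `[(-1 : R), 1].
by rewrite /= lte_fin ifT ?gtrN// => ->; rewrite -EFinB opprK.
Qed.

Lemma sqnormL2_bounded (K : R) f : cmeasurable (-1) 1 f ->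
  (forall t, -1 <= t <= 1 -> normc (f t) <= K) -> (sqnormL2 f <= (2 * K ^+ 2)%:E)%E.
Proof.
move=> mf bf.
have h := @integral_le_bound _ _ R mu `[(-1 : R), 1] (EFin \o (fun t => normc (f t) ^+ 2)) (K ^+ 2)%:E.
have -> : sqnormL2 f = (\int[mu]_(x in `[(-1)%R : R, 1%R]) `|(EFin \o (fun t => (normc (f t) ^+ 2)%R)) x|)%E.
  by apply: eq_integral => t _; rewrite /= ger0_norm// sqr_ge0.
apply: (le_trans (h _ _ _ _)) => //.
- by apply/measurable_EFinP; apply: measurable_sqr_normc.
- by rewrite lee_fin sqr_ge0.
- apply: aeW => t; rewrite /= in_itv/= => tI; rewrite lee_fin ger0_norm ?sqr_ge0//.
  have n0 := normc_ge0 (f t); have nK := bf t tI.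
  by rewrite ler_pXn2r ?nnegrE// (le_trans n0).
rewrite [X in (_ * X)%E](measure_symmetric_itv).
by rewrite -EFinM lee_fin mulrC.
Qed.

Lemma bounded_inL2 (K : R) f : cmeasurable (-1) 1 f ->
  (forall t, -1 <= t <= 1 -> normc (f t) <= K) -> inL2 f /\ normL2 f <= 2 * K.
Proof.
move=> mf bf; have h := sqnormL2_bounded mf bf.
have K0 : 0 <= K by apply: le_trans (normc_ge0 (f 0)) (bf 0 _); lra.
split; first by case: mf => ? ?; split => //; exact: le_lt_trans h (ltry _).
have s0 : (0 <= sqnormL2 f)%E by apply: integral_ge0 => t _; rewrite lee_fin sqr_ge0.
rewrite /normL2.
have -> : 2 * K = Num.sqrt ((2 * K) ^+ 2) by rewrite sqrtr_sqr ger0_norm// mulr_ge0.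
apply: ler_wsqrtr.
have fs : sqnormL2 f \is a fin_num by rewrite ge0_fin_numE// (le_lt_trans h (ltry _)).
rewrite -lee_fin fineK//; apply: (le_trans h); rewrite lee_fin; nra.
Qed.

Lemma normL2_ge0 f : 0 <= normL2 f. Proof. exact: sqrtr_ge0. Qed.

(** Young's inequality |f| <= s / 2 + |f|^2 / (2 s), integrated over an interval of length 2, gives
    the bound s + N^2 / (2 s) with N the L^2 norm. One takes s = N, or lets s tend to 0 when N =
    0. *)
Lemma inL2_component (p : R -> R) f : inL2 f -> measurable_fun `[(-1 : R), 1] p ->
  (forall t, `|p t| <= normc (f t)) ->
  mu.-integrable `[(-1 : R), 1] (EFin \o p) /\ \int[mu]_(t in `[(-1 : R), 1]) `|p t| <= 2 * normL2 f.
Proof.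
move=> /inL2P[mf lf] mp pf.
have i1 : mu.-integrable `[(-1 : R), 1] (EFin \o (fun _ : R => 1 : R)).
  by apply: within_integrable; apply: continuous_subspaceT => ?; exact: cvg_cst.
have young (s : R) t : 0 < s -> `|p t| <= s / 2 * 1 + (2 * s)^-1 * normc (f t) ^+ 2.
  move=> s0; apply: (le_trans (pf t)).
  have -> : s / 2 * 1 + (2 * s)^-1 * normc (f t) ^+ 2 = normc (f t) + (2 * s)^-1 * (s - normc (f t)) ^+ 2.
    by field; rewrite gt_eqF.
  by rewrite lerDl mulr_ge0 ?sqr_ge0// invr_ge0 mulr_ge0// ltW.
have dom (s : R) : mu.-integrable `[(-1 : R), 1] (EFin \o (fun t => s / 2 * 1 + (2 * s)^-1 * normc (f t) ^+ 2)).
  exact: integrable_lin.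
have ip : mu.-integrable `[(-1 : R), 1] (EFin \o p).
  apply: (le_integrable _ _ _ (dom 1)) => //; first exact/measurable_EFinP.
  by move=> t _ /=; rewrite lee_fin (le_trans (young 1 t ltr01))// ler_norm.
split; first exact: ip.
have Q : fine (sqnormL2 f) = \int[mu]_(t in `[(-1 : R), 1]) normc (f t) ^+ 2 by [].
have NE : normL2 f ^+ 2 = \int[mu]_(t in `[(-1 : R), 1]) normc (f t) ^+ 2.
  by rewrite sqr_sqrtr// Rintegral_ge0// => t _; exact: sqr_ge0.
have bound (s : R) : 0 < s -> \int[mu]_(t in `[(-1 : R), 1]) `|p t| <= s + (2 * s)^-1 * normL2 f ^+ 2.
  move=> s0; have -> : s + (2 * s)^-1 * normL2 f ^+ 2 =
    \int[mu]_(t in `[(-1 : R), 1]) (s / 2 * 1 + (2 * s)^-1 * normc (f t) ^+ 2).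
    rewrite Rintegral_lin// NE; congr (_ + _).
    rewrite Rintegral_cst// [X in fine X](measure_symmetric_itv)/=.
    by field.
  apply: le_Rintegral => //; last by move=> t _; exact: young.
  by have := @integrable_norm _ _ _ mu _ _ ip.
have [N0|N0] := eqVneq (normL2 f) 0.
  rewrite N0 mulr0; apply/ler_addgt0Pr => s s0; rewrite add0r.
  by apply: (le_trans (bound s s0)); rewrite N0 expr0n mulr0 addr0.
have Np : 0 < normL2 f by rewrite lt_neqAle eq_sym N0 normL2_ge0.
apply: (le_trans (bound _ Np)).
have -> : (2 * normL2 f)^-1 * normL2 f ^+ 2 = normL2 f / 2 by field.
lra.
Qed.

Lemma inL2_cintegrable f : inL2 f -> cintegrable (-1) 1 f /\
  \int[mu]_(t in `[(-1 : R), 1]) `|Re (f t)| <= 2 * normL2 f /\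
  \int[mu]_(t in `[(-1 : R), 1]) `|Im (f t)| <= 2 * normL2 f.
Proof.
move=> hf; have [m1 m2 _] := hf.
have [i1 b1] := inL2_component hf m1 (fun t => normr_Re_le (f t)).
have [i2 b2] := inL2_component hf m2 (fun t => normr_Im_le (f t)).
by split.
Qed.

End square_integrable.

(** * From the spectrum to eigenfunctions *)

Section resolvent.
Context {R : realType}.
Local Notation mu := (@lebesgue_measure R).
Local Notation Re := complex.Re.
Local Notation Im := complex.Im.
Local Notation normc := ComplexField.Normc.normc.
Implicit Types (a b x t h : R) (f g u v : R -> R[i]) (z E : R[i]).

Definition odecoef h delta beta E (t : R) : R[i] :=
  (h ^- 2)%:C * (Vpert delta beta t - E).

(** The coefficient of one side continued past the jump, with s = delta or - delta. It is continuous
    everywhere and agrees with [odecoef] near any point of its own side, which gives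
    differentiability there. *)
Definition smoothcoef h (s : R) E (t : R) : R[i] :=
  (h ^- 2)%:C * (0 +i* (t ^+ 2 + s) - E).

Lemma odecoefE h delta beta E t :
  odecoef h delta beta E t =
  if beta < t then smoothcoef h delta E t else smoothcoef h (- delta) E t.
Proof. by rewrite /odecoef /smoothcoef /Vpert; case: ifP. Qed.

Lemma ccontinuous_smoothcoef a b h s E : ccontinuous a b (smoothcoef h s E).
Proof.
apply: ccontinuousM; first exact: ccontinuous_cst.
apply: ccontinuousD; last exact: ccontinuous_cst.
split; apply: continuous_subspaceT => t /=; first exact: cvg_cst.
by apply: cvgD; [rewrite expr2; apply: cvgM; exact: cvg_id|exact: cvg_cst].
Qed.

Lemma cmeasurable_if a b beta f g : cmeasurable a b f -> cmeasurable a b g ->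
  cmeasurable a b (fun t => if beta < t then f t else g t).
Proof.
move=> [f1 f2] [g1 g2].
have mb : measurable_fun `[a, b] (fun t : R => beta < t).
  by apply: measurable_fun_ltr; [exact: measurable_cst|exact: measurable_id].
have sub (A : set R) : `[a, b] `&` A `<=` `[a, b]%classic by move=> x [].
split.
  rewrite (_ : (fun t => _) = (fun t => if beta < t then Re (f t) else Re (g t))); last first.
    by apply/funext => t; case: ifP.
  apply: (measurable_fun_if (measurable_itv _) mb).
    exact: (measurable_funS (measurable_itv _) (sub _) f1).
  exact: (measurable_funS (measurable_itv _) (sub _) g1).
rewrite (_ : (fun t => _) = (fun t => if beta < t then Im (f t) else Im (g t))); last first.
  by apply/funext => t; case: ifP.
apply: (measurable_fun_if (measurable_itv _) mb).
  exact: (measurable_funS (measurable_itv _) (sub _) f2).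
exact: (measurable_funS (measurable_itv _) (sub _) g2).
Qed.

Lemma odecoef_measurable a b h delta beta E : cmeasurable a b (odecoef h delta beta E).
Proof.
rewrite (_ : odecoef _ _ _ _ = fun t => if beta < t then smoothcoef h delta E t else smoothcoef h (- delta) E t).
  by apply: cmeasurable_if; apply: ccontinuous_measurable; exact: ccontinuous_smoothcoef.
by apply/funext => t; exact: odecoefE.
Qed.

Lemma odecoef_bounded a b h delta beta E :
  exists2 M, 0 < M & forall t, a <= t <= b -> normc (odecoef h delta beta E t) <= M.
Proof.
have [M1 M10 h1] := ccontinuous_bounded (ccontinuous_smoothcoef a b h delta E).
have [M2 M20 h2] := ccontinuous_bounded (ccontinuous_smoothcoef a b h (- delta) E).
exists (M1 + M2); first exact: addr_gt0.
move=> t tab; rewrite odecoefE; case: ifP => _.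
  by apply: (le_trans (h1 t tab)); rewrite lerDl ltW.
by apply: (le_trans (h2 t tab)); rewrite lerDr ltW.
Qed.

Lemma cmeasurable_bounded_integrable a b (M : R) f : cmeasurable a b f ->
  (forall t, a <= t <= b -> normc (f t) <= M) -> cintegrable a b f.
Proof.
move=> [m1 m2] bf.
have iM : mu.-integrable `[a, b] (EFin \o (fun _ : R => M)).
  by apply: within_integrable; apply: continuous_subspaceT => ?; exact: cvg_cst.
have MM t : a <= t <= b -> normc (f t) <= `|M|.
  by move=> /bf /le_trans; apply; exact: ler_norm.
split; apply: (le_integrable _ _ _ iM); try exact: measurable_itv.
- exact/measurable_EFinP.
- move=> t /=; rewrite in_itv/= lee_fin => tab.
  by apply: (le_trans (normr_Re_le _)); exact: MM.
- exact/measurable_EFinP.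
- move=> t /=; rewrite in_itv/= lee_fin => tab.
  by apply: (le_trans (normr_Im_le _)); exact: MM.
Qed.

Lemma odecoef_mul h delta beta E u : ccontinuous (-1) 1 u ->
  cmeasurable (-1) 1 (fun t => odecoef h delta beta E t * u t) /\
  exists2 M, 0 < M & forall t, -1 <= t <= 1 -> normc (odecoef h delta beta E t * u t) <= M.
Proof.
move=> cu; split.
  by apply: cmeasurableM; [exact: odecoef_measurable|exact: ccontinuous_measurable].
have [M1 M10 h1] := odecoef_bounded (-1) 1 h delta beta E.
have [M2 M20 h2] := ccontinuous_bounded cu.
exists (M1 * M2); first exact: mulr_gt0.
by move=> t tI; rewrite normcM; apply: ler_pM; rewrite ?normc_ge0 ?h1 ?h2.
Qed.

Lemma odecoef_mul_integrable h delta beta E u : ccontinuous (-1) 1 u ->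
  cintegrable (-1) 1 (fun t => odecoef h delta beta E t * u t).
Proof.
by move=> /(odecoef_mul h delta beta E)[m [M _ b]]; exact: cmeasurable_bounded_integrable m b.
Qed.

Lemma near_eq_continuous (p q : R -> R) x : (\forall y \near x, p y = q y) ->
  {for x, continuous q} -> {for x, continuous p}.
Proof.
move=> pq cq; rewrite /prop_for /continuous_at (nbhs_singleton pq).
by apply: cvg_trans cq; apply: near_eq_cvg; apply: filterS pq.
Qed.

Lemma strong_of_integral h delta beta E u v :
  ccontinuous (-1) 1 u -> ccontinuous (-1) 1 v ->
  (forall x, -1 <= x <= 1 -> u x = u (-1) + cintegral (-1) x v) ->
  (forall x, -1 <= x <= 1 -> v x = v (-1) + cintegral (-1) x (fun t => odecoef h delta beta E t * u t)) ->
  strong_solution h delta beta E u v.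
Proof.
move=> cu cv eu ev; split => // x x11 xb.
have deq W w (w0 : R[i]) : cintegrable (-1) 1 w ->
    {for x, continuous (fun t => Re (w t))} -> {for x, continuous (fun t => Im (w t))} ->
    (forall x, -1 <= x <= 1 -> W x = w0 + cintegral (-1) x w) -> is_cderive W x (w x).
  move=> iw c1 c2 eW.
  have h1 : is_cderive (fun x => w0 + cintegral (-1) x w) x (w x).
    rewrite -[w x]add0r; apply: is_cderiveD; first exact: is_cderive_cst.
    exact: (is_cderive_cintegral iw x11 c1 c2).
  exact: (is_cderive_near_eq x11 eW h1).
split.
  apply: (deq u v (u (-1))) => //; first exact: ccontinuous_integrable.
    exact: (within_itv_continuous cv.1 x11).
  exact: (within_itv_continuous cv.2 x11).
have [s hs] : exists s, \forall y \near x, odecoef h delta beta E y = smoothcoef h s E y.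
  have [bx|xb'|e] := ltgtP beta x; last by rewrite e eqxx in xb.
    by exists delta; near=> y; rewrite odecoefE ifT//; near: y; exact: lt_nbhsr.
  exists (- delta); near=> y; rewrite odecoefE ifF//; apply/negbTE; rewrite -leNgt.
  by apply: ltW; near: y; exact: lt_nbhsl.
apply: (deq v (fun t => odecoef h delta beta E t * u t) (v (-1))) => //.
- exact: odecoef_mul_integrable.
- have c := ccontinuousM (ccontinuous_smoothcoef (-1) 1 h s E) cu.
  apply: near_eq_continuous (within_itv_continuous c.1 x11).
  by apply: filterS hs => y ->.
- have c := ccontinuousM (ccontinuous_smoothcoef (-1) 1 h s E) cu.
  apply: near_eq_continuous (within_itv_continuous c.2 x11).
  by apply: filterS hs => y ->.
Unshelve. all: by end_near. Qed.

Lemma strong_solution_unique h delta beta E u v : -1 < beta < 1 ->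
  strong_solution h delta beta E u v -> u (-1) = 0 -> v (-1) = 0 ->
  forall x, -1 <= x <= 1 -> u x = 0 /\ v x = 0.
Proof.
move=> /andP[b1 b2] [cu cv duv] u0 v0.
have [M M0 bM] := odecoef_bounded (-1) 1 h delta beta E.
have one : normc (1 : R[i]) = 1 by exact: ComplexField.Normc.normc1.
have step a b : -1 <= a -> b <= 1 -> b <= beta \/ beta <= a -> u a = 0 -> v a = 0 ->
    forall x, a <= x <= b -> u x = 0 /\ v x = 0.
  move=> a1 b11 side ua va x xab.
  have io t : a < t < b -> -1 < t < 1 /\ t != beta.
    move=> /andP[? ?]; split; first by apply/andP; split; lra.
    by apply/eqP => tb; case: side => ?; lra.
  have le t : a < t < b -> -1 <= t <= 1.
    by move=> /io[/andP[? ?] _]; rewrite !ltW.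
  apply: (@linear_ode_unique R a b (1 + M) u v (fun=> 1) (odecoef h delta beta E)) => //.
  - exact: ccontinuousS a1 b11 cu.
  - exact: ccontinuousS a1 b11 cv.
  - by move=> t _; rewrite one lerDl ltW.
  - by move=> t /le /bM /le_trans; apply; rewrite lerDr.
  - by move=> t /io[t1 t2]; rewrite mul1r; exact: (duv t t1 t2).1.
  - by move=> t /io[t1 t2]; exact: (duv t t1 t2).2.
have left x := @step (-1) beta (lexx _) (ltW b2) (or_introl (lexx _)) u0 v0 x.
have [ub vb] : u beta = 0 /\ v beta = 0 by apply: left; rewrite (ltW b1) lexx.
move=> x /andP[x1 x2]; have [xb|bx] := leP x beta.
  by apply: left; rewrite x1.
by apply: (@step beta 1 (ltW b1) (lexx _) (or_intror (lexx _)) ub vb); rewrite (ltW bx).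
Qed.

Lemma strong_solution_lin h delta beta E u1 v1 u2 v2 c :
  strong_solution h delta beta E u1 v1 -> strong_solution h delta beta E u2 v2 ->
  strong_solution h delta beta E (fun t => u1 t + c * u2 t) (fun t => v1 t + c * v2 t).
Proof.
move=> [cu1 cv1 d1] [cu2 cv2 d2]; split.
- by apply: ccontinuousD => //; apply: ccontinuousM => //; exact: ccontinuous_cst.
- by apply: ccontinuousD => //; apply: ccontinuousM => //; exact: ccontinuous_cst.
move=> x x1 xb; have [du1 dv1] := d1 x x1 xb; have [du2 dv2] := d2 x x1 xb.
split; first by apply: is_cderiveD => //; exact: is_cderiveZ.
apply: (is_cderive_eq (is_cderiveD dv1 (is_cderiveZ c dv2))).
by rewrite [RHS]mulrDr; congr (_ + _); exact: mulrCA.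
Qed.

Lemma cintegral_continuous f (w0 : R[i]) g : cintegrable (-1) 1 f ->
  (forall x, -1 <= x <= 1 -> g x = w0 + cintegral (-1) x f) -> ccontinuous (-1) 1 g.
Proof.
move=> [f1 f2] eg; have le11 : (-1 : R) <= 1 by lra.
split.
  apply: (@subspace_eq_continuous _ _ _ (fun x => Re w0 + \int[mu]_(t in `[(-1 : R), x]) Re (f t))).
    move=> x /set_mem/=; rewrite in_itv/= => /eg e; apply/esym.
    by rewrite /from_subspace e cReD.
  move=> x; apply: cvgD; first exact: cvg_cst.
  exact: (@parameterized_integral_continuous R (-1) 1 _ le11 f1).
apply: (@subspace_eq_continuous _ _ _ (fun x => Im w0 + \int[mu]_(t in `[(-1 : R), x]) Im (f t))).
  move=> x /set_mem/=; rewrite in_itv/= => /eg e; apply/esym.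
  by rewrite /from_subspace e cImD.
move=> x; apply: cvgD; first exact: cvg_cst.
exact: (@parameterized_integral_continuous R (-1) 1 _ le11 f2).
Qed.

Lemma ccontinuous_inL2 u : ccontinuous (-1) 1 u -> inL2 u.
Proof.
move=> cu; have [M _ bM] := ccontinuous_bounded cu.
exact: (bounded_inL2 (ccontinuous_measurable cu) bM).1.
Qed.

End resolvent.

Section spectrum_eigenvalue.
Context {R : realType}.
Local Notation mu := (@lebesgue_measure R).
Local Notation normc := ComplexField.Normc.normc.
Implicit Types (a b x t h : R) (f g u v : R -> R[i]) (z E : R[i]).

Lemma normL2Z f c : inL2 f -> normL2 (fun t => c * f t) = normc c * normL2 f.
Proof.
move=> /inL2P[_ lf].
have e : fine (sqnormL2 (fun t => c * f t)) = normc c ^+ 2 * fine (sqnormL2 f).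
  have e1 : \int[mu]_(t in `[(-1 : R), 1]) normc (c * f t) ^+ 2 =
      \int[mu]_(t in `[(-1 : R), 1]) (normc c ^+ 2 * normc (f t) ^+ 2).
    by apply: eq_Rintegral => t _; rewrite normcM exprMn.
  by rewrite RintegralZl in e1.
by rewrite /normL2 e sqrtrM ?sqr_ge0// sqrtr_sqr ger0_norm// normc_ge0.
Qed.

Lemma spectrum_strong_solution h delta beta E : -1 < beta < 1 -> 0 < h ->
  spectrum (Pop h delta beta) E ->
  exists u v, [/\ strong_solution h delta beta E u v, u (-1) = 0, u 1 = 0 & v (-1) = 1].
Proof.
move=> hb h0 hsp.
have lt11 : (-1 : R) < 1 by lra.
have I1 : -1 <= (1 : R) <= 1.
  by apply/andP; split; lra.
have Im1 : -1 <= (-1 : R) <= 1.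
  by apply/andP; split; lra.
pose ga := odecoef h delta beta E.
have [M M0 bM] := odecoef_bounded (-1) 1 h delta beta E.
have one : normc (1 : R[i]) = 1 by exact: ComplexField.Normc.normc1.
have M10 : 0 < 1 + M by exact: addr_gt0.
have c1 : ccontinuous (-1) 1 (fun _ : R => 1 : R[i]) by exact: ccontinuous_cst.
have b1 t : -1 <= t <= 1 -> normc (1 : R[i]) <= 1 + M by move=> _; rewrite one lerDl ltW.
have b2 t : -1 <= t <= 1 -> normc (ga t) <= 1 + M by move=> /bM /le_trans; apply; rewrite lerDr.
have [B B0 ex] := cpicard_exists lt11 M10 (ccontinuous_measurable c1)
  (odecoef_measurable (-1) 1 h delta beta E) b1 b2.
have i0 : cintegrable (-1) 1 (fun _ : R => 0 : R[i]) by exact/ccontinuous_integrable/ccontinuous_cst.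
have [uL [vL [[cuL cvL] euL evL bL _]]] : exists u v : R -> R[i],
    [/\ ccontinuous (-1) 1 u /\ ccontinuous (-1) 1 v,
        forall x, -1 <= x <= 1 -> u x = 0 + cintegral (-1) x (fun t => 1 * v t),
        forall x, -1 <= x <= 1 -> v x = 1 + cintegral (-1) x (fun t => ga t * u t + 0),
        forall x, -1 <= x <= 1 -> normc (u x) <= B * 1 /\ normc (v x) <= B * 1 & True].
  have [||u [v [h1 h2 h3 h4 _]]] := ex (fun=> 0) 0 1 1 i0.
  - by rewrite ComplexField.Normc.normc0.
  - by rewrite one /= !normr0 !Rintegral_cst//= !mul0r !addr0.
  by exists u, v; split.
have uLm1 : uL (-1) = 0 by rewrite euL// cintegral_itv1 addr0.
have vLm1 : vL (-1) = 1 by rewrite evL// cintegral_itv1 addr0.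
have uLE x : -1 <= x <= 1 -> uL x = cintegral (-1) x vL.
  by move=> xI; rewrite euL// add0r; congr (cintegral _ _); apply/funext => t; rewrite mul1r.
have vLE x : -1 <= x <= 1 -> vL x = 1 + cintegral (-1) x (fun t => ga t * uL t).
  by move=> xI; rewrite evL//; congr (_ + cintegral _ _ _); apply/funext => t; rewrite addr0.
have sL : strong_solution h delta beta E uL vL.
  apply: strong_of_integral => // x xI; first by rewrite uLm1 add0r uLE.
  by rewrite vLm1 vLE.
have [uL1|uL1] := pselect (uL 1 = 0); first by exists uL, vL.
exfalso; apply: hsp.
have nL : 0 < normc (uL 1).
  by rewrite lt_neqAle normc_ge0 andbT eq_sym normc_eq0; apply/eqP.
(* The forced solution is at most B C with C = 4 h^-2 times the norm of f, and its correction at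
   most B C B / |uL 1|. The 4 adds the L^1 bounds of the real and imaginary parts, each twice the
   L^2 norm; the outer 2 passes from the supremum to the L^2 norm. *)
pose K := 2 * (4 * h ^- 2 * (B + B * B / normc (uL 1))).
have h20 : 0 < h ^- 2 by rewrite invr_gt0 exprn_gt0.
exists K => f L2f.
(* Solving - h^2 u'' + V u = f + E u for u'' leaves - h^-2 f beside the homogeneous term. *)
pose F t := - (h ^- 2)%:C * f t.
have L2F : inL2 F by exact: inL2Z.
have [iF [F1 F2]] := inL2_cintegrable L2F.
have NF : normL2 F = h ^- 2 * normL2 f.
  by rewrite normL2Z// normc_opp normc_real gtr0_norm.
pose C := 4 * h ^- 2 * normL2 f.
have C0 : 0 <= C by rewrite mulr_ge0 ?normL2_ge0// mulr_ge0// ltW.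
have [up [vp [[cup cvp] eup evp bp]]] : exists u v : R -> R[i],
    [/\ ccontinuous (-1) 1 u /\ ccontinuous (-1) 1 v,
        forall x, -1 <= x <= 1 -> u x = 0 + cintegral (-1) x (fun t => 1 * v t),
        forall x, -1 <= x <= 1 -> v x = 0 + cintegral (-1) x (fun t => ga t * u t + F t) &
        forall x, -1 <= x <= 1 -> normc (u x) <= B * C /\ normc (v x) <= B * C].
  have [||u [v [h1 h2 h3 h4 _]]] := ex F 0 0 C iF.
  - by rewrite ComplexField.Normc.normc0.
  - by rewrite ComplexField.Normc.normc0 add0r /C -(mulrA 4) -NF; lra.
  by exists u, v; split.
have upm1 : up (-1) = 0 by rewrite eup// cintegral_itv1 addr0.
have vpm1 : vp (-1) = 0 by rewrite evp// cintegral_itv1 addr0.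
(* Chosen so that u 1 = 0; it is also the value of [v] at -1. *)
pose c := - (up 1 / uL 1).
pose u t := up t + c * uL t; pose v t := vp t + c * vL t.
have cu : ccontinuous (-1) 1 u.
  by apply: ccontinuousD => //; apply: ccontinuousM => //; exact: ccontinuous_cst.
have cv : ccontinuous (-1) 1 v.
  by apply: ccontinuousD => //; apply: ccontinuousM => //; exact: ccontinuous_cst.
have um1 : u (-1) = 0 by rewrite /u upm1 uLm1 mulr0 addr0.
have u1 : u 1 = 0.
  by rewrite /u /c mulNr divfK ?subrr//; apply/eqP.
pose w t := ga t * u t + F t.
have igu g : ccontinuous (-1) 1 g -> cintegrable (-1) 1 (fun t => ga t * g t).
  exact: odecoef_mul_integrable.
have sub x g : -1 <= x <= 1 -> cintegrable (-1) 1 g -> cintegrable (-1) x g.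
  by move=> /andP[_ x1]; exact: cintegrableS.
have uE x : -1 <= x <= 1 -> u x = cintegral (-1) x v.
  move=> xI; rewrite /v cintegralD ?cintegralZ.
  - rewrite /u uLE// eup// add0r; congr (cintegral _ _ _ + _).
    by apply/funext => t; rewrite mul1r.
  - exact/(sub _ _ xI)/ccontinuous_integrable.
  - exact/(sub _ _ xI)/ccontinuous_integrable.
  - exact/cintegrableZ/(sub _ _ xI)/ccontinuous_integrable.
have iw : cintegrable (-1) 1 w by apply: cintegrableD => //; exact: igu.
have vE x : -1 <= x <= 1 -> v x = c + cintegral (-1) x w.
  move=> xI; rewrite /v evp// vLE// add0r mulrDr mulr1 addrCA; congr (_ + _).
  rewrite -cintegralZ; last exact/(sub _ _ xI)/igu.
  rewrite -cintegralD.
  - by congr (cintegral _ _ _); apply/funext => t; rewrite /w /u; ring.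
  - by apply: sub => //; apply: cintegrableD => //; exact: igu.
  - by apply: cintegrableZ; apply: sub => //; exact: igu.
have vm1 : v (-1) = c by rewrite vE// cintegral_itv1 addr0.
have L2u : inL2 u by exact: ccontinuous_inL2.
have hE0 : (h ^+ 2)%:C != 0 :> R[i].
  by rewrite -normc_eq0 normc_real normr_eq0 expf_neq0// gt_eqF.
have hVE : (h ^- 2)%:C = ((h ^+ 2)%:C)^-1 :> R[i] by rewrite fmorphV.
exists u; split.
- split => //; exists w.
    split; last first.
      exists v => x xI; split; first by rewrite um1 add0r uE.
      by rewrite vm1 vE.
    have [mgu [M' _ bgu]] := odecoef_mul h delta beta E cu.
    by apply: inL2D => //; exact: (bounded_inL2 mgu bgu).1.
  apply: aeW => x _; rewrite /w /ga /F /odecoef hVE.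
  by move: ((h ^+ 2)%:C) hE0 => k k0; field.
- have bu t : -1 <= t <= 1 -> normc (u t) <= C * (B + B * B / normc (uL 1)).
    move=> tI; apply: (le_trans (normc_leD _ _)); rewrite mulrDr; apply: lerD.
      by rewrite mulrC; exact: (bp t tI).1.
    rewrite normcM /c normc_opp normcM ComplexField.Normc.normcV.
    have h1 := (bp 1 I1).1; have h2 := (bL t tI).1; rewrite mulr1 in h2.
    have -> : C * (B * B / normc (uL 1)) = (B * C / normc (uL 1)) * B by ring.
    apply: ler_pM; rewrite ?normc_ge0//; first by rewrite divr_ge0 ?normc_ge0.
    by rewrite ler_wpM2r// invr_ge0 normc_ge0.
  apply: (le_trans (bounded_inL2 (ccontinuous_measurable cu) bu).2).
  by rewrite le_eqVlt; apply/orP; left; apply/eqP; rewrite /K /C; ring.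
- move=> u' [L2u' u'm1 u'1 [w' [L2w' [v' uv']] aew]].
  have [iw' _] := inL2_cintegrable L2w'.
  have cv' : ccontinuous (-1) 1 v'.
    by apply: (cintegral_continuous (w0 := v' (-1)) iw') => x /uv'[].
  have cu' : ccontinuous (-1) 1 u'.
    by apply: (cintegral_continuous (w0 := u' (-1)) (ccontinuous_integrable cv')) => x /uv'[].
  have iw2 : cintegrable (-1) 1 (fun t => ga t * u' t + F t).
    by apply: cintegrableD => //; exact: igu.
  have cint_m a b g : cintegrable a b g -> cmeasurable a b g.
    by move=> [/integrableP[/measurable_EFinP ? _] /integrableP[/measurable_EFinP ? _]].
  (* [w'] satisfies the equation only up to a null set, which its integral does not see. *)
  have v'E x : -1 <= x <= 1 -> v' x = v' (-1) + cintegral (-1) x (fun t => ga t * u' t + F t).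
    move=> xI; rewrite {1}(uv' x xI).2; congr (_ + _).
    apply: cintegral_ae_eq; [exact/cint_m/sub|exact/cint_m/sub|].
    apply: (@filterS _ _ (ae_filter_ringOfSetsType mu) _ _ _ aew) => t ht /andP[t1 t2].
    have tI : -1 <= t <= 1 by rewrite t1 (le_trans t2)//; case/andP : xI.
    have e := ht tI; rewrite /ga /odecoef /F hVE.
    have -> : w' t = ((h ^+ 2)%:C)^-1 * (Vpert delta beta t * u' t - (- (h ^+ 2)%:C * w' t + Vpert delta beta t * u' t)).
      by move: ((h ^+ 2)%:C) hE0 => k k0; field.
    by rewrite -e; ring.
  pose d t := u' t + (-1) * u t; pose dv t := v' t + (-1) * v t.
  have cd : ccontinuous (-1) 1 d.
    by apply: ccontinuousD => //; apply: ccontinuousM => //; exact: ccontinuous_cst.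
  have cdv : ccontinuous (-1) 1 dv.
    by apply: ccontinuousD => //; apply: ccontinuousM => //; exact: ccontinuous_cst.
  have dm1 : d (-1) = 0 by rewrite /d u'm1 um1 mulr0 addr0.
  have sd : strong_solution h delta beta E d dv.
    apply: strong_of_integral => // x xI.
      rewrite dm1 add0r /dv cintegralD ?cintegralZ.
      - by rewrite /d (uv' x xI).1 u'm1 add0r uE.
      - exact/(sub _ _ xI)/ccontinuous_integrable.
      - exact/(sub _ _ xI)/ccontinuous_integrable.
      - exact/cintegrableZ/(sub _ _ xI)/ccontinuous_integrable.
    rewrite /dv vm1 v'E// vE// mulrDr addrACA; congr (_ + _).
    rewrite -cintegralZ; last exact: sub.
    rewrite -cintegralD.
    - by congr (cintegral _ _ _); apply/funext => t; rewrite /w /d /ga; ring.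
    - exact: sub.
    - by apply: cintegrableZ; exact: sub.
  (* The difference [d] has the same initial values as dv (-1) uL and so equals it. At 1 the former
     vanishes and [uL] does not, whence dv (-1) = 0. *)
  have sD := strong_solution_lin (- dv (-1)) sd sL.
  have D0 := strong_solution_unique hb sD.
  rewrite dm1 uLm1 vLm1 mulr0 addr0 mulr1 subrr in D0.
  have dE x : -1 <= x <= 1 -> d x = dv (-1) * uL x.
    by move=> xI; have [+ _] := D0 erefl erefl x xI; rewrite mulNr => /eqP; rewrite subr_eq0 => /eqP.
  have : dv (-1) * uL 1 = 0 by rewrite -dE// /d u'1 u1 mulr0 addr0.
  move=> /eqP; rewrite mulf_eq0 => /orP[/eqP dv0|/eqP//].
  apply: aeW => x xI; have := dE x xI; rewrite dv0 mul0r /d mulN1r => /eqP.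
  by rewrite subr_eq0 => /eqP.
Qed.

End spectrum_eigenvalue.

(** * The curves Gamma *)

Section complex_topology.
Context {R : realType}.
Local Notation Re := complex.Re.
Local Notation Im := complex.Im.
Local Notation normc := ComplexField.Normc.normc.

Lemma normc_normE (z : R[i]) : `|z| = (normc z)%:C.
Proof. by case: z => x y; rewrite normc_def. Qed.

Lemma cvg_complexP (T : Type) (F : set_system T) (FF : Filter F) (f : T -> R[i]) (l : R[i]) :
  (f x : R[i]^o) @[x --> F] --> (l : R[i]^o) <->
  (Re (f x) @[x --> F] --> Re l) /\ (Im (f x) @[x --> F] --> Im l).
Proof.
split.
- move=> /cvgrPdist_lt h; split; apply/cvgrPdist_lt => e e0.
    have e0' : (0 : R[i]) < e%:C by rewrite ltcR.
    apply: filterS (h _ e0') => x; rewrite normc_normE ltcR; apply: le_lt_trans.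
    by rewrite -cReN -cReD; exact: normr_Re_le.
  have e0' : (0 : R[i]) < e%:C by rewrite ltcR.
  apply: filterS (h _ e0') => x; rewrite normc_normE ltcR; apply: le_lt_trans.
  by rewrite -cImN -cImD; exact: normr_Im_le.
- move=> [/cvgrPdist_lt h1 /cvgrPdist_lt h2]; apply/cvgrPdist_lt => e e0.
  have [r rE] : exists r : R, e = r%:C.
    exists (Re e); apply: complex_ext => //=.
    by move: e0; rewrite ltcE => /andP[/eqP].
  have r0 : 0 < r by move: e0; rewrite rE ltcR.
  have r20 : 0 < r / 2 by rewrite divr_gt0.
  apply: filterS2 (h1 _ r20) (h2 _ r20) => x k1 k2.
  rewrite normc_normE rE ltcR; apply: (le_lt_trans (normc_le_ReIm _)).
  rewrite cReD cImD cReN cImN; lra.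
Qed.

End complex_topology.

(** * Real and imaginary parts of the square root *)

Section real_sqrt.
Context {R : realType}.
Implicit Types (lam y : R).

(* sqrt (lam + i y) = sqrt_re lam y + i sqrt_im lam y for lam > 0 *)
Definition sqrt_re lam y : R := Num.sqrt ((Num.sqrt (lam ^+ 2 + y ^+ 2) + lam) / 2).
Definition sqrt_im lam y : R := y / (2 * sqrt_re lam y).

Lemma modulus_bounds lam y : 0 < lam ->
  lam <= Num.sqrt (lam ^+ 2 + y ^+ 2) <= lam + `|y|.
Proof.
move=> l0; apply/andP; split.
  rewrite -[leLHS](gtr0_norm l0) -sqrtr_sqr ler_wsqrtr// lerDl sqr_ge0//.
have n0 := normr_ge0 y.
have s0 : 0 <= lam + `|y| by lra.
rewrite -[leRHS](ger0_norm s0) -sqrtr_sqr ler_wsqrtr// sqrrD real_normK ?num_real//.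
have : 0 <= lam * `|y| by rewrite mulr_ge0// ltW.
rewrite mulr2n; lra.
Qed.

Lemma sqrt_re_sqr lam y : 0 < lam ->
  sqrt_re lam y ^+ 2 = (Num.sqrt (lam ^+ 2 + y ^+ 2) + lam) / 2.
Proof.
move=> l0; have /andP[h _] := modulus_bounds y l0.
by rewrite /sqrt_re sqr_sqrtr// divr_ge0//; lra.
Qed.

Lemma sqrt_re_ge lam y : 0 < lam -> Num.sqrt lam <= sqrt_re lam y.
Proof. by move=> l0; have /andP[h _] := modulus_bounds y l0; rewrite /sqrt_re ler_wsqrtr//; lra. Qed.

Lemma sqrt_re_gt0 lam y : 0 < lam -> 0 < sqrt_re lam y.
Proof. by move=> l0; apply: lt_le_trans (sqrt_re_ge y l0); rewrite sqrtr_gt0. Qed.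

Lemma sqrt_reM lam y : 0 < lam -> 2 * sqrt_re lam y * sqrt_im lam y = y.
Proof.
move=> l0; rewrite /sqrt_im mulrC divfK//.
by rewrite gt_eqF// mulr_gt0// sqrt_re_gt0.
Qed.

Lemma sqrt_reB lam y : 0 < lam -> sqrt_re lam y ^+ 2 - sqrt_im lam y ^+ 2 = lam.
Proof.
move=> l0; have a0 := sqrt_re_gt0 y l0.
have rE := sqrt_re_sqr y l0; have mE := sqrt_reM y l0.
have /andP[b1 b2] := modulus_bounds y l0.
have m2 : Num.sqrt (lam ^+ 2 + y ^+ 2) ^+ 2 = lam ^+ 2 + y ^+ 2.
  by rewrite sqr_sqrtr// addr_ge0// sqr_ge0.
move: (Num.sqrt _) b1 rE m2 => m b1 rE m2.
have k : (2 * sqrt_re lam y ^+ 2) * (sqrt_re lam y ^+ 2 - sqrt_im lam y ^+ 2 - lam) = 0.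
  transitivity (2 * (sqrt_re lam y ^+ 2) * (sqrt_re lam y ^+ 2 - lam) - (2 * sqrt_re lam y * sqrt_im lam y) ^+ 2 / 2).
    by field.
  rewrite mE rE.
  transitivity ((m ^+ 2 - (lam ^+ 2 + y ^+ 2)) / 2); first by field.
  by rewrite m2 subrr mul0r.
move/eqP: k; rewrite mulf_eq0 => /orP[|]; last by rewrite subr_eq0 => /eqP.
by rewrite mulf_eq0 pnatr_eq0/= expf_eq0/= gt_eqF.
Qed.

(** For two square roots S and S', (S - S') (S + S') is the difference of the arguments, and |S +
    S'| >= 1 because both real parts are at least 1. *)
Lemma sqrt_im_lipschitz lam lam' y y' : 1 <= lam -> 1 <= lam' ->
  `|sqrt_im lam y - sqrt_im lam' y'| <= `|lam - lam'| + `|y - y'|.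
Proof.
move=> l1 l1'; have l0 : 0 < lam by lra. have l0' : 0 < lam' by lra.
pose S := sqrt_re lam y +i* sqrt_im lam y; pose S' := sqrt_re lam' y' +i* sqrt_im lam' y'.
have e : (S - S') * (S + S') = (lam - lam') +i* (y - y').
  apply: complex_ext; rewrite !(cReM, cImM, cReD, cImD, cReN, cImN) /=.
    rewrite -[in RHS](sqrt_reB y l0) -[in RHS](sqrt_reB y' l0'); ring.
  rewrite -[in RHS](sqrt_reM y l0) -[in RHS](sqrt_reM y' l0'); ring.
have h1 : 1 <= ComplexField.Normc.normc (S + S').
  apply: le_trans (normr_Re_le _); rewrite cReD /=.
  have s1 : 1 <= Num.sqrt lam by rewrite -[leLHS]sqrtr1 ler_wsqrtr.
  have := sqrt_re_ge y l0; have := sqrt_re_gt0 y' l0' => a0 a1.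
  by apply: le_trans (ler_norm _); lra.
have h2 := normr_Im_le (S - S'); rewrite cImD cImN /= in h2.
apply: (le_trans h2).
have h3 : ComplexField.Normc.normc (S - S') <= ComplexField.Normc.normc ((S - S') * (S + S')).
  by rewrite normcM ler_peMr ?normc_ge0.
by apply: (le_trans h3); rewrite e; exact: (normc_le_ReIm (_ +i* _)).
Qed.

(** Multiplying (S - S') (S + S') = i (y - y') by the conjugate of S + S' and taking imaginary parts
    gives (g - g') |S + S'|^2 = (y - y') (A + A'). Then A + A' >= 2 sqrt lam, while |S + S'|^2 <= 4
    (lam + Y). *)
Lemma sqrt_im_increasing lam Y y y' : 0 < lam -> `|y| <= Y -> `|y'| <= Y -> y' <= y ->
  (y - y') * (Num.sqrt lam / (2 * (lam + Y))) <= sqrt_im lam y - sqrt_im lam y'.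
Proof.
move=> l0 yY yY' yy.
have a1 := sqrt_re_ge y l0; have a1' := sqrt_re_ge y' l0.
have d1 := sqrt_reB y l0; have d1' := sqrt_reB y' l0.
have m1 := sqrt_reM y l0; have m1' := sqrt_reM y' l0.
have r1 := sqrt_re_sqr y l0; have r1' := sqrt_re_sqr y' l0.
have /andP[_ b] := modulus_bounds y l0; have /andP[_ b'] := modulus_bounds y' l0.
have s0 : 0 < Num.sqrt lam by rewrite sqrtr_gt0.
have Y0 : 0 <= Y by apply: le_trans (normr_ge0 y) yY.
move: (Num.sqrt (lam ^+ 2 + y ^+ 2)) (Num.sqrt (lam ^+ 2 + y' ^+ 2)) b b' r1 r1' => m m' b b' r1 r1'.
move: (sqrt_re lam y) (sqrt_re lam y') (sqrt_im lam y) (sqrt_im lam y') a1 a1' d1 d1' m1 m1' r1 r1' => A A' g g' a1 a1' d1 d1' m1 m1' r1 r1'.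
pose Q := (A + A') ^+ 2 + (g + g') ^+ 2.
have key : (y - y') * (A + A') = (g - g') * Q.
  have : (A ^+ 2 - g ^+ 2) - (A' ^+ 2 - g' ^+ 2) = 0 by rewrite d1 d1' subrr.
  move=> h; rewrite -m1 -m1'.
  transitivity ((g - g') * Q + (g + g') * ((A ^+ 2 - g ^+ 2) - (A' ^+ 2 - g' ^+ 2))); first by rewrite /Q; ring.
  by rewrite h mulr0 addr0.
have Q0 : 0 < Q.
  by rewrite /Q ltr_pwDl ?sqr_ge0// exprn_gt0//; lra.
have QY : Q <= 4 * (lam + Y).
  have h1 : Q <= 2 * (A ^+ 2 + A' ^+ 2 + g ^+ 2 + g' ^+ 2).
    rewrite -subr_ge0 (_ : _ - _ = (A - A') ^+ 2 + (g - g') ^+ 2); last by rewrite /Q; ring.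
    by rewrite addr_ge0// sqr_ge0.
  lra.
have -> : g - g' = (y - y') * ((A + A') / Q).
  by rewrite mulrA key mulfK// gt_eqF.
rewrite ler_wpM2l ?subr_ge0// ler_pdivrMr; last by rewrite mulr_gt0//; lra.
rewrite mulrAC ler_pdivlMr//.
have : Num.sqrt lam * Q <= Num.sqrt lam * (4 * (lam + Y)) by rewrite ler_pM2l.
have : 2 * Num.sqrt lam * (2 * (lam + Y)) <= (A + A') * (2 * (lam + Y)).
  by rewrite ler_wpM2r ?mulr_ge0//; lra.
lra.
Qed.

(** Replacing the real part A by s = sqrt lam costs little: A^2 - s^2 <= |y| / 2, hence A - s <= |y|
    / (4 s). *)
Lemma sqrt_im_approx lam y : 0 < lam ->
  `|sqrt_im lam y - y / (2 * Num.sqrt lam)| <= y ^+ 2 / (8 * lam * Num.sqrt lam).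
Proof.
move=> l0.
have a1 := sqrt_re_ge y l0.
have s0 : 0 < Num.sqrt lam by rewrite sqrtr_gt0.
have s2 : Num.sqrt lam ^+ 2 = lam by rewrite sqr_sqrtr// ltW.
have /andP[_ b] := modulus_bounds y l0; have r1 := sqrt_re_sqr y l0.
rewrite /sqrt_im; move: (sqrt_re lam y) a1 r1 => A a1 r1.
move: (Num.sqrt (lam ^+ 2 + y ^+ 2)) b r1 => m b r1.
move: (Num.sqrt lam) s0 s2 a1 => s s0 s2 a1.
have A0 : 0 < A by lra.
have -> : y / (2 * A) - y / (2 * s) = - (y * (A - s) / (2 * A * s)).
  by field; rewrite !gt_eqF.
rewrite normrN !normrM normfV (ger0_norm (_ : 0 <= A - s)); last by lra.
rewrite (gtr0_norm (_ : 0 < 2 * A * s)); last by rewrite !mulr_gt0.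
have h1 : (A - s) * (2 * s) <= `|y| / 2.
  have : (A - s) * (A + s) <= `|y| / 2.
    have -> : (A - s) * (A + s) = A ^+ 2 - s ^+ 2 by ring.
    rewrite r1 s2; lra.
  apply: le_trans; rewrite ler_wpM2l//; lra.
rewrite ler_pdivrMr; last by rewrite !mulr_gt0.
rewrite mulrAC ler_pdivlMr; last by rewrite !mulr_gt0.
have n0 := normr_ge0 y.
have -> : y ^+ 2 = `|y| ^+ 2 by rewrite real_normK ?num_real.
have -> : `|y| * (A - s) * (8 * lam * s) = 4 * lam * `|y| * ((A - s) * (2 * s)) by ring.
apply: (@le_trans _ _ (4 * lam * `|y| * (`|y| / 2))).
  by rewrite ler_wpM2l// mulr_ge0// mulr_ge0// ltW.
have -> : 4 * lam * `|y| * (`|y| / 2) = `|y| ^+ 2 * (2 * s * s) by rewrite -s2; field.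
by rewrite ler_wpM2l ?sqr_ge0// ler_wpM2r ?(ltW s0)// ler_wpM2l.
Qed.

End real_sqrt.

(** * The curves as zero sets of a real integral *)

Section gamma_curve.
Context {R : realType}.
Local Notation mu := (@lebesgue_measure R).
Local Notation Re := complex.Re.
Local Notation Im := complex.Im.
Local Notation normc := ComplexField.Normc.normc.

(** A change of sign would pass through 0, where m^2 <= p^2 fails. This is how the branch of a
    continuous square root is pinned down on the whole interval. *)
Lemma constant_sign (a b m : R) (p : R -> R) : a <= b -> 0 < m ->
  {within `[a, b], continuous p} -> (forall t, a <= t <= b -> m ^+ 2 <= p t ^+ 2) ->
  (forall t, a <= t <= b -> m <= p t) \/ (forall t, a <= t <= b -> p t <= - m).
Proof.
move=> ab m0 cp hp.
have aI : a <= a <= b by rewrite lexx.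
have dich t : a <= t <= b -> m <= p t \/ p t <= - m.
  move=> /hp h; have [p0|p0] := leP 0 (p t).
    by left; move: h; rewrite ler_pXn2r ?nnegrE// ltW.
  right; rewrite lerNr; move: h; rewrite -(sqrrN (p t)) ler_pXn2r ?nnegrE// ?oppr_ge0 ltW//.
have nosign t : a <= t <= b -> Num.min (p a) (p t) <= 0 <= Num.max (p a) (p t) -> False.
  move=> tab h; have /andP[a_t tb] := tab.
  have [c] := IVT a_t (within_itvS (lexx a) tb cp) h.
  rewrite in_itv/= => /andP[ac ct] pc0.
  have cab : a <= c <= b by rewrite ac (le_trans ct).
  by have := dich c cab; rewrite pc0 => -[]; lra.
have [pa|pa] := dich a aI; [left|right] => t tab; have [h|h] := dich t tab => //; exfalso;
  apply: (nosign t tab); rewrite ge_min le_max; apply/andP; split; apply/orP.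
- by right; lra.
- by left; lra.
- by left; lra.
- by right; lra.
Qed.

Lemma Rintegral_ge_cst (a b m : R) (p : R -> R) : a < b -> {within `[a, b], continuous p} ->
  (forall t, a <= t <= b -> m <= p t) -> (b - a) * m <= \int[mu]_(t in `[a, b]) p t.
Proof.
move=> ab cp hp.
have ab' : a <= b by exact: ltW.
have cst_int : \int[mu]_(t in `[a, b]) (fun=> m) t = m * b - m * a.
  apply: (Rintegral_derive (f := fun t => m * t) ab').
  - by apply: continuous_subspaceT => t; apply: cvgM; [exact: cvg_cst|exact: cvg_id].
  - by apply: continuous_subspaceT => t; exact: cvg_cst.
  - move=> t _; apply: (is_derive_eq (is_deriveM (is_derive_cst m t 1) (is_derive_id t 1))).
    by rewrite /GRing.scale /= mulr0 mulr1 addr0.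
rewrite mulrC mulrBr -cst_int.
apply: le_Rintegral; first exact: measurable_itv.
- by apply: within_integrable; apply: continuous_subspaceT => t; exact: cvg_cst.
- exact: within_integrable.
- by move=> t; rewrite /= in_itv/=; exact: hp.
Qed.

Lemma Rintegral_norm_le_cst (a b m : R) (p : R -> R) : a < b -> {within `[a, b], continuous p} ->
  (forall t, a <= t <= b -> `|p t| <= m) -> `|\int[mu]_(t in `[a, b]) p t| <= (b - a) * m.
Proof.
move=> ab cp hp; rewrite ler_norml; apply/andP; split.
  rewrite -mulrN; apply: Rintegral_ge_cst => // t /hp.
  by rewrite ler_norml => /andP[].
have cN : {within `[a, b], continuous (fun t => - p t)} by move=> t; apply: cvgN; exact: cp.
have h : (b - a) * (- m) <= \int[mu]_(t in `[a, b]) (fun t => - p t) t.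
  apply: Rintegral_ge_cst => // t /hp.
  by rewrite ler_norml lerN2 => /andP[].
have e : \int[mu]_(t in `[a, b]) (fun t => - p t) t = - \int[mu]_(t in `[a, b]) p t.
  rewrite -mulN1r -RintegralZl//; last exact: within_integrable.
  by apply: eq_Rintegral => t _; rewrite mulN1r.
by rewrite e mulrN lerN2 in h.
Qed.

Section fixed_interval.
Context (a b k : R).
Context (a1 : -1 <= a).
Context (ab : a < b).
Context (b1 : b <= 1).

(** For E = lam + i m, a square root of i t^2 + i k - E is i sqrt (lam + i y) with y = m - t^2 - k;
    its real part is minus this function. *)
Definition gfun (lam m t : R) : R := sqrt_im lam (m - t ^+ 2 - k).
Definition gint (lam m : R) : R := \int[mu]_(t in `[a, b]) gfun lam m t.
(** Mean of t^2 + k over [a, b]. *)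
Definition gmean : R := (a ^+ 2 + a * b + b ^+ 2) / 3 + k.

Lemma gfun_continuous lam m : 1 <= lam -> {within `[a, b], continuous (gfun lam m)}.
Proof.
move=> l1; apply: continuous_subspaceT => t.
apply: (@continuous_comp _ _ _ (fun t : R => m - t ^+ 2 - k) (sqrt_im lam)).
  apply: cvgB; last exact: cvg_cst.
  by apply: cvgB; [exact: cvg_cst|rewrite expr2; apply: cvgM; exact: cvg_id].
move: (m - t ^+ 2 - k) => y; apply/cvgrPdist_lt => e e0.
have : \forall z \near y, `|y - z| < e by exact: nbhsx_ballx.
apply: filterS => z hz; apply: (le_lt_trans _ hz).
by apply: (le_trans (sqrt_im_lipschitz y z l1 l1)); rewrite subrr normr0 add0r.
Qed.

Lemma sqr_itv t : a <= t <= b -> 0 <= t ^+ 2 <= 1.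
Proof.
move=> /andP[at_ tb]; rewrite sqr_ge0/=.
have := a1; have := b1; nra.
Qed.

Lemma gint_lipschitz lam lam' m m' : 1 <= lam -> 1 <= lam' ->
  `|gint lam m - gint lam' m'| <= (b - a) * (`|lam - lam'| + `|m - m'|).
Proof.
move=> l1 l1'; rewrite /gint -RintegralB//; [|exact/within_integrable/gfun_continuous..].
apply: Rintegral_norm_le_cst => //.
  by move=> t; apply: cvgB; [exact: gfun_continuous l1 t|exact: gfun_continuous l1' t].
move=> t _; apply: (le_trans (sqrt_im_lipschitz _ _ l1 l1')).
by rewrite (_ : m - t ^+ 2 - k - (m' - t ^+ 2 - k) = m - m')//; ring.
Qed.

Lemma gint_increasing lam m m' : 1 <= lam -> k <= m' <= k + 1 -> k <= m <= k + 1 -> m' <= m ->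
  (b - a) * ((m - m') * (Num.sqrt lam / (2 * (lam + 1)))) <= gint lam m - gint lam m'.
Proof.
move=> l1 /andP[m1' m2'] /andP[m1 m2] mm; rewrite /gint -RintegralB//; [|exact/within_integrable/gfun_continuous..].
apply: Rintegral_ge_cst => //.
  by move=> t; apply: cvgB; exact: gfun_continuous l1 t.
move=> t /sqr_itv/andP[t0 t1].
have -> : m - m' = (m - t ^+ 2 - k) - (m' - t ^+ 2 - k) by ring.
apply: sqrt_im_increasing; first by lra.
- by rewrite ler_norml; apply/andP; split; lra.
- by rewrite ler_norml; apply/andP; split; lra.
- lra.
Qed.

Lemma gint_opp lam m : 1 <= lam ->
  \int[mu]_(t in `[a, b]) (- gfun lam m t) = - gint lam m.
Proof.
move=> l1; rewrite /gint -mulN1r -RintegralZl//; last exact/within_integrable/gfun_continuous.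
by apply: eq_Rintegral => t _; rewrite mulN1r.
Qed.

(** As t^2 lies in [0, 1], m - t^2 - k is nonpositive throughout for m = k and nonnegative for m = k
    + 1; the intermediate value theorem does the rest. *)
Lemma gint_zero_exists lam : 1 <= lam -> exists2 m, k <= m <= k + 1 & gint lam m = 0.
Proof.
move=> l1.
have kk : k <= k + 1 by rewrite lerDl.
have cG : {within `[k, k + 1], continuous (gint lam)}.
  apply: continuous_subspaceT => m; apply/cvgrPdist_lt => e e0.
  have ba : 0 < b - a by rewrite subr_gt0.
  have e0' : 0 < e / (b - a) by exact: divr_gt0.
  have : \forall z \near m, `|m - z| < e / (b - a) by exact: nbhsx_ballx.
  apply: filterS => z; rewrite ltr_pdivlMr// mulrC => hz; apply: (le_lt_trans _ hz).
  by apply: (le_trans (gint_lipschitz m z l1 l1)); rewrite subrr normr0 add0r.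
have l0 : 0 < lam by lra.
have sg y : 0 <= y -> 0 <= sqrt_im lam y.
  by move=> y0; rewrite divr_ge0// mulr_ge0// ltW// sqrt_re_gt0.
have sgN y : y <= 0 -> sqrt_im lam y <= 0.
  by move=> y0; rewrite mulr_le0_ge0// invr_ge0 mulr_ge0// ltW// sqrt_re_gt0.
have G1 : 0 <= gint lam (k + 1).
  have := @Rintegral_ge_cst a b 0 (gfun lam (k + 1)) ab (@gfun_continuous lam (k + 1) l1).
  by rewrite mulr0; apply => t /sqr_itv/andP[t0 t1]; apply: sg; lra.
have G0 : gint lam k <= 0.
  have cN : {within `[a, b], continuous (fun t => - gfun lam k t)}.
    by move=> t; apply: cvgN; exact: gfun_continuous.
  have := @Rintegral_ge_cst a b 0 _ ab cN.
  rewrite mulr0 gint_opp// oppr_ge0; apply => t /sqr_itv/andP[t0 t1].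
  by rewrite oppr_ge0; apply: sgN; lra.
have [|m] := @IVT R (gint lam) k (k + 1) 0 kk cG.
  by move: (gint lam k) (gint lam (k + 1)) G0 G1 => x y x0 y0; rewrite ge_min le_max x0 y0 orbT.
by rewrite in_itv; exists m.
Qed.

Lemma integral_sqr m : \int[mu]_(t in `[a, b]) (m - t ^+ 2 - k) = (b - a) * (m - gmean).
Proof.
have cs (x : R) : {within `[a, b], continuous (fun t : R => x - t ^+ 2 - k)}.
  apply: continuous_subspaceT => t; apply: cvgB; last exact: cvg_cst.
  by apply: cvgB; [exact: cvg_cst|rewrite expr2; apply: cvgM; exact: cvg_id].
have -> : (b - a) * (m - gmean) = ((m - k) * b - b ^+ 3 / 3) - ((m - k) * a - a ^+ 3 / 3).
  by rewrite /gmean; field.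
apply: (Rintegral_derive (f := fun t => (m - k) * t - t ^+ 3 / 3) (ltW ab)) => //.
- apply: continuous_subspaceT => t; apply: cvgB.
    by apply: cvgM; [exact: cvg_cst|exact: cvg_id].
  by apply: cvgM; [exact: exprn_continuous|exact: cvg_cst].
- move=> t _; apply: is_derive_eq; rewrite /GRing.scale /=.
  by field.
Qed.

(** Linearising the square root at y = 0 replaces [gint] by (b - a) (m - gmean) / (2 sqrt lam). The
    error per unit length is at most 1 / (8 lam sqrt lam), which after division by the slope leaves
    1 / (4 lam). *)
Lemma gint_zero_near lam m : 1 <= lam -> k <= m <= k + 1 -> gint lam m = 0 ->
  `|m - gmean| <= lam^-1.
Proof.
move=> l1 /andP[m1 m2] G0; have l0 : 0 < lam by lra.
have s0 : 0 < Num.sqrt lam by rewrite sqrtr_gt0.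
have ba : 0 < b - a by rewrite subr_gt0.
pose q t := (m - t ^+ 2 - k) / (2 * Num.sqrt lam).
have cq0 : {within `[a, b], continuous (fun t : R => m - t ^+ 2 - k)}.
  apply: continuous_subspaceT => t; apply: cvgB; last exact: cvg_cst.
  by apply: cvgB; [exact: cvg_cst|rewrite expr2; apply: cvgM; exact: cvg_id].
have cq : {within `[a, b], continuous q}.
  by move=> t; apply: cvgM; [exact: cq0|exact: cvg_cst].
have : `|\int[mu]_(t in `[a, b]) (gfun lam m t - q t)| <= (b - a) * (1 / (8 * lam * Num.sqrt lam)).
  apply: Rintegral_norm_le_cst => //.
    by move=> t; apply: cvgB; [exact: gfun_continuous l1 t|exact: cq].
  move=> t /sqr_itv/andP[t0 t1]; apply: (le_trans (sqrt_im_approx _ l0)).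
  rewrite ler_wpM2r//; first by rewrite invr_ge0 !mulr_ge0// ltW.
  by nra.
rewrite RintegralB//; [|exact/within_integrable/gfun_continuous|exact/within_integrable].
rewrite -/(gint lam m) G0 sub0r normrN RintegralZr//; last exact: within_integrable.
rewrite integral_sqr -(mulrA (b - a)) (normrM (b - a)) (gtr0_norm ba) ler_pM2l// normrM.
rewrite (gtr0_norm (_ : 0 < (2 * Num.sqrt lam)^-1)); last by rewrite invr_gt0 mulr_gt0.
rewrite ler_pdivrMr; last by rewrite mulr_gt0.
move=> h; apply: (le_trans h).
have -> : 1 / (8 * lam * Num.sqrt lam) * (2 * Num.sqrt lam) = lam^-1 * 4^-1.
  by field; rewrite !gt_eqF.
by rewrite ler_piMr ?invr_ge0 ?(ltW l0)//; lra.
Qed.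

(** A quantitative implicit function argument: per unit length, [gint] increases in m with slope at
    least 1 / (2 (lam + 1)) and is 1-Lipschitz in lam. It makes the zero a continuous function of
    lam. *)
Lemma gint_zero_lipschitz lam lam' m m' : 1 <= lam -> 1 <= lam' ->
  k <= m <= k + 1 -> k <= m' <= k + 1 -> gint lam m = 0 -> gint lam' m' = 0 ->
  `|m - m'| <= (2 * (lam + 1)) * `|lam - lam'|.
Proof.
move=> l1 l1' hm hm' G0 G0'.
have l0 : 0 < lam by lra.
have ba : 0 < b - a by rewrite subr_gt0.
have s1 : 1 <= Num.sqrt lam by rewrite -[leLHS]sqrtr1 ler_wsqrtr.
have kp : 0 < 2 * (lam + 1) by lra.
have h1 : (b - a) * (`|m - m'| / (2 * (lam + 1))) <= `|gint lam m - gint lam m'|.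
  have base x y : k <= x <= k + 1 -> k <= y <= k + 1 -> y <= x ->
     (b - a) * (`|x - y| / (2 * (lam + 1))) <= `|gint lam x - gint lam y|.
    move=> hx hy yx; apply: le_trans (ler_norm _).
    apply: le_trans (gint_increasing l1 hy hx yx); rewrite ler_pM2l//.
    rewrite ger0_norm ?subr_ge0// ler_wpM2l ?subr_ge0//.
    by rewrite -[leLHS]mul1r ler_wpM2r// invr_ge0 ltW.
  have [mm|mm] := leP m' m; first exact: base.
  by rewrite distrC [leRHS]distrC; apply: base => //; exact: ltW.
have h2 := gint_lipschitz m' m' l1 l1'.
rewrite G0' subr0 subrr normr0 addr0 in h2.
rewrite G0 sub0r normrN in h1.
have := le_trans h1 h2; rewrite ler_pM2l// ler_pdivrMr//.
by rewrite mulrC.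
Qed.

Local Notation Gam := (Gamma a b (fun t : R => 0 +i* (t ^+ 2 + k))).

Lemma Gamma_of_zero lam m : 1 <= lam -> gint lam m = 0 -> Gam (lam +i* m).
Proof.
move=> l1 G0; have l0 : 0 < lam by lra.
exists (fun t => (- gfun lam m t) +i* sqrt_re lam (m - t ^+ 2 - k)); split.
- move=> x; apply/cvg_complexP; split => /=.
    by apply: cvgN; exact: gfun_continuous.
  have c : {within `[a, b], continuous (fun t : R => sqrt_re lam (m - t ^+ 2 - k))}.
    apply: continuous_subspaceT => t; rewrite /sqrt_re.
    apply: (@continuous_comp _ _ _ (fun t : R => (Num.sqrt (lam ^+ 2 + (m - t ^+ 2 - k) ^+ 2) + lam) / 2) Num.sqrt); last exact: sqrt_continuous.
    apply: cvgM; last exact: cvg_cst.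
    apply: cvgD; last exact: cvg_cst.
    apply: (@continuous_comp _ _ _ (fun t : R => lam ^+ 2 + (m - t ^+ 2 - k) ^+ 2) Num.sqrt); last exact: sqrt_continuous.
    apply: cvgD; first exact: cvg_cst.
    apply: (@continuous_comp _ _ _ (fun t : R => m - t ^+ 2 - k) (fun y => y ^+ 2)); last exact: exprn_continuous.
    apply: cvgB; last exact: cvg_cst.
    by apply: cvgB; [exact: cvg_cst|exact: exprn_continuous].
  exact: c.
- move=> t _; set y := m - t ^+ 2 - k.
  have e1 := sqrt_reB y l0; have e2 := sqrt_reM y l0.
  rewrite expr2; apply: complex_ext; rewrite !(cReM, cImM, cReD, cImD, cReN, cImN) /= /gfun -/y.
    by rewrite -[in RHS]e1; ring.
  rewrite (_ : t ^+ 2 + k - m = - y); last by rewrite /y; ring.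
  by rewrite -[in RHS]e2; ring.
- have e := gint_opp m l1; rewrite G0 oppr0 in e.
  exact: e.
Qed.

(** The number W - E keeps away from the negative real axis and 0, so the square root keeps away
    from the imaginary axis. Its real part has constant sign and cannot integrate to 0. *)
Lemma no_Gamma lam m d : 0 < d -> Gam (lam +i* m) ->
  ~ (forall t, a <= t <= b -> lam <= - d \/ d <= `|m - t ^+ 2 - k|).
Proof.
move=> d0 [s [cs hs s0]] hd.
have cp : {within `[a, b], continuous (fun t => Re (s t))}.
  by move=> x; have /cvg_complexP[] := cs x.
(* [x0] solves 4 x0 (d + |lam|) = d^2. If p = Re (s)^2 were below x0, the squared imaginary part 4 p
   (p + lam) of s^2 would be below d^2; and x0 <= d handles the alternative lam <= - d. *)
pose x0 := d ^+ 2 / (4 * (d + `|lam|)).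
have den : 0 < d + `|lam| by rewrite ltr_pwDl.
have x00 : 0 < x0 by rewrite divr_gt0 ?exprn_gt0 ?mulr_gt0.
have xd : x0 <= d.
  rewrite ler_pdivrMr ?mulr_gt0//; have := normr_ge0 lam; nra.
have x0E : 4 * x0 * (d + `|lam|) = d ^+ 2 by rewrite /x0; field; rewrite gt_eqF.
move: x0 x00 xd x0E => x0 x00 xd x0E.
have hp t : a <= t <= b -> Num.sqrt x0 ^+ 2 <= Re (s t) ^+ 2.
  move=> tab; rewrite sqr_sqrtr; last exact: ltW.
  have := hs t tab; rewrite expr2 => e.
  have e1 := congr1 (@complex.Re R) e; have e2 := congr1 (@complex.Im R) e.
  rewrite !(cReM, cImM, cReD, cImD, cReN, cImN) /= in e1 e2.
  have q2 := sqr_ge0 (Im (s t)).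
  rewrite leNgt; apply/negP => lt.
  case: (hd t tab) => hy; first by nra.
  have l1 := ler_norm lam; have p2 := sqr_ge0 (Re (s t)).
  have yE : (m - t ^+ 2 - k) ^+ 2 = 4 * Re (s t) ^+ 2 * (Re (s t) ^+ 2 + lam).
    transitivity (4 * Re (s t) ^+ 2 * Im (s t) ^+ 2); last by congr (_ * _); lra.
    transitivity ((2 * (Re (s t) * Im (s t))) ^+ 2); last by ring.
    by rewrite -sqrrN; congr (_ ^+ 2); lra.
  have dy : d ^+ 2 <= (m - t ^+ 2 - k) ^+ 2.
    by rewrite -(real_normK (num_real (m - _ - k))) ler_pXn2r ?nnegrE// ltW.
  have : 4 * Re (s t) ^+ 2 * (Re (s t) ^+ 2 + lam) <= 4 * Re (s t) ^+ 2 * (d + `|lam|).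
    by apply: ler_wpM2l; [exact: mulr_ge0|lra].
  have : 4 * Re (s t) ^+ 2 * (d + `|lam|) < 4 * x0 * (d + `|lam|).
    by rewrite ltr_pM2r// ltr_pM2l.
  lra.
have sx : 0 < Num.sqrt x0 by rewrite sqrtr_gt0.
have ba : 0 < b - a by rewrite subr_gt0.
have bas := mulr_gt0 ba sx.
have [h|h] := constant_sign (ltW ab) sx cp hp.
  by have := Rintegral_ge_cst ab cp h; rewrite /cintegral /= in s0; rewrite s0; lra.
have cN : {within `[a, b], continuous (fun t => - Re (s t))} by move=> t; apply: cvgN; exact: cp.
have hN t : a <= t <= b -> Num.sqrt x0 <= - Re (s t) by move=> /h; rewrite lerNr.
have i0 : \int[mu]_(t in `[a, b]) - Re (s t) = 0.
  rewrite (@eq_Rintegral _ _ _ mu _ (fun t => -1 * Re (s t))); last by move=> t _; rewrite mulN1r.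
  rewrite RintegralZl//; last exact: within_integrable.
  by rewrite /cintegral /= in s0; rewrite s0 mulr0.
by have := Rintegral_ge_cst ab cN hN; rewrite i0; lra.
Qed.

(** [no_Gamma] first confines m to [k, k + 1], so that |E| large means |lam| >= 1, and then excludes
    lam <= -1. For lam >= 1 the imaginary part of the root is at least 1 in modulus, hence of
    constant sign, which identifies the branch as i sqrt (lam + i y) or its opposite. *)
Lemma zero_of_Gamma lam m : Gam (lam +i* m) -> 2 + `|k| <= normc (lam +i* m) ->
  [/\ k <= m <= k + 1, normc (lam +i* m) <= lam + (`|k| + 1), 1 <= lam & gint lam m = 0].
Proof.
move=> G hE.
have mk : k <= m <= k + 1.
  rewrite !leNgt; apply/andP; split; apply/negP => h.
    apply: (@no_Gamma lam m (k - m)) => //; first by rewrite subr_gt0.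
    move=> t /sqr_itv/andP[t0 t1]; right; rewrite -normrN; apply: le_trans (ler_norm _); lra.
  apply: (@no_Gamma lam m (m - (k + 1))) => //; first by rewrite subr_gt0.
  move=> t /sqr_itv/andP[t0 t1]; right; apply: le_trans (ler_norm _); lra.
have /andP[m1 m2] := mk.
have mn : `|m| <= `|k| + 1.
  have := ler_norm k; have := ler_norm (- k); rewrite normrN => ? ?.
  by rewrite ler_norml; apply/andP; split; lra.
have El := normc_le_ReIm (lam +i* m); rewrite /= in El hE.
have lamn : 1 <= `|lam| by rewrite /=; lra.
have l1 : 1 <= lam.
  have [l0|l0] := leP 0 lam; first by rewrite ger0_norm in lamn.
  exfalso; apply: (@no_Gamma lam m 1) => // t _; left.
  by rewrite ltr0_norm// in lamn; lra.
have l0 : 0 < lam by lra.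
split => //; first by rewrite /=; rewrite (gtr0_norm l0) in El; lra.
have [s [cs hs s0]] := G.
have cp : {within `[a, b], continuous (fun t => Re (s t))}.
  by move=> x; have /cvg_complexP[] := cs x.
have cq : {within `[a, b], continuous (fun t => Im (s t))}.
  by move=> x; have /cvg_complexP[] := cs x.
have rel t : a <= t <= b -> Im (s t) ^+ 2 - Re (s t) ^+ 2 = lam /\
    2 * Re (s t) * Im (s t) = - (m - t ^+ 2 - k).
  move=> /hs; rewrite expr2 => e.
  have e1 := congr1 (@complex.Re R) e; have e2 := congr1 (@complex.Im R) e.
  rewrite !(cReM, cImM, cReD, cImD, cReN, cImN) /= in e1 e2.
  by split; lra.
have hq t : a <= t <= b -> 1 ^+ 2 <= Im (s t) ^+ 2.
  by move=> /rel[e _]; have := sqr_ge0 (Re (s t)); rewrite expr1n; lra.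
(* Both q^2 and A^2 solve x (x - lam) = y^2 / 4, and their sum exceeds lam, which leaves only q =
   A. *)
have key q p y : 1 <= q -> q ^+ 2 - p ^+ 2 = lam -> 2 * p * q = - y -> p = - sqrt_im lam y.
  move=> q1 e1 e2.
  have f1 := sqrt_reB y l0; have f2 := sqrt_reM y l0; have f0 := sqrt_re_gt0 y l0.
  move: (sqrt_re lam y) (sqrt_im lam y) f1 f2 f0 => A g f1 f2 f0.
  have h : (q ^+ 2 - A ^+ 2) * (q ^+ 2 + A ^+ 2 - lam) = 0.
    transitivity (((2 * p * q) ^+ 2 - (2 * A * g) ^+ 2) / 4
       + q ^+ 2 * (q ^+ 2 - p ^+ 2 - lam) - A ^+ 2 * (A ^+ 2 - g ^+ 2 - lam)); first by field.
    by rewrite e1 f1 e2 f2 sqrrN !subrr !mulr0 mul0r addr0 subr0.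
  have qA : q = A.
    have pos : 0 < q ^+ 2 + A ^+ 2 - lam.
      by have := sqr_ge0 p; have := exprn_gt0 2 f0; lra.
    move/eqP: h; rewrite mulf_eq0 (gt_eqF pos) orbF subr_eq0 eqrXn2 //; first by move/eqP.
      lra.
    exact: ltW.
  have : 2 * q * (p + g) = 0 by rewrite qA in e2 *; lra.
  move=> /eqP; rewrite mulf_eq0 => /orP[|]; last by rewrite addr_eq0 => /eqP.
  by rewrite mulf_eq0 pnatr_eq0 /= gt_eqF//; lra.
rewrite /cintegral /= in s0.
have [h|h] := constant_sign (ltW ab) ltr01 cq hq.
  rewrite -[RHS]oppr0 -s0 -mulN1r -RintegralZl//; last exact: within_integrable.
  apply: eq_Rintegral => t /set_mem/=; rewrite in_itv/= => tab.
  have [r1 r2] := rel t tab.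
  by rewrite (key _ _ _ (h t tab) r1 r2) mulN1r opprK.
rewrite -s0; apply: eq_Rintegral => t /set_mem/=; rewrite in_itv/= => tab.
have [r1 r2] := rel t tab.
have q1 : 1 <= - Im (s t) by have := h t tab; lra.
have r1' : (- Im (s t)) ^+ 2 - (- Re (s t)) ^+ 2 = lam by rewrite !sqrrN.
have r2' : 2 * (- Re (s t)) * (- Im (s t)) = - (m - t ^+ 2 - k) by rewrite -r2; ring.
by rewrite /gfun -[LHS]opprK -(key _ _ _ q1 r1' r2') opprK.
Qed.

Lemma Gamma_near_line : near_at_infinity Gam (hline gmean).
Proof.
move=> eta eta0; exists (3 + `|k| + eta^-1 + 1).
  by have := normr_ge0 k; have : 0 < eta^-1 by [rewrite invr_gt0]; lra.
move=> [lam m] G hE.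
have k0 := normr_ge0 k; have ei : 0 < eta^-1 by rewrite invr_gt0.
have [|mk El l1 G0] := zero_of_Gamma G; first by apply: le_trans hE; lra.
exists (lam +i* gmean); first by exists lam.
have -> : lam +i* m - (lam +i* gmean) = 0 +i* (m - gmean).
  by apply: complex_ext; rewrite ?cReD ?cImD ?cReN ?cImN /= ?subrr.
apply: (le_lt_trans (normc_le_ReIm _)); rewrite /= normr0 add0r.
apply: (le_lt_trans (gint_zero_near l1 mk G0)).
rewrite -[ltRHS]invrK ltf_pV2 ?posrE//; last by lra.
by have := le_trans hE El; lra.
Qed.

Lemma Gamma_point lam : 1 <= lam -> exists2 m, Gam (lam +i* m) & `|m - gmean| <= lam^-1.
Proof.
move=> l1; have [m mk G0] := gint_zero_exists l1.
exists m; first exact: Gamma_of_zero.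
exact: gint_zero_near.
Qed.

Lemma Gamma_tends_to_infinity : tends_to_infinity Gam.
Proof.
have ex lam : {m | 1 <= lam -> k <= m <= k + 1 /\ gint lam m = 0}.
  apply: cid; have [l1|l1] := leP 1 lam.
    by have [m ? ?] := gint_zero_exists l1; exists m.
  by exists 0.
(* The zeros are picked by choice, and their continuity in lam comes from [gint_zero_lipschitz]. The
   truncation max 1 t keeps the parameter where a zero exists, so the curve is defined for all real
   t. *)
pose mf lam := sval (ex lam); pose L (t : R) := Num.max 1 t.
have L1 t : 1 <= L t by rewrite le_max lexx.
have mP t : k <= mf (L t) <= k + 1 /\ gint (L t) (mf (L t)) = 0 := svalP (ex (L t)) (L1 t).
have LL t t' : `|L t - L t'| <= `|t - t'|.
  rewrite /L /Num.max; have n1 := ler_norm (t - t'); have n2 := ler_norm (- (t - t')).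
  rewrite normrN in n2.
  by rewrite ler_norml; case: ltP => ?; case: ltP => ?; apply/andP; split; lra.
exists (fun t => L t +i* mf (L t)); split.
- move=> t; apply/cvg_complexP; split => /=.
    apply/cvgrPdist_lt => e e0.
    have : \forall z \near t, `|t - z| < e by exact: nbhsx_ballx.
    by apply: filterS => z hz; apply: (le_lt_trans _ hz); exact: LL.
  apply/cvgrPdist_lt => e e0.
  have kp : 0 < 2 * (L t + 1) by have := L1 t; lra.
  have e0' : 0 < e / (2 * (L t + 1)) by exact: divr_gt0.
  have : \forall z \near t, `|t - z| < e / (2 * (L t + 1)) by exact: nbhsx_ballx.
  apply: filterS => z; rewrite ltr_pdivlMr// mulrC => hz; apply: (le_lt_trans _ hz).
  have [h1 h2] := mP t; have [h1' h2'] := mP z.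
  apply: (le_trans (gint_zero_lipschitz (L1 t) (L1 z) h1 h1' h2 h2')).
  by rewrite ler_pM2l.
- by move=> t; apply: Gamma_of_zero; [exact: L1|exact: (mP t).2].
- apply/cvgryPge => A; near=> t.
  have At : A <= t by near: t; apply: nbhs_pinfty_ge; exact: num_real.
  apply: (le_trans At); apply: le_trans (normr_Re_le _) => /=.
  by apply: le_trans (ler_norm _); rewrite le_max lexx orbT.
Unshelve. all: by end_near. Qed.

End fixed_interval.
End gamma_curve.

(** * Location of the limit spectrum *)

Section limit_spectrum.
Context {R : realType}.
Local Notation Re := complex.Re.
Local Notation Im := complex.Im.
Local Notation normc := ComplexField.Normc.normc.
Implicit Types (h delta beta : R) (E : R[i]).

Lemma spectrum_halfstrip h delta beta E : -1 < beta < 1 -> 0 < h -> 0 < delta ->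
  spectrum (Pop h delta beta) E -> 0 <= Re E /\ - delta <= Im E <= 1 + delta.
Proof.
move=> hb h0 d0; case: E => lam m /(spectrum_strong_solution hb h0)[u [v [sol u1 u2 v1]]] /=.
have no : ~ (lam < 0 \/ m < - delta \/ 1 + delta < m).
  move=> /(strong_solution_outside_trivial hb h0 d0)/(_ sol u1 u2) /eqP.
  by rewrite v1 oner_eq0.
split; first by rewrite leNgt; apply/negP => ?; apply: no; left.
by apply/andP; split; rewrite leNgt; apply/negP => ?; apply: no; right; [left|right].
Qed.

(** The limit point is fixed before h tends to 0, so the threshold on h may depend on its real part
    while [r] does not. Working with eta / 2 leaves room for replacing the limit point by a spectral
    value close to it. *)
Lemma lim_spectrum_near_means (beta delta eta : R) :
  -1 < beta < 1 -> 0 < delta -> 0 < eta ->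
  exists2 r, 0 < r & forall E, lim_spectrum delta beta E -> r <= normc E ->
    normc E <= Re E + (1 + delta) /\
    (`|Im E - ((beta ^+ 2 - beta + 1) / 3 - delta)| < eta \/
     `|Im E - ((beta ^+ 2 + beta + 1) / 3 + delta)| < eta).
Proof.
move=> hb d0 eta0.
have eta2 : 0 < eta / 2 by exact: divr_gt0.
have [R0 R00 triv] := strong_solution_trivial hb d0 eta2.
exists (R0 + 1 + (1 + delta)); first by lra.
move=> E0 [h [E [hpos h_lim spE]]] /cvg_complexP[ReE ImE] nE.
have strip j := spectrum_halfstrip hb (hpos j) d0 (spE j).
have Re0 : 0 <= Re E0.
  by apply: (cvgr_to_ge ReE); apply: nearW => j; have [] := strip j.
have Im0 : - delta <= Im E0.
  by apply: (cvgr_to_ge ImE); apply: nearW => j; have [_ /andP[]] := strip j.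
have Im1 : Im E0 <= 1 + delta.
  by apply: (cvgr_to_le ImE); apply: nearW => j; have [_ /andP[]] := strip j.
have Imn : `|Im E0| <= 1 + delta by rewrite ler_norml; apply/andP; split; lra.
have nle := normc_le_ReIm E0; rewrite (ger0_norm Re0) in nle.
split; first by lra.
have [hL|hL] := ltP (`|Im E0 - ((beta ^+ 2 - beta + 1) / 3 - delta)|) eta; first by left.
have [hR|hR] := ltP (`|Im E0 - ((beta ^+ 2 + beta + 1) / 3 + delta)|) eta; first by right.
exfalso.
have Rp : 0 < Re E0 + 1 by lra.
(* Spectral values close to E0 have real part at most Re E0 + 1, which bounds 1 / lam from below
   along the sequence. *)
have [h0 h00 triv'] := triv (Re E0 + 1)^-1 (ltac:(by rewrite invr_gt0)).
suff [j [hj [Ej [Ej' Imj]]]] : exists j, h j < h0 /\ R0 <= Re (E j) /\ Re (E j) <= Re E0 + 1 /\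
    `|Im E0 - Im (E j)| < eta / 2.
  have [u [v [sol u1 u2 v1]]] := spectrum_strong_solution hb (hpos j) (spE j).
  have [_ Imb] := strip j.
  have EjE : E j = Re (E j) +i* Im (E j) by case: (E j).
  rewrite EjE in sol.
  have far c : eta <= `|Im E0 - c| -> eta / 2 <= `|Im (E j) - c|.
    move=> hc; have : `|Im E0 - c| <= `|Im E0 - Im (E j)| + `|Im (E j) - c|.
      by apply: le_trans (ler_normD _ _); rewrite addrA subrK.
    lra.
  have inv : (Re E0 + 1)^-1 <= (Re (E j))^-1 by rewrite lef_pV2 ?posrE//; lra.
  have hj' : 0 < h j < h0 by rewrite hpos.
  have := triv' _ _ _ _ _ hj' Ej inv Imb (far _ hL) (far _ hR) sol u1 u2.
  by move=> /eqP; rewrite v1 oner_eq0.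
have n1 : \forall j \near \oo, h j < h0 by exact: (cvgr_lt _ h_lim).
have n2 : \forall j \near \oo, `|Re E0 - Re (E j)| < 1 by move/cvgrPdist_lt : ReE => /(_ _ ltr01).
have n3 : \forall j \near \oo, `|Im E0 - Im (E j)| < eta / 2 by move/cvgrPdist_lt : ImE => /(_ _ eta2).
have [N _ hN] : \forall j \near \oo, h j < h0 /\ `|Re E0 - Re (E j)| < 1 /\ `|Im E0 - Im (E j)| < eta / 2.
  by near=> j; split; [near: j|split; near: j].
have [k1 [k2 k3]] := hN N (leqnn N).
move: k2; rewrite ltr_norml => /andP[k2 k2'].
by exists N; split => //; split; [lra|split; [lra|]].
Unshelve. all: by end_near. Qed.

End limit_spectrum.

Unset Implicit Arguments.

Theorem theorem12 (R : realType) (beta delta : R)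
    (hbeta : -1 < beta < 1) (hdelta : 0 < delta) :
  [/\ near_at_infinity (lim_spectrum delta beta)
        (Gamma_left delta beta `|` Gamma_right delta beta),
      tends_to_infinity (Gamma_left delta beta) /\
      near_at_infinity (Gamma_left delta beta)
        (hline ((beta ^+ 2 - beta + 1) / 3 - delta))
    & tends_to_infinity (Gamma_right delta beta) /\
      near_at_infinity (Gamma_right delta beta)
        (hline ((beta ^+ 2 + beta + 1) / 3 + delta))].
Proof.
have /andP[b1 b2] := hbeta.
have le1 : -1 <= -1 :> R by [].
have le1' : 1 <= 1 :> R by [].
have meanL : gmean (-1) beta (- delta) = (beta ^+ 2 - beta + 1) / 3 - delta.
  by rewrite /gmean; ring.
have meanR : gmean beta 1 delta = (beta ^+ 2 + beta + 1) / 3 + delta.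
  by rewrite /gmean; ring.
split.
- move=> eta eta0.
  have eta2 : 0 < eta / 2 by exact: divr_gt0.
  have [r r0 hr] := lim_spectrum_near_means hbeta hdelta eta2.
  have ei : 0 < (eta / 2)^-1 by rewrite invr_gt0.
  exists (r + 1 + (1 + delta) + (eta / 2)^-1); first by lra.
  move=> E limE nE.
  have rE : r <= ComplexField.Normc.normc E by lra.
  have [lamE near] := hr E limE rE.
  have lam_ge : 1 + (eta / 2)^-1 <= complex.Re E by lra.
  have lam1 : 1 <= complex.Re E by lra.
  have lam2 : (complex.Re E)^-1 <= eta / 2.
    by rewrite -[leRHS]invrK lef_pV2 ?posrE//; lra.
  (* The curve is met at the real part of [E]: half of [eta] is spent between Im E and the mean, the
     other half between the mean and the curve. *)
  have close c m : `|complex.Im E - c| < eta / 2 -> `|m - c| <= (complex.Re E)^-1 ->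
      ComplexField.Normc.normc (E - (complex.Re E +i* m)) < eta.
    move=> h1 h2; have -> : E - (complex.Re E +i* m) = 0 +i* (complex.Im E - m).
      by apply: complex_ext; rewrite ?cReD ?cImD ?cReN ?cImN /= ?subrr.
    apply: (le_lt_trans (normc_le_ReIm _)); rewrite /= normr0 add0r.
    have : `|complex.Im E - m| <= `|complex.Im E - c| + `|m - c|.
      by rewrite (distrC m); apply: le_trans (ler_normD _ _); rewrite addrA subrK.
    lra.
  case: near => hc.
    have [m Gm hm] := Gamma_point (- delta) le1 b1 (ltW b2) lam1.
    exists (complex.Re E +i* m); first by left.
    by apply: close hc _; rewrite -meanL.
  have [m Gm hm] := Gamma_point delta (ltW b1) b2 le1' lam1.
  exists (complex.Re E +i* m); first by right.
  by apply: close hc _; rewrite -meanR.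
- split; first exact: (Gamma_tends_to_infinity (- delta) le1 b1 (ltW b2)).
  by rewrite -meanL; exact: (Gamma_near_line (- delta) le1 b1 (ltW b2)).
- split; first exact: (Gamma_tends_to_infinity delta (ltW b1) b2 le1').
  by rewrite -meanR; exact: (Gamma_near_line delta (ltW b1) b2 le1').
Qed.
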